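(* Let $-\infty<a<b<\infty$ and let $X=[a,b]\times\mathbb{T}^{d-1}$. Let $\mu$ be a finite signed measure with support in $X$ which is pseudo-positive on $X$. Suppose that $$C:=\sum_{k\in\mathbb{Z}^{d-1}}\int_X e^{i\langle k,y\rangle}\,d\mu(t,y)<\infty .$$ Then for each natural number $s\ge1$ there exists a unique finite signed measure $\sigma^{(2s)}$ with support in $X$ such that (i) the support of each component measure $\sigma^{(2s)}_k$, $k\in\mathbb{Z}^{d-1}$, is in $[a,b]$ and has cardinality $\le 2s$; (ii) $\int f\,d\mu=\int f\,d\sigma^{(2s)}$ for all functions $f\in PH^{2s}(X)$; (iii) $\sigma^{(2s)}$ is pseudo-positive on $X$.
   Context: Fix an integer $d\ge2$. $\mathbb{T}^{d-1}=(\mathbb{R}/2\pi\mathbb{Z})^{d-1}$ is the $(d-1)$-dimensional torus; functions on $X=[a,b]\times\mathbb{T}^{d-1}$ are identified with functions $f(t,y)$ on $[a,b]\times\mathbb{R}^{d-1}$ that are $2\pi$-periodic in each coordinate of $y$. $\langle k,y\rangle$ is the Euclidean inner product. $PH^{2s}(X)$ is the space of continuous functions $f:X\to\mathbb{C}$ whose periodic extension satisfies $\Delta^{2s}f=0$ (polyharmonic of order $2s$) in the interior $(a,b)\times\mathbb{R}^{d-1}$, where $\Delta$ is the Laplace operator in the $d$ variables $x=(t,y)$ and $\Delta^{2s}$ is its $2s$-th iterate. Signed measures are real-valued and $\sigma$-additive on Borel sets. A signed measure $\mu$ on $\mathbb{R}\times\mathbb{T}^{d-1}$ with support in $X$ is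 pseudo-positive (on the cylinder $X$) if for each $k\in\mathbb{Z}^{d-1}$ and each non-negative continuous compactly supported $h:\mathbb{R}\to[0,\infty)$ one has $\int_X h(t)e^{i\langle k,y\rangle}\,d\mu(t,y)\ge0$ (in particular the integral is real). For such $\mu$ and $k\in\mathbb{Z}^{d-1}$ the component measure $\mu_k$ is the unique non-negative measure on $\mathbb{R}$ with $\int_{-\infty}^{\infty}h(t)\,d\mu_k(t)=\int_X h(t)e^{i\langle k,y\rangle}\,d\mu(t,y)$ for all continuous compactly supported $h$. *)

(* Defs.v *)
From HB Require Import structures.
From mathcomp Require Import all_boot all_order all_algebra.
From mathcomp Require Import all_classical all_reals all_analysis.
From mathcomp Require Import complex.

Set Implicit Arguments.
Unset Strict Implicit.
Unset Printing Implicit Defensive.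

Import Order.TTheory GRing.Theory Num.Theory.
Import numFieldNormedType.Exports.

Local Open Scope classical_set_scope.
Local Open Scope quotient_scope.
Local Open Scope complex_scope.
Local Open Scope ring_scope.

Section circle.
Variable R : realType.

Definition circle_rel (x y : R) : bool :=
  `[< exists m : int, x - y = 2 * pi * m%:~R >].

Lemma circle_rel_refl : reflexive circle_rel.
Proof. by move=> x; apply/asboolP; exists 0; rewrite subrr mulr0. Qed.

Lemma circle_rel_sym : symmetric circle_rel.
Proof.
suff H x y : circle_rel x y -> circle_rel y x.
  by move=> x y; apply/idP/idP; exact: H.
by move=> /asboolP[m xy]; apply/asboolP; exists (- m);
  rewrite -[LHS]opprB xy mulrNz mulrN.
Qed.

Lemma circle_rel_trans : transitive circle_rel.
Proof.
move=> y x z /asboolP[m xy] /asboolP[m' yz]; apply/asboolP; exists (m + m').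
by rewrite -(subrKA y) xy yz -mulrDr -intrD.
Qed.

Canonical circle_equiv :=
  EquivRel circle_rel circle_rel_refl circle_rel_sym circle_rel_trans.

Definition circle := quotient_topology {eq_quot circle_equiv}.

HB.instance Definition _ := PointedTopological.on circle.
HB.instance Definition _ := Quotient.on circle.

End circle.

(* Matrices carry the product topology. *)
Definition torus (R : realType) (n : nat) := 'rV[circle R]_n.
HB.instance Definition _ (R : realType) (n : nat) :=
  PointedTopological.on (torus R n).

Definition torus_proj (R : realType) (n : nat) (y : 'rV[R]_n) : torus R n :=
  \row_j \pi_(circle R) (y 0 j).

(* The value does not depend on the representatives [repr (y 0 j)]. *)
Definition character (R : realType) (n : nat) (k : 'rV[int]_n)
    (y : torus R n) : R[i] :=
  let theta := \sum_(j < n) (k 0 j)%:~R * repr (y 0 j) in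
  cos theta +i* sin theta.

Definition borel (T : ptopologicalType) := g_sigma_algebraType (@open T).
HB.instance Definition _ (T : ptopologicalType) := Measurable.on (borel T).

Definition cylinder (R : realType) (n : nat) := (R * torus R n)%type.
HB.instance Definition _ (R : realType) (n : nat) :=
  Pointed.on (cylinder R n).
HB.instance Definition _ (R : realType) (n : nat) :=
  Topological.on (cylinder R n).
HB.instance Definition _ (R : realType) (n : nat) :=
  PointedTopological.on (cylinder R n).

Section charge_integral.
Context d (T : measurableType d) (R : realType).
Variable mu : {charge set T -> \bar R}.

Definition hahn_pos : set T := sval (cid (Hahn_decomposition mu)).
Definition hahn_neg : set T :=
  sval (cid (svalP (cid (Hahn_decomposition mu)))).

Lemma hahnP : hahn_decomposition mu hahn_pos hahn_neg.
Proof. exact: (svalP (cid (svalP (cid (Hahn_decomposition mu))))). Qed.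

(* Independent of the chosen Hahn decomposition. *)
Definition charge_Rintegral (D : set T) (f : T -> R) : R :=
  Rintegral (jordan_pos hahnP) D f - Rintegral (jordan_neg hahnP) D f.

Definition charge_Cintegral (D : set T) (f : T -> R[i]) : R[i] :=
  charge_Rintegral D (fun x => complex.Re (f x)) +i*
  charge_Rintegral D (fun x => complex.Im (f x)).

Definition total_variation : set T -> \bar R := charge_variation hahnP.
End charge_integral.

Definition measure_support (R : realType) (T : topologicalType)
    (nu : set T -> \bar R) : set T :=
  [set x | forall U, open U -> U x -> (0 < nu U)%E].

Definition signed_measure (R : realType) (n : nat) :=
  {charge set (borel (cylinder R n)) -> \bar R}.

Definition charge_support (R : realType) (n : nat) (mu : signed_measure R n) :
    set (cylinder R n) :=
  measure_support (total_variation mu).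

Section cylinder.
Variables (R : realType) (n : nat).

Definition slab (a b : R) : set (cylinder R n) := `[a, b] `*` setT.

Definition compactly_supported (h : R -> R) : Prop :=
  compact (closure [set t | h t != 0]).

Definition pseudo_positive (a b : R) (mu : signed_measure R n) : Prop :=
  forall (k : 'rV[int]_n) (h : R -> R),
    continuous h -> compactly_supported h -> (forall t, 0 <= h t) ->
    (* the order of R[i]: the integral is real and nonnegative *)
    0 <= charge_Cintegral mu (slab a b)
           (fun x => (h x.1)%:C * character k x.2).

(* Integrability is required since [Rintegral] maps infinite integrals to 0;
   it forces [nu] to be locally finite, which makes it unique. *)
Definition component_measure (a b : R) (mu : signed_measure R n)
    (k : 'rV[int]_n) (nu : {measure set (measurableTypeR R) -> \bar R}) :
    Prop :=
  forall h : R -> R, continuous h -> compactly_supported h ->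
    nu.-integrable setT (EFin \o h) /\
    (Rintegral nu setT h)%:C =
      charge_Cintegral mu (slab a b)
        (fun x => (h x.1)%:C * character k x.2).

(* Index set of the coordinates of R x R^n: [None] is t, [Some j] is y_j. *)
Definition coord_vec (i : option 'I_n) : R * 'rV[R]_n :=
  if i is Some j then (0, delta_mx 0 j) else (1, 0).

Definition partial (i : option 'I_n) (u : R * 'rV[R]_n -> R) :
    R * 'rV[R]_n -> R :=
  fun x => 'D_(coord_vec i) u x.

Definition laplacian (u : R * 'rV[R]_n -> R) : R * 'rV[R]_n -> R :=
  fun x => \sum_(i : option 'I_n) partial i (partial i u) x.

Fixpoint cont_diff_on (m : nat) (O : set (R * 'rV[R]_n))
    (u : R * 'rV[R]_n -> R) : Prop :=
  (forall x, O x -> {for x, continuous u}) /\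
  if m is m'.+1 then
    forall i : option 'I_n,
      (forall x, O x -> derivable u x (coord_vec i)) /\
      cont_diff_on m' O (partial i u)
  else True.

(* Classical sense: C^(2p), annihilated by the p-th iterate of the Laplacian. *)
Definition polyharmonic_on (p : nat) (O : set (R * 'rV[R]_n))
    (u : R * 'rV[R]_n -> R) : Prop :=
  cont_diff_on (2 * p)%N O u /\ forall x, O x -> iter p laplacian u x = 0.

Definition periodic_ext (f : cylinder R n -> R[i]) : R * 'rV[R]_n -> R[i] :=
  fun x => f (x.1, torus_proj x.2).

(* Functions on X are total functions constrained on X only.  The real-linear
   operator [laplacian] acts on a complex function through Re and Im. *)
Definition PH (p : nat) (a b : R) (f : cylinder R n -> R[i]) : Prop :=
  {within slab a b, continuous (f : cylinder R n -> (R[i])^o)} /\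
  polyharmonic_on p (`]a, b[ `*` setT) (fun x => complex.Re (periodic_ext f x)) /\
  polyharmonic_on p (`]a, b[ `*` setT) (fun x => complex.Im (periodic_ext f x)).

(* Uniqueness of such a [sigma] can only be up to equality on Borel sets: the
   values of a charge on other sets are arbitrary. *)
Definition gauss_measure (s : nat) (a b : R) (mu sigma : signed_measure R n) :
    Prop :=
  [/\ charge_support sigma `<=` slab a b,
      forall k : 'rV[int]_n, exists nu,
        [/\ component_measure a b sigma k nu,
            measure_support nu `<=` `[a, b] &
            (measure_support nu #<= `I_(2 * s)%N)%card],
      forall f, PH (2 * s)%N a b f ->
        charge_Cintegral mu (slab a b) f = charge_Cintegral sigma (slab a b) f &
      pseudo_positive a b sigma].

End cylinder.

(* Main.v *)
(** Expanding in characters of the torus turns Laplace's operator into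
    D^2 - |k|^2 acting on the k-th Fourier coefficient, so the coefficients of a
    function in PH^{2s} lie in the 4s-dimensional kernel of (D^2 - |k|^2)^{2s},
    which is a Chebyshev space.  The k-th component of mu is a positive functional
    on that space, and a Gauss quadrature with at most 2s nodes in [a, b]
    reproduces it.  The quadrature is obtained by optimizing, under the constraint
    of matching the moments, the integral of one more function u on which the
    operator is positive; for k <> 0 one can take u = 1, because the operator sends
    it to |k|^{4s} > 0, and this makes the mass of the quadrature at most the mass
    of the k-th component of mu.  Hence the masses are summable in k, and the
    quadratures are the components of a finite signed measure.  Uniqueness holds
    because 4s distinct point evaluations on a Chebyshev space of dimension 4s are
    independent, and because a measure is determined by its components. *)
Require Import Defs.
From HB Require Import structures.
From mathcomp Require Import all_boot all_order all_algebra.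
From mathcomp Require Import all_classical all_reals all_analysis.
From mathcomp Require Import measurable_realfun complex ring lra zify.
Import Order.TTheory GRing.Theory Num.Theory.
Import numFieldNormedType.Exports.
Local Open Scope classical_set_scope.
Local Open Scope ring_scope.

Set Implicit Arguments.
Unset Strict Implicit.
Unset Printing Implicit Defensive.

(** * Zeros along a chain of first-order operators *)

Section chains.
Variable R : realType.
Implicit Types (I : set R) (lam : nat -> R) (F : nat -> R -> R).

(** [D^2 - |k|^2] splits as [(D - |k|) (D + |k|)], and [D - l] is [D] conjugated by [exp (l t)].
    Rolle's theorem therefore works along the factors, and counting zeros replaces both determinants
    and the theory of linear differential equations. At the optimal value some nonzero nonnegative
    combination has integral 0, and its zeros are the nodes. Zeros inside [[a, b]] are double, zeros
    at the ends may be simple. The count alone would still allow [2 s + 1] nodes, both ends among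
    them; the positive sign of the operator on [u] excludes this, so the integral of [u] has to be
    minimized, not maximized. The sign [|k|^{4s}] is positive because the order [2 s] is even. For
    [k = 0] no bound on the mass is needed: one term does not affect summability. Pseudo-positivity
    speaks of continuous compactly supported functions, but a Fourier coefficient cut off at [a] and
    [b] is in general not continuous. Measures are therefore treated as functionals on bounded
    measurable functions, continuous under bounded pointwise convergence; positivity and Fourier
    uniqueness are extended to this domain first. *)

Definition chain I lam (N : nat) F :=
  forall j x, (j < N)%N -> I x ->
    is_derive x 1 (F j) (F j.+1 x + lam j * F j x).

(** A chain lists [F 0], [(D - lam 0) F 0], and so on; dropping its head is the induction step of
    the zero counts. *)
Lemma chain_tail I lam N F :
  chain I lam N.+1 F -> chain I (fun j => lam j.+1) N (fun j => F j.+1).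
Proof. by move=> cF j x jN Ix; exact: cF. Qed.

(** As [g = f' - l f], the derivative of [expR (- l * t) * f t] is [expR (- l * t) * g t]; the mean
    value theorem for this product carries zeros and signs between [f] and [g]. *)
Lemma twisted_MVT I (f g : R -> R) (l : R) : is_interval I ->
  (forall x, I x -> is_derive x 1 f (g x + l * f x)) ->
  forall x y, I x -> I y -> x < y -> exists c, [/\ x < c < y, I c &
    expR (- l * y) * f y - expR (- l * x) * f x =
    expR (- l * c) * g c * (y - x)].
Proof.
move=> iI df x y Ix Iy xy.
have Iz z : x <= z <= y -> I z by move=> ?; apply: iI Ix Iy _ _.
have dh z : I z -> is_derive z 1 (fun t => expR (- l * t) * f t)
    (expR (- l * z) * g z).
  move=> zI; have := df _ zI => dfz.
  apply: is_derive_eq.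
  rewrite /GRing.scale /=; ring.
have [|c|c cxy E] := MVT xy (f := fun t => expR (- l * t) * f t)
    (df := fun z => expR (- l * z) * g z).
- move=> z; rewrite in_itv/= => /andP[xz zy]; apply: dh; apply: Iz.
  by rewrite !ltW.
- apply: derivable_within_continuous => z; rewrite in_itv/= => zxy.
  by have [] := dh z (Iz _ zxy).
- exists c; move: cxy; rewrite in_itv/= => cxy; split=> //.
  by apply: Iz; case/andP: cxy => ? ?; rewrite !ltW.
Qed.

Lemma rolle_zeros I (f g : R -> R) (l : R) : is_interval I ->
  (forall x, I x -> is_derive x 1 f (g x + l * f x)) ->
  forall z0 zs, path <%R z0 zs -> (forall z, z \in z0 :: zs -> I z /\ f z = 0) ->
  exists ws, [/\ path <%R z0 ws,
    forall w, w \in ws -> [/\ I w, g w = 0 & w < last z0 zs] &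
    size ws = size zs].
Proof.
move=> iI df z0 zs; elim: zs z0 => [|z1 zs IH] z0 /=.
  by move=> _ _; exists [::].
case/andP=> z01 pz zf.
have [ws [pw wP sw]] := IH z1 pz (fun z zz => zf z (mem_behead (s := [:: z0, z1 & zs]) zz)).
have [Iz0 f0] := zf z0 (mem_head _ _).
have [Iz1 f1] : I z1 /\ f z1 = 0 by apply: zf; rewrite !inE eqxx orbT.
have [c [/andP[zc cz] Ic]] := twisted_MVT iI df Iz0 Iz1 z01.
rewrite f0 f1 !mulr0 subrr => /esym/eqP.
rewrite !mulf_eq0 gt_eqF ?expR_gt0//= orbC subr_eq0 gt_eqF//= => /eqP gc.
have zl : z1 <= last z1 zs.
  have := pz; rewrite (path_sortedE lt_trans) => /andP[/allP az _].
  by have:= mem_last z1 zs; rewrite inE => /orP[/eqP->//|/az/ltW].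
exists (c :: ws); split=> /=; last by rewrite sw.
- rewrite zc/=; case: ws pw {wP sw} => //= w ws /andP[zw ->].
  by rewrite (lt_trans cz).
- move=> w; rewrite inE => /orP[/eqP->|/wP//]; split=> //.
  exact: lt_le_trans zl.
Qed.

(** Every gap between neighbouring zeros of [f] contains a zero of [g], and the inner zeros of [f],
    listed by [belast z1 zs], are zeros of [g] as well. Gaps and inner zeros alternate, so all of
    these are distinct. *)
Lemma rolle_double_zeros I (f g : R -> R) (l : R) : is_interval I ->
  (forall x, I x -> is_derive x 1 f (g x + l * f x)) ->
  forall z0 z1 zs, path <%R z0 (z1 :: zs) ->
  (forall z, z \in [:: z0, z1 & zs] -> I z /\ f z = 0) ->
  (forall z, z \in belast z1 zs -> g z = 0) ->
  exists ws, [/\ path <%R z0 ws,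
    forall w, w \in ws -> [/\ I w, g w = 0 & w < last z1 zs] &
    size ws = (size zs).*2.+1].
Proof.
move=> iI df z0 z1 zs; elim: zs z0 z1 => [|z2 zs IH] z0 z1.
  move=> pz fz _; have [ws [pw wP sw]] := rolle_zeros iI df pz fz.
  by exists ws.
move=> /andP[z01] pz zf gz; change (is_true (path <%R z1 (z2 :: zs))) in pz.
have [||ws [pw wP sw]] := IH z1 z2 pz.
- by move=> z zz; apply: zf; rewrite inE zz orbT.
- by move=> z zz; apply: gz; rewrite /= inE zz orbT.
have gz1 : g z1 = 0 by apply: gz; rewrite mem_head.
have [Iz1 _] : I z1 /\ f z1 = 0 by apply: zf; rewrite !inE eqxx orbT.
have [||u [pu uP]] := rolle_zeros iI df (z0 := z0) (zs := [:: z1]).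
- by rewrite /= z01.
- by move=> z; rewrite !inE => zz; apply: zf; rewrite !inE orbA zz.
case: u pu uP => //= c [|//] /andP[z0c _] uP _.
have [Ic gc cz1] := uP c (mem_head _ _).
have zl : z1 < last z2 zs.
  have := pz; rewrite (path_sortedE lt_trans) => /andP[/allP az _].
  by apply: az; exact: mem_last.
exists [:: c, z1 & ws]; split=> /=; last by rewrite sw doubleS.
- by rewrite z0c cz1.
- move=> w; rewrite !inE => /or3P[/eqP->|/eqP->|/wP//]; split=> //.
  exact: lt_trans zl.
Qed.

(** Rolle's theorem leaves one zero fewer for a chain that is one shorter, so [F 1] vanishes by
    induction. Then [F 0] times an exponential is constant, and it is 0 at [z0]. *)
Lemma chain_eq0 I lam N F : is_interval I -> chain I lam N F ->
  (forall x, I x -> F N x = 0) ->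
  forall zs, sorted <%R zs -> size zs = N ->
  (forall z, z \in zs -> I z /\ F 0%N z = 0) ->
  forall x, I x -> F 0%N x = 0.
Proof.
move=> iI; elim: N lam F => [|N IH] lam F cF FN zs; first by move=> *; exact: FN.
case: zs => // z0 zs /= pz [szs] fz x Ix.
have df y : I y -> is_derive y 1 (F 0%N) (F 1%N y + lam 0%N * F 0%N y).
  by move=> Iy; exact: cF.
have [ws [pw wP sw]] := rolle_zeros iI df pz fz.
have F1 y : I y -> F 1%N y = 0.
  apply: (IH _ _ (chain_tail cF) FN ws).
  - exact: path_sorted pw.
  - by rewrite sw.
  - by move=> w /wP[].
have [Iz0 f0] := fz z0 (mem_head _ _).
have [xz|zx|->//] := ltgtP x z0.
- have [c [_ Ic]] := twisted_MVT iI df Ix Iz0 xz.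
  rewrite F1// f0 !(mulr0,mul0r) sub0r => /eqP.
  by rewrite oppr_eq0 mulf_eq0 gt_eqF ?expR_gt0//= => /eqP.
- have [c [_ Ic]] := twisted_MVT iI df Iz0 Ix zx.
  rewrite F1// f0 !(mulr0,mul0r) subr0 => /eqP.
  by rewrite mulf_eq0 gt_eqF ?expR_gt0//= => /eqP.
Qed.

(** The Rolle zeros of [F 1] lie left of the last zero of [F 0], so [F 1] is positive beyond that
    zero by induction, and [F 0] times an exponential increases there from 0. *)
Lemma chain_gt0 I lam N F : is_interval I -> chain I lam N F ->
  (forall x, I x -> 0 < F N x) ->
  forall zs, sorted <%R zs -> size zs = N ->
  (forall z, z \in zs -> I z /\ F 0%N z = 0) ->
  forall x, I x -> (forall z, z \in zs -> z < x) -> 0 < F 0%N x.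
Proof.
move=> iI; elim: N lam F => [|N IH] lam F cF FN zs; first by move=> *; exact: FN.
case: zs => // z0 zs /= pz [szs] fz x Ix xz.
have df y : I y -> is_derive y 1 (F 0%N) (F 1%N y + lam 0%N * F 0%N y).
  by move=> Iy; exact: cF.
have [ws [pw wP sw]] := rolle_zeros iI df pz fz.
have lz := mem_last z0 zs; have [Il f0] := fz _ lz.
have [c [/andP[lc cx] Ic]] := twisted_MVT iI df Il Ix (xz _ lz).
have g0 : 0 < F 1%N c.
  apply: (IH _ _ (chain_tail cF) FN ws) => //.
  - exact: path_sorted pw.
  - by rewrite sw.
  - by move=> w /wP[].
  - by move=> w /wP[_ _ wl]; exact: lt_trans lc.
rewrite f0 mulr0 subr0 => E; rewrite -(pmulr_rgt0 (F 0%N x) (expR_gt0 (- lam 0%N * x))) E.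
by rewrite !mulr_gt0 ?expR_gt0// subr_gt0 xz.
Qed.

(* The interior zeros are double, so that [F 1] has [N.*2.+1] zeros to the
   left of the largest zero of [F 0], and [F 1] is positive near that zero. *)
Lemma chain_ge0_zeros (a b : R) lam N F : chain setT lam N.+1.*2 F ->
  (forall x, a <= x <= b -> 0 <= F 0%N x) ->
  ((forall x, 0 < F N.+1.*2 x) \/
   (forall x, F N.+1.*2 x = 0) /\ exists x, F 0%N x != 0) ->
  forall zs, sorted <%R zs -> (forall z, z \in zs -> a <= z <= b /\ F 0%N z = 0) ->
  (size zs <= N.+1)%N.
Proof.
move=> cF F0 FN zs szs zsP; rewrite leqNgt; apply/negP => Nzs.
(* Exactly [N.+2] zeros of [F 0] give [F 1] exactly [N.*2.+1] zeros, the length of its own chain. *)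
wlog {Nzs} Nzs : zs szs zsP / size zs = N.+2.
  move=> /(_ (take N.+2 zs)); apply.
  - exact: take_sorted.
  - by move=> z /mem_take/zsP.
  - by rewrite size_takel.
case: zs szs zsP Nzs => // z0 [//|z1 zs] /= /andP[z01 pz] zsP [sz].
have iT : is_interval [set: R] by [].
have df y : [set: R] y -> is_derive y 1 (F 0%N) (F 1%N y + lam 0%N * F 0%N y).
  by move=> Iy; exact: cF.
have pz' : path <%R z0 (z1 :: zs) by rewrite /= z01.
have zl z : z \in belast z1 zs -> z < last z1 zs.
  have : sorted <%R (z1 :: zs) by [].
  rewrite lastI => s1 zb; have := s1; rewrite -cats1 (sorted_pairwise lt_trans).
  rewrite pairwise_cat => /and3P[/allrelP + _ _]; apply => //.
  by rewrite mem_head.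
have z0l z : z \in z1 :: zs -> z0 < z.
  by move=> zz; have := pz'; rewrite (path_sortedE lt_trans) => /andP[/allP + _]; apply.
have lzs : last z1 zs \in [:: z0, z1 & zs] by rewrite inE mem_last orbT.
have [/andP[al lb] fl] := zsP _ lzs.
have [/andP[a0 _] f0] := zsP z0 (mem_head _ _).
(* An inner zero is an interior minimum of [F 0] on [[a, b]]: value and derivative vanish there,
   hence also [F 1]. *)
have Dz z : z \in belast z1 zs -> F 1%N z = 0.
  move=> zb; have zz := mem_belast zb.
  have [/andP[az zb'] fz]: a <= z <= b /\ F 0%N z = 0 by apply: zsP; rewrite inE zz orbT.
  have d1 := df z I; have d0 : is_derive z 1 (F 0%N) 0.
    apply: (@derive1_at_min _ _ a b).
    - exact: le_trans az zb'.
    - by move=> t _; have [] := df t I.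
    - rewrite in_itv/= (le_lt_trans a0 (z0l _ zz))/=.
      exact: lt_le_trans (zl _ zb) lb.
    - by move=> t; rewrite in_itv/= fz => /andP[at_ tb]; apply: F0; rewrite !ltW.
  by have := @derive_val _ _ _ _ _ _ _ d1; rewrite (@derive_val _ _ _ _ _ _ _ d0) fz mulr0 addr0.
have [|ws [pw wP sw]] := rolle_double_zeros iT df pz' _ Dz.
  by move=> z /zsP[].
have cF1 := chain_tail cF.
have sws : sorted <%R ws := path_sorted pw.
have wsN : size ws = N.*2.+1 by rewrite sw sz.
case: FN => [FN|[FN [x]]]; last first.
  (* If the last function is 0, then [F 1] is 0, and a chain of length 1 with the zero [z0] forces
     [F 0 = 0]. *)
  rewrite (@chain_eq0 setT lam 1 F _ _ _ [:: z0]) ?eqxx //.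
  - by move=> j y; rewrite ltnS leqn0 => /eqP-> _; exact: df.
  - move=> y _; apply: (chain_eq0 iT cF1 _ sws wsN) => // z.
    by case/wP.
  - by move=> z; rewrite inE => /eqP->.
(* Right of [y] all zeros of [F 1] are passed and [F 1] is positive, so [F 0] would have to rise to
   its last zero from a negative value at [y]. *)
have [y [/andP[wy yl] ly]] : exists y, (z0 <= y < last z1 zs) /\ forall w, w \in ws -> w < y.
  have wl : last z0 ws < last z1 zs.
    have := mem_last z0 ws; rewrite inE => /orP[/eqP->|/wP[//]].
    by apply: z0l; rewrite mem_last.
  have le_last w : w \in z0 :: ws -> w <= last z0 ws.
    have : sorted <=%R (z0 :: ws) by apply: sub_path pw => ? ? /ltW.
    rewrite lastI => s1 wb; move: s1 wb.
    rewrite -cats1 (sorted_pairwise le_trans) pairwise_cat mem_cat => /and3P[/allrelP + _ _].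
    move=> H /orP[wb|]; last by rewrite mem_seq1 => /eqP->.
    by apply: H; rewrite ?mem_head.
  exists ((last z0 ws + last z1 zs) / 2); split=> [|w wws].
    by rewrite (le_trans (le_last z0 (mem_head _ _)))/= ?midf_lt// ltW// midf_lt.
  by rewrite (le_lt_trans (le_last w _)) ?midf_lt// inE wws orbT.
have [c [/andP[yc cl] _]] := twisted_MVT iT df (x := y) I I yl.
have g0 : 0 < F 1%N c.
  apply: (chain_gt0 iT cF1 _ sws wsN) => //.
  - by move=> w /wP[].
  - by move=> w /ly wy'; exact: lt_trans yc.
rewrite fl mulr0 sub0r => E.
have : 0 <= F 0%N y by apply: F0; rewrite (le_trans a0 wy)/= (le_trans (ltW yl)).
rewrite -(pmulr_rge0 (F 0%N y) (expR_gt0 (- lam 0%N * y))) -oppr_le0 E leNgt.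
by rewrite !mulr_gt0 ?expR_gt0// subr_gt0.
Qed.

End chains.

(** * Gauss quadrature for Chebyshev systems *)

Section gauss.
Variable R : realType.

Lemma ler_coord_norm n (v : 'rV[R]_n) i : `|v 0 i| <= `|v|.
Proof.
have /mapP[j Hj ->] : `|v 0 i| \in [seq `|v x.1 x.2| | x : 'I_1 * 'I_n].
  by apply/mapP; exists (ord0, i) => //=; rewrite mem_enum.
by rewrite [leRHS]/Num.norm /= mx_normrE; apply/bigmax_geP; right => /=; exists j.
Qed.

Lemma chain_sum I (lam : nat -> R) N n (c : 'I_n -> R) (W : 'I_n -> nat -> R -> R) :
  (forall i, chain I lam N (W i)) ->
  chain I lam N (fun j x => \sum_i c i * W i j x).
Proof.
move=> cW j x jN Ix.
have dW i : is_derive x 1 (fun y => c i * W i j y) (c i * (W i j.+1 x + lam j * W i j x)).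
  by have := cW i j x jN Ix => ?; apply: is_derive_eq; rewrite /GRing.scale/=; ring.
have -> : (fun x => \sum_i c i * W i j x) = \sum_i (fun y => c i * W i j y).
  by apply/funext => y; rewrite fct_sumE.
apply: is_derive_eq.
by rewrite mulr_sumr -big_split; apply: eq_bigr => i _ /=; ring.
Qed.

(** A functional on the span of a system, known only through its values [l i] on the basis functions
    and applied to coefficient rows. *)
Definition lin n (l : 'I_n -> R) (c : 'rV[R]_n) : R := \sum_i c 0 i * l i.

Definition combination n (W : 'I_n -> nat -> R -> R) (c : 'rV[R]_n) (x : R) : R :=
  lin (fun i => W i 0%N x) c.

Variables (a b : R) (r : nat) (lam : nat -> R).
Notation N := r.+1.*2.
(** The functions [W (lift ord0 i)] form a basis of the kernel of the product of the operators;
    [W ord0] is the extra function to be optimized. Half the dimension, [r.+1], will be the number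
    of nodes. *)
Variable W : 'I_N.+1 -> nat -> R -> R.
Hypothesis cW : forall i, chain setT lam N (W i).
Hypothesis W0 : forall x, 0 < W ord0 N x.
Hypothesis WS : forall i x, W (lift ord0 i) N x = 0.

Local Notation comb := (combination W).

Hypothesis freeW : forall c : 'rV[R]_N.+1, c 0 ord0 = 0 -> (forall x, comb c x = 0) -> c = 0.

Let linD (l : 'I_N.+1 -> R) (c d : 'rV[R]_N.+1) : lin l (c + d) = lin l c + lin l d.
Proof.
by rewrite /lin -big_split; apply: eq_bigr => i _ /=; rewrite mxE mulrDl.
Qed.

Let linZ (l : 'I_N.+1 -> R) (k : R) (c : 'rV[R]_N.+1) : lin l (k *: c) = k * lin l c.
Proof. by rewrite /lin mulr_sumr; apply: eq_bigr => i _; rewrite mxE mulrA. Qed.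

Let linN (l : 'I_N.+1 -> R) (c : 'rV[R]_N.+1) : lin l (- c) = - lin l c.
Proof. by rewrite -scaleN1r linZ mulN1r. Qed.

Let lin_delta (l : 'I_N.+1 -> R) i : lin l (delta_mx 0 i) = l i.
Proof.
rewrite /lin (bigD1 i)//= mxE !eqxx mul1r big1 ?addr0// => j /negbTE ji.
by rewrite mxE eqxx ji mul0r.
Qed.

Let lin_continuous (l : 'I_N.+1 -> R) : continuous (lin l).
Proof.
have -> : lin l = \sum_i (fun c : 'rV[R]_N.+1 => c 0 i * l i).
  by apply/funext => c; rewrite fct_sumE.
apply: (big_ind (fun f : 'rV[R]_N.+1 -> R => continuous f)).
- by move=> x; apply: (@cst_continuous _ _ (0 : R)).
- by move=> f g cf cg x; exact: (@continuousD _ _ _ f g x (cf x) (cg x)).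
- move=> i _ x; apply: continuousM; last exact: cst_continuous.
  exact: (@coord_continuous R 1 N.+1 0 i x).
Qed.

Let combE (c : 'rV[R]_N.+1) (x : R) : comb c x = \sum_i c 0 i * W i 0%N x. Proof. by []. Qed.

Let comb_continuous (c : 'rV[R]_N.+1) : continuous (comb c).
Proof.
move=> x; apply: differentiable_continuous; apply/derivable1_diffP.
by have [] := chain_sum (c 0) cW (ltn0Sn _) (x := x) I.
Qed.

(** A row killed by the matrix is a combination with [N] zeros, hence 0 by [chain_eq0], and [freeW]
    makes its coefficients vanish. *)
Lemma chebyshev_unisolvent (x : 'I_N -> R) : injective x ->
  \matrix_(i, j) W (lift ord0 i) 0%N (x j) \in unitmx.
Proof.
move=> injx; rewrite -row_free_unit; apply/inj_row_free => v vE0.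
pose c : 'rV[R]_N.+1 := \row_i (if unlift ord0 i is Some j then v 0 j else 0).
have cS i : c 0 (lift ord0 i) = v 0 i by rewrite mxE liftK.
have c0 : c 0 ord0 = 0 by rewrite mxE unlift_none.
suff cE : c = 0 by apply/rowP => i; rewrite -cS cE !mxE.
have cz j : comb c (x j) = 0.
  rewrite combE big_ord_recl c0 mul0r add0r.
  have /rowP/(_ j) := vE0; rewrite !mxE => E; rewrite -[RHS]E.
  by apply: eq_bigr => i _; rewrite cS mxE.
apply: freeW => // y.
apply: (@chain_eq0 _ setT lam N (fun j x => \sum_i c 0 i * W i j x) _ _ _
  (sort <=%R (codom x))) => //.
- exact: chain_sum.
- move=> z _; rewrite big_ord_recl c0 mul0r add0r big1// => i _.
  by rewrite WS mulr0.
- by rewrite sort_lt_sorted; apply/injectiveP.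
- by rewrite size_sort size_codom card_ord.
- by move=> z; rewrite mem_sort => /codomP[j ->]; rewrite -combE cz.
Qed.

Lemma chebyshev_interpolation (x : 'I_N -> R) (y : 'I_N -> R) : injective x ->
  exists2 c : 'rV[R]_N.+1, c 0 ord0 = 0 & forall j, comb c (x j) = y j.
Proof.
move=> injx; have Mu := chebyshev_unisolvent injx.
set M := \matrix_(i, j) _ in Mu.
pose v := (\row_j y j) *m invmx M.
exists (\row_i (if unlift ord0 i is Some j then v 0 j else 0)) => [|j].
  by rewrite mxE unlift_none.
have /rowP/(_ j) : v *m M = \row_j y j by rewrite mulmxKV.
rewrite [LHS]mxE [RHS]mxE => <-; rewrite combE big_ord_recl.
rewrite [X in X * _ + _]mxE unlift_none mul0r add0r.
by apply: eq_bigr => i _; rewrite [X in X * _ = _]mxE liftK [X in _ = _ * X]mxE.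
Qed.

Lemma chebyshev_evaluations_free (x : 'I_N -> R) (d : 'I_N -> R) : injective x ->
  (forall i : 'I_N, \sum_j d j * W (lift ord0 i) 0%N (x j) = 0) ->
  forall j, d j = 0.
Proof.
move=> injx dW j; have Mu := chebyshev_unisolvent injx.
set M := \matrix_(i, j) _ in Mu.
have : M *m (\col_j d j) = 0.
  by apply/colP => i; rewrite !mxE -[RHS](dW i); apply: eq_bigr => k _; rewrite !mxE mulrC.
move=> /(congr1 (mulmx (invmx M))); rewrite mulKmx// mulmx0 => /colP/(_ j).
by rewrite !mxE.
Qed.

(** Facts about exactly [N] points are applied to shorter lists of nodes by adding points beyond all
    of them. *)
Lemma seq_extension (zs : seq R) : uniq zs -> (size zs <= N)%N ->
  exists2 x : 'I_N -> R, injective x &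
    forall j : 'I_N, (j < size zs)%N -> x j = nth 0 zs j.
Proof.
move=> uz sz; have [B zB] : exists B, forall z, z \in zs -> z < B.
  elim: (zs) => [|z s [B sB]]; first by exists 0.
  exists (Num.max B (z + 1)) => t; rewrite inE lt_max => /orP[/eqP->|/sB->//].
  by rewrite ltrDl ltr01 orbT.
exists (fun j : 'I_N => if (j < size zs)%N then nth 0 zs j else B + j%:R); last first.
  by move=> j ->.
move=> i j; case: ltnP => si; case: ltnP => sj.
- by move=> /eqP; rewrite nth_uniq// => /eqP/val_inj.
- move=> zE; have := zB _ (mem_nth 0 si); rewrite zE.
  by rewrite -subr_gt0 opprD addrA subrr add0r oppr_gt0 ltNge ler0n.
- move=> zE; have := zB _ (mem_nth 0 sj); rewrite -zE.
  by rewrite -subr_gt0 opprD addrA subrr add0r oppr_gt0 ltNge ler0n.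
- by move=> /addrI/eqP; rewrite eqr_nat => /eqP/val_inj.
Qed.

Hypothesis ab : a < b.
Hypothesis Wge0 : forall x, a <= x <= b -> 0 <= W ord0 0%N x.
Variable l : 'I_N.+1 -> R.
Hypothesis lpos : forall c : 'rV[R]_N.+1,
  (forall x, a <= x <= b -> 0 <= comb c x) -> 0 <= lin l c.
Variable e : 'rV[R]_N.+1.
Hypothesis egt0 : forall x, a <= x <= b -> 0 < comb e x.

(** [sup S] is the least value on [W ord0] of a functional that agrees with [l] on the kernel and is
    nonnegative on nonnegative combinations; [l'] below is the functional with this value. *)
Let S : set R := [set y | exists2 c : 'rV[R]_N.+1, c 0 ord0 = 0 /\ y = lin l c &
  forall x, a <= x <= b -> comb c x <= W ord0 0%N x].

Let comb_delta0 x : comb (delta_mx 0 ord0) x = W ord0 0%N x.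
Proof. exact: lin_delta. Qed.

Let ubS : ubound S (l ord0).
Proof.
move=> _ [c [c0 ->] cle]; rewrite -subr_ge0 -(lin_delta l) -linN -linD.
by apply: lpos => x xab; rewrite /combination linD linN lin_delta subr_ge0 cle.
Qed.

Let S0 : S !=set0.
Proof.
exists 0; exists 0 => [|x xab]; first by rewrite mxE /lin big1// => i _; rewrite mxE mul0r.
by rewrite /combination /lin big1 ?Wge0// => i _; rewrite mxE mul0r.
Qed.

Let l' (i : 'I_N.+1) := if i == ord0 then sup S else l i.

Let linl' (c : 'rV[R]_N.+1) : lin l' c = lin l c + c 0 ord0 * (sup S - l ord0).
Proof.
rewrite /lin (bigD1 ord0)//= [in RHS](bigD1 ord0)//= /l' eqxx.
under eq_bigr => i /negbTE -> do [].
by ring.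
Qed.

(** Dividing by the coefficient of [W ord0] compares this function with the kernel: a negative
    coefficient yields an upper bound of [S], a positive one an element of [S]. *)
Let l'pos (c : 'rV[R]_N.+1) : (forall x, a <= x <= b -> 0 <= comb c x) -> 0 <= lin l' c.
Proof.
move=> cge0; pose d := c - c 0 ord0 *: delta_mx 0 ord0.
have d0 : d 0 ord0 = 0 by rewrite !mxE !eqxx mulr1 subrr.
have cd x : comb d x = comb c x - c 0 ord0 * W ord0 0%N x.
  by rewrite /combination /d linD linN linZ lin_delta.
have ld : lin l d = lin l c - c 0 ord0 * l ord0 by rewrite /d linD linN linZ lin_delta.
have -> : lin l' c = c 0 ord0 * sup S + lin l d by rewrite linl' ld; ring.
have [c0|c0|c0] := ltgtP (c 0 ord0) 0.
- have k0 : 0 < - (c 0 ord0) by rewrite oppr_gt0.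
  have : sup S <= lin l ((- c 0 ord0)^-1 *: d).
    apply: ge_sup => // _ [v [v0 ->] vle].
    rewrite -subr_ge0 -linN -linD; apply: lpos => x xab.
    rewrite /combination linD linN subr_ge0 (le_trans (vle x xab))//.
    rewrite linZ -/(comb d x) cd mulrC ler_pdivlMr// mulrN (mulrC (W _ _ _)).
    by rewrite lerBrDr addNr cge0.
  by rewrite linZ mulrC ler_pdivlMr//; lra.
- have : lin l (- ((c 0 ord0)^-1 *: d)) <= sup S.
    apply: ub_le_sup; first by exists (l ord0).
    exists (- ((c 0 ord0)^-1 *: d)); first by split => //; rewrite mxE mxE d0 mulr0 oppr0.
    move=> x xab; rewrite /combination linN linZ -/(comb d x) cd mulrBr mulKf ?gt_eqF//.
    by rewrite opprB lerBlDr lerDl mulr_ge0 ?invr_ge0 ?cge0// ltW.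
  by rewrite linN linZ -mulrN mulrC ler_pdivrMr//; lra.
- by rewrite c0 mul0r add0r ld c0 mul0r subr0; exact: lpos.
Qed.

(** A compact base of a cone of nonnegative combinations, on which [l'] attains its minimum. *)
Let K := [set c : 'rV[R]_N.+1 | [/\ `|c| = 1, 0 <= c 0 ord0 &
  forall x, a <= x <= b -> 0 <= comb c x]].

Let compactK : compact K.
Proof.
apply: bounded_closed_compact.
  exists 1; split => // y y1 c [c1 _ _] /=.
  by apply: le_trans (ltW y1); rewrite le_eqVlt; apply/orP; left; apply/eqP; exact: c1.
have -> : K = [set c | `|c| = 1] `&` [set c : 'rV[R]_N.+1 | 0 <= c 0 ord0] `&`
    \bigcap_(x in `[a, b]) [set c | 0 <= lin (fun i => W i 0%N x) c].
  apply/seteqP; split=> c /=.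
    by move=> [? ? H]; split=> // x /=; rewrite in_itv/= => /H.
  by move=> [[? ?] H]; split=> // x xab; apply: H; rewrite /= in_itv.
apply: closedI; first apply: closedI.
- apply: (@preimage_closed _ _ (fun c : 'rV[R]_N.+1 => `|c|) [set y | y = 1]); last exact: closed_eq.
  by move=> x _; exact: norm_continuous.
- apply: (@preimage_closed _ _ (fun c : 'rV[R]_N.+1 => c 0 ord0) [set y | 0 <= y]).
    by move=> x _; exact: coord_continuous.
  exact: closed_ge.
- apply: closed_bigI => x _.
  apply: (@preimage_closed _ _ (lin (fun i => W i 0%N x)) [set y | 0 <= y]).
    by move=> y _; exact: lin_continuous.
  exact: closed_ge.
Qed.

Let normalizedK (c : 'rV[R]_N.+1) : c != 0 -> 0 <= c 0 ord0 ->
  (forall x, a <= x <= b -> 0 <= comb c x) -> K (`|c|^-1 *: c).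
Proof.
move=> c0 cge0 cpos; split.
- by rewrite normrZ normfV normr_id mulVf// normr_eq0.
- by rewrite mxE mulr_ge0// invr_ge0.
- by move=> x xab; rewrite /combination linZ mulr_ge0 ?invr_ge0//; exact: cpos.
Qed.

Let exists_extremal : exists c : 'rV[R]_N.+1, K c /\ lin l' c = 0.
Proof.
have K0 : K !=set0.
  pose D : 'rV[R]_N.+1 := delta_mx 0 ord0.
  exists (`|D|^-1 *: D); apply: normalizedK.
  - by apply/eqP => /matrixP/(_ 0 ord0)/eqP; rewrite !mxE !eqxx oner_eq0.
  - by rewrite mxE !eqxx.
  - by move=> x xab; rewrite comb_delta0 Wge0.
have [c Kc cmin] := compact_EVT_min K0 compactK (continuous_subspaceT (lin_continuous (l := l'))).
exists c; rewrite inE in Kc; split=> //; apply/eqP; rewrite eq_le andbC.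
have [c1 c0 cpos] := Kc; rewrite l'pos//= leNgt; apply/negP => lc.
have [_ [d [d0 ->] dle]] := sup_adherent lc (conj S0 (ex_intro _ _ ubS)).
pose x := delta_mx 0 ord0 - d : 'rV[R]_N.+1.
have x0 : x 0 ord0 = 1 by rewrite !mxE d0 !eqxx subr0.
have nx1 : 1 <= `|x| by rewrite -[leLHS]normr1 -x0; exact: ler_coord_norm.
have xn0 : x != 0.
  by apply/eqP => xE; move: nx1; rewrite xE normr0 ler10.
have Kx : K (`|x|^-1 *: x).
  apply: normalizedK => //; first by rewrite x0.
  by move=> y yab; rewrite /combination /x linD linN lin_delta subr_ge0 dle.
have := cmin _ (mem_set Kx); rewrite linZ mulrC ler_pdivlMr ?normr_gt0// => H.
have := le_trans (ler_peMr (ltW lc) nx1) H.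
rewrite /x linD linN lin_delta [l' _]/l' eqxx (linl' d) d0 mul0r addr0.
by rewrite lerBrDr -lerBrDl leNgt => /negP.
Qed.

(** The nodes are the zeros in [[a, b]] of the extremal combination [c]. Since [l'] is 0 on [c], it
    depends only on the values at these zeros, so it is a sum of point evaluations weighted by its
    values on Lagrange functions. *)
Lemma gauss_quadrature : exists (zs : seq R) (w : R -> R),
  [/\ uniq zs /\ (size zs <= r.+1)%N,
      forall z, z \in zs -> a <= z <= b /\ 0 <= w z,
      forall i, l (lift ord0 i) = \sum_(z <- zs) w z * W (lift ord0 i) 0%N z &
      \sum_(z <- zs) w z * W ord0 0%N z <= l ord0].
Proof.
have [c [[c1 c0 cpos] lc]] := exists_extremal.
have cN0 : c != 0 by apply: contra_eq_neq c1 => ->; rewrite normr0 eq_sym oner_eq0.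
have cF := chain_sum (c 0) cW.
have cmax : forall zs, sorted <%R zs ->
    (forall z, z \in zs -> a <= z <= b /\ comb c z = 0) -> (size zs <= r.+1)%N.
  apply: (chain_ge0_zeros cF cpos).
  have FN x : \sum_i c 0 i * W i N x = c 0 ord0 * W ord0 N x.
    by rewrite big_ord_recl big1 ?addr0// => i _; rewrite WS mulr0.
  have [c00|c00] := eqVneq (c 0 ord0) 0; [right|left] => [|x]; last first.
    by rewrite FN mulr_gt0// lt_neqAle eq_sym c00.
  split=> [x|]; first by rewrite FN c00 mul0r.
  apply: contra_notP (negP cN0) => /forallNP H; apply/eqP/freeW => // x.
  by have /negP := H x; rewrite negbK => /eqP.
(* A longest list of zeros exists by the bound [cmax], and it contains every zero. *)
pose P n := `[< exists zs, [/\ size zs = n, sorted <%R zs &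
   forall z, z \in zs -> a <= z <= b /\ comb c z = 0] >].
have exP : exists n, P n by exists 0%N; apply/asboolP; exists [::]; split.
have Pmax n : P n -> (n <= r.+1)%N by move=> /asboolP[zs [<- ? ?]]; exact: cmax.
have [n /asboolP[zs [szs sz zsP]] nmax] := ex_maxnP exP Pmax.
have zsall z : a <= z <= b -> comb c z = 0 -> z \in zs.
  move=> zab cz; apply/negPn/negP => zN.
  suff : P n.+1 by move=> /nmax; rewrite ltnn.
  apply/asboolP; exists (sort <=%R (z :: zs)); split.
  - by rewrite size_sort /= szs.
  - by rewrite sort_lt_sorted /= zN (sorted_uniq lt_trans)//; exact: lt_irreflexive.
  - by move=> t; rewrite mem_sort inE => /orP[/eqP->//|/zsP].
have uz : uniq zs by apply: (sorted_uniq lt_trans) => //; exact: lt_irreflexive.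
have szN : (size zs <= r.+1)%N by exact: cmax.
(* A combination that is nonnegative at the zeros of the extremal one becomes
   nonnegative on [a, b] after adding a multiple of the latter. *)
have l'zs d : (forall z, z \in zs -> 0 <= comb d z) -> 0 <= lin l' d.
  move=> dz; apply/ler_addgt0Pl => eps eps0.
  (* Adding [k *: e] makes the combination strictly positive at the zeros and raises [l'] by at most
     [eps]. *)
  have [k k0 ke] : exists2 k, 0 < k & k * lin l' e <= eps.
    have := l'pos (fun x xab => ltW (egt0 xab)); rewrite le_eqVlt => /orP[/eqP <-|e0].
      by exists 1 => //; rewrite mulr0 ltW.
    by exists (eps / lin l' e); [rewrite divr_gt0|rewrite divfK// gt_eqF].
  pose g := d + k *: e.
  have gz z : z \in zs -> 0 < comb g z.
    move=> zz; rewrite /combination linD linZ ltr_wpDl//; first exact: dz.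
    by rewrite mulr_gt0// egt0//; case: (zsP z zz).
  suff [M Mg] : exists M, forall x, a <= x <= b -> 0 <= comb (g + M *: c) x.
    have := l'pos Mg; rewrite !linD !linZ lc mulr0 addr0 => /le_trans; apply.
    by rewrite addrC lerD2r.
  (* On the compact set [A] the combination [c] has no zero, hence a positive minimum; [M] will be
     minus the minimum of [g] divided by the minimum of [c]. *)
  pose A := `[a, b] `&` [set x | comb g x <= 0].
  have cA : compact A.
    apply: compact_closedI; first exact: segment_compact.
    apply: (@preimage_closed _ _ (comb g) [set y | y <= 0]); last exact: closed_le.
    by move=> x _; exact: comb_continuous.
  have [A0|/set0P A0] := eqVneq A set0.
    exists 0 => x xab; rewrite scale0r addr0 leNgt; apply/negP => gx.
    suff : A x by rewrite A0.
    by split; [rewrite /= in_itv|exact: ltW].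
  have [u Au umin] := compact_EVT_min A0 cA (continuous_subspaceT (comb_continuous (c := c))).
  have [v Av vmin] := compact_EVT_min A0 cA (continuous_subspaceT (comb_continuous (c := g))).
  rewrite inE in Au; rewrite inE in Av.
  have cu : 0 < comb c u.
    case: Au => /=; rewrite in_itv/= => uab gu.
    rewrite lt_neqAle cpos// andbT eq_sym; apply/eqP => cu0.
    by have := gz _ (zsall _ uab cu0); rewrite ltNge gu.
  exists (- comb g v / comb c u) => x xab.
  rewrite /combination linD linZ -!/(comb _ x).
  have gv : comb g v <= 0 by case: Av.
  have M0 : 0 <= - comb g v / comb c u.
    by rewrite divr_ge0 ?oppr_ge0 ?(ltW cu).
  have [gx|gx] := leP 0 (comb g x); first by rewrite addr_ge0// mulr_ge0// cpos.
  have Ax : A x by split; [rewrite /= in_itv|exact: ltW].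
  have cux := umin _ (mem_set Ax); have gvx := vmin _ (mem_set Ax).
  have : - comb g v <= - comb g v / comb c u * comb c x.
    rewrite -mulrA ler_peMr ?oppr_ge0//.
    by rewrite mulrC ler_pdivlMr// mul1r.
  by move=> H; apply: le_trans (lerD gvx H); rewrite subrr.
have szN' : (size zs <= N)%N by rewrite (leq_trans szN)// -addnn leq_addr.
have [x injx xzs] := seq_extension uz szN'.
(* [q z] is a Lagrange function for the node [z], taken in the kernel. *)
have [q qP] : exists q : R -> 'rV[R]_N.+1, forall z, z \in zs -> q z 0 ord0 = 0 /\
    forall t, t \in zs -> comb (q z) t = (t == z)%:R.
  suff H z : exists q : 'rV[R]_N.+1, z \in zs -> q 0 ord0 = 0 /\
    forall t, t \in zs -> comb q t = (t == z)%:R by have [q qP] := choice H; exists q.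
  have [q q0 qx] := chebyshev_interpolation (fun j => (x j == z)%:R) injx.
  exists q => zz; split=> // t tz.
  have ti : (index t zs < N)%N by rewrite (leq_trans _ szN')// index_mem.
  by have := qx (Ordinal ti); rewrite xzs/= ?index_mem// nth_index.
have Lq d : lin l' d = \sum_(z <- zs) comb d z * lin l' (q z).
  pose f := d - \sum_(z <- zs) comb d z *: q z.
  have lsum m (s : seq R) : lin m (\sum_(z <- s) comb d z *: q z) =
      \sum_(z <- s) comb d z * lin m (q z).
    elim: s => [|z s IH]; last by rewrite !big_cons linD linZ IH.
    by rewrite !big_nil /lin big1// => i _; rewrite mxE mul0r.
  have fz z : z \in zs -> comb f z = 0.
    move=> zz; rewrite /combination /f linD linN lsum (bigD1_seq z)//= -!/(comb _ _).
    have [_ qz] := qP z zz; rewrite qz// eqxx mulr1 big1_seq ?addr0 ?subrr//.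
    move=> t /andP[tz tzs]; have [_ qt] := qP t tzs.
    by rewrite -/(comb (q t) z) qt// eq_sym (negbTE tz) mulr0.
  have f0 : lin l' f = 0.
    apply/eqP; rewrite eq_le l'zs ?andbT => [|z zz]; last by rewrite fz.
    rewrite -oppr_ge0 -linN l'zs// => z zz.
    by rewrite /combination linN -/(comb f z) fz// oppr0.
  by move: f0; rewrite /f linD linN lsum => /eqP; rewrite subr_eq0 => /eqP.
exists zs, (fun z => lin l' (q z)); split=> //.
- move=> z zz; split; first by case: (zsP z zz).
  apply: l'zs => t tz; have [_ qz] := qP z zz.
  by rewrite qz// ler0n.
- move=> i; transitivity (lin l' (delta_mx 0 (lift ord0 i))).
    by rewrite lin_delta /l' eq_sym (negbTE (neq_lift _ _)).
  by rewrite Lq; apply: eq_bigr => z _; rewrite mulrC /combination lin_delta.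
- apply: (@le_trans _ _ (lin l' (delta_mx 0 ord0))); last first.
    by rewrite lin_delta /l' eqxx; apply: ge_sup.
  by rewrite Lq le_eqVlt; apply/orP; left; apply/eqP; apply: eq_bigr => z _;
    rewrite mulrC comb_delta0.
Qed.

End gauss.

(** * Exponential polynomials *)

Section exponential_polynomials.
Variable R : realType.

Definition epoly (rho : R) (P : {poly R}) (t : R) : R := P.[t] * expR (rho * t).

Global Instance is_derive_epoly (rho : R) (P : {poly R}) (t : R) :
  is_derive t 1 (epoly rho P) (epoly rho (P^`() + rho *: P) t).
Proof.
rewrite /epoly; have dP := is_derive_poly P t.
apply: is_derive_eq; rewrite hornerD hornerZ /GRing.scale/=; ring.
Qed.

Lemma epolyD (rho : R) (P Q : {poly R}) (t : R) : epoly rho (P + Q) t = epoly rho P t + epoly rho Q t.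
Proof. by rewrite /epoly hornerD mulrDl. Qed.

Lemma epolyZ (rho c : R) (P : {poly R}) (t : R) : epoly rho (c *: P) t = c * epoly rho P t.
Proof. by rewrite /epoly hornerZ mulrA. Qed.

(** [D - lam j] sends [epoly rho Q] to [epoly rho (Q' + (rho - lam j) Q)], so only the polynomial
    factor has to be tracked. *)
Fixpoint poly_chain (lam : nat -> R) (rho : R) (P : {poly R}) (j : nat) :=
  if j is j'.+1 then
    let Q := poly_chain lam rho P j' in Q^`() + (rho - lam j') *: Q
  else P.

Lemma chain_epoly (I : set R) (lam : nat -> R) (rho : R) (P : {poly R}) N :
  chain I lam N (fun j => epoly rho (poly_chain lam rho P j)).
Proof.
move=> j x _ _; have := is_derive_epoly rho (poly_chain lam rho P j) x.
move=> d; apply: is_derive_eq; rewrite /= -epolyZ -epolyD scalerBl.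
by rewrite addrA subrK.
Qed.

(* [\prod_(j < N) (D - lam j)] is a power of [D^2 - k^2] for even [N]. *)
Definition alternating (k : R) (j : nat) : R := if odd j then - k else k.

Lemma alternating_even k j : alternating k j.*2 = k.
Proof. by rewrite /alternating odd_double. Qed.

Lemma alternating_odd k j : alternating k j.*2.+1 = - k.
Proof. by rewrite /alternating /= odd_double. Qed.

Lemma size_derivW (P : {poly R}) : (size P^`() <= (size P).-1)%N.
Proof.
have [->|P0] := eqVneq P 0; first by rewrite linear0 size_poly0.
by have := lt_size_deriv P0; case: (size P).
Qed.

Lemma size_drop1 (P : {poly R}) m (c : R) : (size P <= m)%N ->
  (size (P^`() + c *: P)%R <= m)%N.
Proof.
move=> sP; apply: leq_trans (size_polyD _ _) _; rewrite geq_max.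
by rewrite (leq_trans (size_derivW _) _)/= ?(leq_trans (leq_pred _))// (leq_trans (size_scale_leq _ _)).
Qed.

(** In each pair of operators, [D - k] acts on [epoly k Q] by differentiating [Q], which lowers the
    size; the other operator does not raise it. *)
Lemma size_poly_chainD (k : R) (P : {poly R}) j :
  (size (poly_chain (alternating k) k P j.*2) <= size P - j)%N.
Proof.
elim: j => [|j IH]; first by rewrite subn0.
rewrite doubleS /= alternating_odd alternating_even subrr scale0r addr0.
by apply: size_drop1; apply: (leq_trans (size_derivW _)); rewrite subnS -!subn1 leq_sub2r.
Qed.

Lemma size_poly_chainN (k : R) (P : {poly R}) j :
  (size (poly_chain (alternating k) (- k) P j.*2) <= size P - j)%N.
Proof.
elim: j => [|j IH]; first by rewrite subn0.
rewrite doubleS /= alternating_odd alternating_even opprK addNr scale0r addr0.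
apply: (leq_trans (size_derivW _)).
by rewrite subnS -!subn1 leq_sub2r// size_drop1.
Qed.

Lemma poly_chain0 (P : {poly R}) j : poly_chain (alternating 0) 0 P j = P^`(j).
Proof.
elim: j => [|j IH]; first by rewrite derivn0.
by rewrite /= IH /alternating oppr0 if_same subrr scale0r addr0 -derivnS.
Qed.

Lemma poly_fun_eq0 (P : {poly R}) : (forall x, P.[x] = 0) -> P = 0.
Proof.
move=> P0; apply: (@roots_geq_poly_eq0 _ P [seq i%:R | i <- iota 0 (size P)]).
- by apply/allP => x _; apply/rootP.
- by rewrite map_inj_uniq ?iota_uniq// => i j /eqP; rewrite eqr_nat => /eqP.
- by rewrite size_map size_iota.
Qed.

Lemma deriv_addZ_eq0 (rho : R) (P : {poly R}) : rho != 0 ->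
  P^`() + rho *: P = 0 -> P = 0.
Proof.
move=> r0 E; apply/eqP; apply: contraT => P0.
have : size (P^`() + rho *: P) = size P.
  by rewrite addrC size_polyDl size_scale// lt_size_deriv.
by rewrite E size_poly0 => /esym/eqP; rewrite size_poly_eq0 (negbTE P0).
Qed.

(** Differentiation lowers the degree of [Q] and replaces [P] by [P' + rho P], which has the degree
    of [P] because [rho != 0]. *)
Lemma epoly_free (rho : R) (P Q : {poly R}) : rho != 0 ->
  (forall t, epoly rho P t + Q.[t] = 0) -> P = 0 /\ Q = 0.
Proof.
move=> r0; have [n] := ubnP (size Q); elim: n Q P => // n IH Q P sQ PQ.
have P0 : P = 0.
  have [Q0|Q0] := eqVneq Q 0.
    apply: poly_fun_eq0 => x; have := PQ x.
    rewrite Q0 horner0 addr0 => /eqP.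
    by rewrite mulf_eq0 [expR _ == 0]gt_eqF ?expR_gt0// orbF => /eqP.
  have [] // := IH Q^`() (P^`() + rho *: P); last by move=> /(deriv_addZ_eq0 r0).
    by rewrite (leq_trans (lt_size_deriv Q0)).
  move=> t; have d1 := is_derive_epoly rho P t; have d2 := is_derive_poly Q t.
  have : is_derive t 1 (epoly rho P + horner Q) (epoly rho (P^`() + rho *: P) t + Q^`().[t]).
    exact: is_deriveD.
  have -> : epoly rho P + horner Q = cst 0 by apply/funext => x; exact: PQ.
  by move=> d; rewrite -(@derive_val _ _ _ _ _ _ _ d) derive_cst.
split=> //; apply: poly_fun_eq0 => x; have := PQ x.
by rewrite P0 /epoly horner0 mul0r add0r.
Qed.

(* For [k != 0], the entries [1 .. 4 s] span the kernel of [(D^2 - k^2)^(2 s)];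
   the entry [0] is the constant [1], on which this operator is positive.  For
   [k = 0] the entry [0] is [t^(4 s)] instead, as [1] lies in the kernel. *)
Definition exp_system_data (k : R) (s i : nat) : R * {poly R} :=
  if k == 0 then (0, if i is i'.+1 then 'X^i' else 'X^(s.*2.*2))
  else if i is i'.+1 then
    if (i' < s.*2)%N then (k, 'X^i') else (- k, 'X^(i' - s.*2))
  else (0, 1).

Definition exp_system (k : R) (s : nat) (i : 'I_(s.*2.*2).+1) (j : nat) : R -> R :=
  epoly (exp_system_data k s i).1
    (poly_chain (alternating k) (exp_system_data k s i).1 (exp_system_data k s i).2 j).

Variables (k : R) (s : nat).
Local Notation N := s.*2.*2.
Local Notation W := (@exp_system k s).

Lemma exp_system_chain I (i : 'I_N.+1) : chain I (alternating k) N (W i).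
Proof. exact: chain_epoly. Qed.

(** For [k != 0] each factor [D^2 - k^2] multiplies the constant 1 by [- k^2]; an even number of
    factors makes the sign positive. For [k = 0] the value is a factorial. *)
Lemma exp_system_top x : 0 < W ord0 N x.
Proof.
rewrite /exp_system /exp_system_data /=; have [->|k0] := eqVneq k 0.
  rewrite poly_chain0 derivnXn subnn expr0 ffactnn /epoly mulr_gt0 ?expR_gt0//.
  by rewrite hornerMn hornerC pmulrn_lgt0 ?fact_gt0.
suff -> j : poly_chain (alternating k) 0 1 j.*2.*2 = (k ^+ j.*2.*2)%:P.
  by rewrite /epoly hornerC mulr_gt0 ?expR_gt0// -!muln2 mulnC exprM exprn_gt0// exprn_even_gt0.
elim: j => [|j IH]; first by rewrite expr0.
rewrite !doubleS /= {}IH !alternating_odd.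
have -> : alternating k j.*2.*2.+2 = k by rewrite -!doubleS alternating_even.
have -> : alternating k j.*2.*2.+3 = - k by rewrite -!doubleS alternating_odd.
rewrite alternating_even !exprS; do !rewrite -?[_ *: _%:P]mul_polyC ?derivC ?add0r -?polyCM ?derivC ?add0r.
by congr _%:P; ring.
Qed.

Lemma exp_system_kernel (i : 'I_N) x : W (lift ord0 i) N x = 0.
Proof.
rewrite /exp_system; set P := poly_chain _ _ _ _.
suff /eqP : size P = 0%N by rewrite size_poly_eq0 => /eqP ->; rewrite /epoly horner0 mul0r.
apply/eqP; rewrite -leqn0 {}/P /exp_system_data /=; have iN := ltn_ord i.
have [->|k0] := eqVneq k 0.
  by rewrite poly_chain0 derivn_poly0 ?size_poly0// size_polyXn.
case: ltnP => si.
  by apply: leq_trans (size_poly_chainD _ _ _) _; rewrite size_polyXn; lia.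
by apply: leq_trans (size_poly_chainN _ _ _) _; rewrite size_polyXn; lia.
Qed.

Lemma exp_system_free (c : 'rV[R]_N.+1) : c 0 ord0 = 0 ->
  (forall x, combination W c x = 0) -> c = 0.
Proof.
move=> c0 cW.
have {}cW x : \sum_(i < N) c 0 (lift ord0 i) * W (lift ord0 i) 0%N x = 0.
  by have := cW x; rewrite /combination /lin big_ord_recl c0 mul0r add0r.
suff H (i : 'I_N) : c 0 (lift ord0 i) = 0.
  by apply/rowP => i; rewrite mxE; case: (unliftP ord0 i) => [j|] ->.
move: cW; rewrite /exp_system /exp_system_data /=; have [_|k0] := eqVneq k 0.
  move=> cW; have : \sum_(i < N) c 0 (lift ord0 i) *: 'X^i = 0 :> {poly R}.
    apply: poly_fun_eq0 => x; rewrite -[RHS](cW x) horner_sum.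
    by apply: eq_bigr => j _; rewrite /epoly mul0r expR0 mulr1 hornerZ.
  move=> /polyP/(_ i); rewrite coef0 coef_sum (bigD1 i)//= coefZ coefXn eqxx mulr1.
  rewrite big1 ?addr0// => j ji; rewrite coefZ coefXn [_ == _](_ : _ = false) ?mulr0//.
  by apply/negbTE; rewrite eq_sym.
move=> cW; pose a j := c 0 (inord j.+1).
have aE (j : 'I_N) : a j = c 0 (lift ord0 j).
  by rewrite /a; congr (c 0 _); apply/val_inj; rewrite /= inordK// ltnS ltn_ord.
pose A := \poly_(j < s.*2) a j; pose B := \poly_(j < s.*2) a (j + s.*2)%N.
(* Multiplying the relation by [expR (k * t)] changes the exponents [k] and [- k] into [k + k] and
   0. *)
have [|t|A0 B0] := @epoly_free (k + k) A B.
- by rewrite -mulr2n mulrn_eq0.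
- have <- : expR (k * t) * 0 = 0 by rewrite mulr0.
  rewrite -(cW t); under eq_bigr => j _ do rewrite -aE.
  rewrite -(big_mkord xpredT (fun j => a j * epoly (if (j < s.*2)%N then (k, 'X^j)
    else (- k, 'X^(j - s.*2))).1 (if (j < s.*2)%N then (k, 'X^j)
    else (- k, 'X^(j - s.*2))).2 t)).
  rewrite (@big_cat_nat _ _ _ s.*2)//=; last by rewrite -(addnn s.*2) leq_addr.
  rewrite mulrDr {1}/epoly /A /B !horner_poly -[in X in _ = _ + _ * X](add0n s.*2).
  rewrite -(addnn s.*2) big_addn addnK !big_mkord.
  rewrite mulr_suml !mulr_sumr; congr (_ + _); apply: eq_bigr => j _.
    rewrite ltn_ord /= /epoly hornerXn mulrDl expRD; ring.
  rewrite ltnNge leq_addl /= addnK /epoly hornerXn mulNr expRN.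
  have := expR_gt0 (k * t) => ?; field; exact: lt0r_neq0.
rewrite -aE; have [si|si] := ltnP i s.*2.
  by have := congr1 (fun P : {poly R} => P`_i) A0; rewrite coef0 coef_poly si.
have := congr1 (fun P : {poly R} => P`_(i - s.*2)) B0.
by rewrite coef0 coef_poly subnK// ltn_subLR// addnn ltn_ord.
Qed.

Lemma exp_system_ge0 x : 0 <= W ord0 0%N x.
Proof.
rewrite /exp_system /exp_system_data /epoly /= mulr_ge0 ?expR_ge0//.
case: eqVneq => _ /=; last by rewrite hornerC.
by rewrite hornerXn exprn_even_ge0// odd_double.
Qed.

(** This is the strictly positive combination [e] that the quadrature asks for. For [k = 0] the
    constant lies in the kernel, which is nonzero by [0 < s]. *)
Lemma exp_system_const (s0 : (0 < s)%N) :
  exists e : 'rV[R]_N.+1, forall x, combination W e x = 1.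
Proof.
have [i Wi] : exists i, forall x, W i 0%N x = 1; last first.
  exists (delta_mx 0 i) => x; rewrite /combination /lin (bigD1 i)//= big1 => [|j ji].
    by rewrite mxE !eqxx mul1r Wi addr0.
  by rewrite mxE eqxx (negbTE ji) mul0r.
rewrite /exp_system /exp_system_data /epoly; have [_|k0] := eqVneq k 0.
  have N0 : (0 < N)%N by rewrite -!muln2; lia.
  by exists (lift ord0 (Ordinal N0)) => x; rewrite /= hornerC mul0r expR0 mulr1.
by exists ord0 => x; rewrite /= hornerC mul0r expR0 mulr1.
Qed.

Lemma exp_system_ord0 x : k != 0 -> W ord0 0%N x = 1.
Proof.
move=> k0; rewrite /exp_system /exp_system_data /epoly (negbTE k0) /=.
by rewrite hornerC mul0r expR0 mulr1.
Qed.

End exponential_polynomials.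

(** * The torus *)

Section torus_topology.
Variables (R : realType) (n : nat).
Local Open Scope quotient_scope.
Implicit Types (y : 'rV[R]_n) (z : torus R n) (m k : 'rV[int]_n).

Definition lattice_shift m : 'rV[R]_n := \row_j (2 * pi * (m 0 j)%:~R).

Definition torus_repr z : 'rV[R]_n := \row_j (repr (z 0 j) : R).

Lemma circle_piP (x x' : R) :
  \pi_(circle R) x = \pi_(circle R) x' <-> exists m : int, x - x' = 2 * pi * m%:~R.
Proof.
have P : reflect (\pi_(circle R) x = \pi_(circle R) x') (circle_rel x x').
  exact: (@eqmodP _ (circle_equiv R)).
by split=> [/P/asboolP|H]; [|exact/P/asboolP].
Qed.

Lemma torus_projE y i j : torus_proj y i j = \pi_(circle R) (y 0 j).
Proof. by rewrite (ord1 i) /torus_proj !mxE. Qed.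

Lemma torus_projP y y' :
  torus_proj y = torus_proj y' <-> exists m, y = y' + lattice_shift m.
Proof.
split=> [/rowP E|[m ->]]; last first.
  apply/rowP => j; rewrite !torus_projE; apply/circle_piP; exists (m 0 j).
  by rewrite !mxE addrAC subrr add0r.
have H j : exists m : int, y 0 j - y' 0 j = 2 * pi * m%:~R.
  by have := E j; rewrite !torus_projE => /circle_piP.
have [f fP] := choice H; exists (\row_j f j); apply/rowP => j.
by rewrite !mxE -fP addrC subrK.
Qed.

Lemma torus_reprK : cancel torus_repr (@torus_proj R n).
Proof. by move=> z; apply/rowP => j; rewrite torus_projE mxE reprK. Qed.

Lemma torus_repr_proj y : exists m, torus_repr (torus_proj y) = y + lattice_shift m.
Proof. by apply/torus_projP; rewrite torus_reprK. Qed.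

Definition lattice_periodic (T : Type) (w : 'rV[R]_n -> T) :=
  forall y m, w (y + lattice_shift m) = w y.

(** Functions on the torus are written with the arbitrary representatives [torus_repr]; periodicity
    makes the choice immaterial. *)
Lemma periodic_torus_repr (T : Type) (w : 'rV[R]_n -> T) y : lattice_periodic w ->
  w (torus_repr (torus_proj y)) = w y.
Proof. by move=> pw; have [m ->] := torus_repr_proj y; rewrite pw. Qed.

Definition phase k y : R := \sum_(j < n) (k 0 j)%:~R * y 0 j.

Lemma cosDint2pi (x : R) (q : int) : cos (x + 2 * pi * q%:~R) = cos x.
Proof.
wlog : x q / exists p : nat, q = p => [H|[p ->]].
  case: q => p; first by apply: H; exists p.
  by rewrite NegzE mulrNz mulrN -(H _ p.+1) ?subrK//; exists p.+1.
have -> : 2 * pi * (p%:Z)%:~R = pi *+ 2 *+ p :> R by rewrite -[RHS]mulr_natr -[pi *+ 2]mulr_natl.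
exact: (periodicn (@cosD2pi R)).
Qed.

Lemma sinDint2pi (x : R) (q : int) : sin (x + 2 * pi * q%:~R) = sin x.
Proof. by rewrite -!cosBpihalf addrAC cosDint2pi. Qed.

Lemma phase_shift k y m : exists q : int,
  phase k (y + lattice_shift m) = phase k y + 2 * pi * q%:~R.
Proof.
exists (\sum_j k 0 j * m 0 j); rewrite /phase rmorph_sum mulr_sumr -big_split.
by apply: eq_bigr => j _ /=; rewrite !mxE intrM; ring.
Qed.

Lemma cos_phase_periodic k : lattice_periodic (fun y => cos (phase k y)).
Proof. by move=> y m; have [q ->] := phase_shift k y m; rewrite cosDint2pi. Qed.

Lemma sin_phase_periodic k : lattice_periodic (fun y => sin (phase k y)).
Proof. by move=> y m; have [q ->] := phase_shift k y m; rewrite sinDint2pi. Qed.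

Definition tcos k z : R := cos (phase k (torus_repr z)).
Definition tsin k z : R := sin (phase k (torus_repr z)).

Lemma tcos_proj k y : tcos k (torus_proj y) = cos (phase k y).
Proof. exact: (periodic_torus_repr y (@cos_phase_periodic k)). Qed.

Lemma tsin_proj k y : tsin k (torus_proj y) = sin (phase k y).
Proof. exact: (periodic_torus_repr y (@sin_phase_periodic k)). Qed.

Lemma characterE k z : character k z = (tcos k z +i* tsin k z)%C.
Proof.
suff E : \sum_(j < n) (k 0 j)%:~R * repr (z 0 j) = phase k (torus_repr z) :> R.
  by rewrite /character /= E.
by apply: eq_bigr => j _; rewrite mxE.
Qed.

(** The preimage of the image of [U] is the union of the translates of [U] by multiples of
    [2 pi]. *)
Lemma circle_pi_open (U : set R) : open U -> open (\pi_(circle R) @` U).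
Proof.
move=> oU; rewrite /open /= /quotient_open.
have -> : \pi_(circle R) @^-1` (\pi_(circle R) @` U) =
    \bigcup_(m in [set: int]) [set x | U (x + 2 * pi * m%:~R)].
  apply/seteqP; split=> x /=.
    move=> [u Uu /circle_piP[m um]]; exists m => //=.
    by rewrite -um addrC subrK.
  move=> [m _ /= Ux]; exists (x + 2 * pi * m%:~R) => //.
  by apply/circle_piP; exists m; rewrite addrAC subrr add0r.
apply: bigcup_open => m _.
apply: (@open_comp _ _ (fun x : R => x + 2 * pi * m%:~R) U) => // x _.
by apply: cvgD; [exact: cvg_id|exact: cvg_cst].
Qed.

Lemma torus_proj_nbhs y (N : set 'rV[R]_n) : nbhs y N ->
  nbhs (torus_proj y) (@torus_proj R n @` N).
Proof.
move=> [P Py PN].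
exists (fun i j => \pi_(circle R) @` (P i j)°) => [i j|z zP].
  rewrite torus_projE; apply: open_nbhs_nbhs; split.
    by apply: circle_pi_open; exact: open_interior.
  exists (y i j) => //; last by rewrite ord1.
  exact: Py.
have H j : exists x : R, P 0 j x /\ \pi_(circle R) x = z 0 j.
  by have [x Px xz] := zP 0 j; exists x; split=> //; exact: interior_subset.
have [f fP] := choice H.
exists (\row_j f j); last by apply/rowP => j; rewrite torus_projE mxE; have [] := fP j.
apply: PN => i j; rewrite ord1 !mxE; by have [] := fP j.
Qed.

Lemma torus_proj_continuous : continuous (@torus_proj R n).
Proof.
move=> y N [P Py PN]; exists (fun i j => \pi_(circle R) @^-1` (P i j)).
  move=> i j; have := Py i j; rewrite torus_projE => /(@pi_continuous _ _ (y 0 j)).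
  by rewrite (ord1 i).
move=> z zP; apply: PN => i j; have := zP i j; by rewrite /= torus_projE (ord1 i).
Qed.

(** [torus_repr] has jumps, so this is not a composition of continuous maps; it holds because the
    projection is open. *)
Lemma descent_continuous (T : topologicalType) (f : R * 'rV[R]_n -> T) (t : R) z :
  (forall t', lattice_periodic (fun y => f (t', y))) ->
  {for (t, torus_repr z), continuous f} ->
  {for (t, z), continuous (fun x : cylinder R n => f (x.1, torus_repr x.2))}.
Proof.
move=> pf cf N /cf [[A B] /= [At Bz] ABN].
exists (A, @torus_proj R n @` B); first split => //=.
  by rewrite -[z in nbhs z]torus_reprK; exact: torus_proj_nbhs.
move=> [t' z'] /= [At' [y By <-]].
rewrite (periodic_torus_repr y (pf t')); exact: (ABN (t', y)).
Qed.

End torus_topology.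

(** * Bounded functionals *)

Section bounded_functionals.
Context d (T : measurableType d) (R : realType).
Implicit Types (f g : T -> R) (I J : (T -> R) -> R).

Definition bounded_measurable f : Prop :=
  measurable_fun [set: T] f /\ exists M : R, forall x, `|f x| <= M.

Lemma bounded_measurable_cst (c : R) : bounded_measurable (fun _ => c).
Proof. by split; [exact: measurable_cst|exists `|c|]. Qed.

Lemma bounded_measurableD f g : bounded_measurable f -> bounded_measurable g ->
  bounded_measurable (fun x => f x + g x).
Proof.
move=> [mf [M fM]] [mg [L gL]]; split; first exact: measurable_funD.
by exists (M + L) => x; apply: le_trans (ler_normD _ _) _; exact: lerD.
Qed.

Lemma bounded_measurableM f g : bounded_measurable f -> bounded_measurable g ->
  bounded_measurable (fun x => f x * g x).
Proof.
move=> [mf [M fM]] [mg [L gL]]; split; first exact: measurable_funM.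
by exists (M * L) => x; rewrite normrM ler_pM.
Qed.

Lemma bounded_measurableZ (c : R) f : bounded_measurable f ->
  bounded_measurable (fun x => c * f x).
Proof. by move=> bf; apply: bounded_measurableM => //; exact: bounded_measurable_cst. Qed.

Lemma bounded_measurableB f g : bounded_measurable f -> bounded_measurable g ->
  bounded_measurable (fun x => f x - g x).
Proof.
move=> bf bg; have := bounded_measurableD bf (bounded_measurableZ (-1) bg).
by under [X in bounded_measurable X -> _]eq_fun do rewrite mulN1r.
Qed.

Lemma bounded_measurable_sum n (F : 'I_n -> T -> R) :
  (forall i, bounded_measurable (F i)) -> bounded_measurable (fun x => \sum_i F i x).
Proof.
elim: n F => [|n IH] F bF.
  by under eq_fun do rewrite big_ord0; exact: bounded_measurable_cst.
under eq_fun do rewrite big_ord_recl.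
by apply: bounded_measurableD => //; exact: IH.
Qed.

Lemma bounded_measurable_indic (A : set T) : measurable A ->
  bounded_measurable (\1_A : T -> R).
Proof.
move=> mA; split; first exact: measurable_indic.
by exists 1 => x; rewrite indicE; case: (_ \in _); rewrite ?normr1// normr0.
Qed.

(* Integration against a signed measure, in a form that is closed under
   composition with linear operators such as [f |-> fourier coefficient of f]. *)
Record bounded_functional I : Prop := BoundedFunctional {
  bfunD : forall f g, bounded_measurable f -> bounded_measurable g ->
    I (fun x => f x + g x) = I f + I g;
  bfunZ : forall c f, bounded_measurable f -> I (fun x => c * f x) = c * I f;
  bfun_cvg : forall (F : nat -> T -> R) f M, (forall n, bounded_measurable (F n)) ->
    (forall n x, `|F n x| <= M) -> bounded_measurable f ->
    (forall x, F n x @[n --> \oo] --> f x) -> I (F n) @[n --> \oo] --> I f }.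

Lemma bfun0 I : bounded_functional I -> I (fun _ => 0) = 0.
Proof.
move=> bI; have := bfunZ bI 0 (bounded_measurable_cst 0); by rewrite !mul0r.
Qed.

Lemma bfunB I f g : bounded_functional I -> bounded_measurable f ->
  bounded_measurable g -> I (fun x => f x - g x) = I f - I g.
Proof.
move=> bI bf bg; have := bfunD bI bf (bounded_measurableZ (-1) bg).
rewrite (bfunZ bI)// mulN1r => <-; congr I; apply/funext => x.
by rewrite mulN1r.
Qed.

Lemma bfun_sum I n (F : 'I_n -> T -> R) : bounded_functional I ->
  (forall i, bounded_measurable (F i)) ->
  I (fun x => \sum_i F i x) = \sum_i I (F i).
Proof.
move=> bI; elim: n F => [|n IH] F bF.
  by under eq_fun do rewrite big_ord0; rewrite bfun0// big_ord0.
under eq_fun do rewrite big_ord_recl; rewrite big_ord_recl.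
by rewrite (bfunD bI)// ?IH//; exact: bounded_measurable_sum.
Qed.

Lemma bfun_linear I J a b : bounded_functional I -> bounded_functional J ->
  bounded_functional (fun f => a * I f + b * J f).
Proof.
move=> bI bJ; split=> [f g bf bg|c f bf|F f M bF FM bf Ff].
- by rewrite (bfunD bI)// (bfunD bJ)//; ring.
- by rewrite (bfunZ bI)// (bfunZ bJ)//; ring.
- apply: cvgD; apply: cvgMl_tmp; first exact: (bfun_cvg bI bF FM bf Ff).
  exact: (bfun_cvg bJ bF FM bf Ff).
Qed.

(** The sum counts the positive integers up to [y]: it is the integer part of [y]. *)
Lemma staircase_approx (n : nat) (y : R) : 0 <= y <= n%:R ->
  (\sum_(i < n) (i.+1%:R <= y)%R%:R : R) <= y <= \sum_(i < n) (i.+1%:R <= y)%R%:R + 1.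
Proof.
have H (m : nat) (z : R) : m%:R <= z -> \sum_(i < m) (i.+1%:R <= z)%R%:R = m%:R :> R.
  move=> mz; rewrite (eq_bigr (fun _ => 1)) ?sumr_const ?card_ord// => i _.
  by rewrite (le_trans _ mz)// ler_nat.
elim: n => [|n IH] /andP[y0 yn].
  by rewrite big_ord0 y0 (le_trans yn)// add0r ler01.
rewrite big_ord_recr /=; have [ny|ny] := leP n.+1%:R y.
  have nn : n%:R <= y by apply: le_trans ny; rewrite ler_nat.
  rewrite H//; have : n.+1%:R = n%:R + 1 :> R by rewrite natr1.
  by move=> E; rewrite [true%:R]/(1%:R) -E ny (le_trans yn)// lerDl ler01.
rewrite addr0; have [ny'|ny'] := leP y n%:R; first by apply: IH; rewrite y0.
by rewrite H ?(ltW ny')//= natr1 ltW.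
Qed.

(** After adding a constant, [f] takes values in [[0, M]] and is the uniform limit of staircases of
    step [M / n.+1], which are combinations of indicators of superlevel sets. *)
Lemma bfun_ext I J : bounded_functional I -> bounded_functional J ->
  (forall A, measurable A -> I \1_A = J \1_A) ->
  forall f, bounded_measurable f -> I f = J f.
Proof.
move=> bI bJ IJ f bf.
wlog [M M0 fM] : f bf / exists2 M : R, 0 < M & forall x, 0 <= f x <= M.
  move=> H; have [mf [M fM]] := bf.
  have bM : bounded_measurable (fun _ : T => `|M|) := bounded_measurable_cst _.
  have E : I (fun x => f x + `|M|) = J (fun x => f x + `|M|).
    apply: H; first exact: bounded_measurableD.
    exists (`|M| + `|M| + 1) => [|x]; first by rewrite ltr_wpDl// addr_ge0.
    have := le_trans (fM x) (ler_norm M); rewrite ler_norml; lra.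
  have EM : I (fun _ => `|M|) = J (fun _ => `|M|).
    apply: H => //; exists (`|M| + 1) => [|x]; first by rewrite ltr_wpDl.
    by rewrite normr_ge0/= lerDl.
  by move: E; rewrite (bfunD bI)// (bfunD bJ)// EM => /addIr.
pose A (n : nat) (i : 'I_n.+1) := [set x | i.+1%:R <= f x * n.+1%:R / M].
have mA n i : measurable (@A n i).
  have mg : measurable_fun setT (fun x => f x * n.+1%:R / M).
    by apply: measurable_funM => //; apply: measurable_funM => //; case: bf.
  rewrite (_ : A n i = (fun x => f x * n.+1%:R / M) @^-1` `[i.+1%:R, +oo[); last first.
    by apply/seteqP; split=> x /=; rewrite in_itv/= andbT.
  by rewrite -[X in measurable X]setTI; apply: mg.
pose F n x : R := \sum_(i < n.+1) M / n.+1%:R * \1_(A n i) x.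
have bA n i : bounded_measurable (\1_(A n i) : T -> R).
  by apply: bounded_measurable_indic; exact: mA.
have bF n : bounded_measurable (F n).
  by apply: bounded_measurable_sum => i; apply: bounded_measurableZ; exact: bA.
have FIJ n : I (F n) = J (F n).
  rewrite /F (bfun_sum bI) ?(bfun_sum bJ)//; last 2 first.
  - by move=> i; apply: bounded_measurableZ; exact: bA.
  - by move=> i; apply: bounded_measurableZ; exact: bA.
  by apply: eq_bigr => i _; rewrite (bfunZ bI)// (bfunZ bJ)// IJ.
have Fappr n x : F n x <= f x <= F n x + M / n.+1%:R.
  have n0 : 0 < n.+1%:R :> R by rewrite ltr0n.
  have /andP[f0 f1] := fM x.
  have iM : 0 <= M^-1 by rewrite invr_ge0 ltW.
  have y0 : 0 <= f x * n.+1%:R / M by apply: mulr_ge0 iM; rewrite mulr_ge0.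
  have yn : f x * n.+1%:R / M <= n.+1%:R by rewrite ler_pdivrMr// mulrC ler_wpM2l.
  have := @staircase_approx n.+1 (f x * n.+1%:R / M); rewrite y0 yn => /(_ isT)/andP[].
  have -> : F n x = M / n.+1%:R * \sum_(i < n.+1) (i.+1%:R <= f x * n.+1%:R / M)%R%:R.
    rewrite /F mulr_sumr; apply: eq_bigr => i _; rewrite indicE.
    by congr (_ * (_ : bool)%:R); apply/idP/idP => [/set_mem//|H]; exact/mem_set.
  set S := \sum_(_ < _) _ => Sy yS; have -> : M / n.+1%:R * S + M / n.+1%:R = M / n.+1%:R * (S + 1) by ring.
  have -> : f x = M / n.+1%:R * (f x * n.+1%:R / M) by field; rewrite ?gt_eqF.
  have k0 : 0 <= M / n.+1%:R by rewrite ltW// divr_gt0.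
  by apply/andP; split; apply: ler_wpM2l.
have Fcvg x : F n x @[n --> \oo] --> f x.
  apply: (@squeeze_cvgr _ _ _ _ (fun n => f x - M / n.+1%:R) (fun _ => f x)).
  - apply: nearW => n; have /andP[? ?] := Fappr n x.
    by apply/andP; split=> //; rewrite lerBlDr.
  - rewrite -[X in _ --> X]subr0; apply: cvgB; first exact: cvg_cst.
    rewrite -[X in _ --> X](mulr0 M); apply: cvgMl_tmp; exact: cvg_harmonic.
  - exact: cvg_cst.
have FM n x : `|F n x| <= M.
  have F0 : 0 <= F n x.
    by apply: sumr_ge0 => i _; rewrite !mulr_ge0 ?invr_ge0 ?(ltW M0)// indicE.
  rewrite ger0_norm//; have /andP[Ff _] := Fappr n x.
  by have /andP[_] := fM x; exact: le_trans.
have cI := bfun_cvg bI bF FM bf Fcvg.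
have cJ := bfun_cvg bJ bF FM bf Fcvg.
have E : (fun n => I (F n)) = (fun n => J (F n)) by apply/funext.
by rewrite E in cI; exact: (cvg_unique _ cI cJ).
Qed.

Lemma bounded_measurable_integrable (mu : {measure set T -> \bar R}) f :
  (mu setT < +oo)%E -> bounded_measurable f -> mu.-integrable setT (EFin \o f).
Proof.
move=> muT [mf [M fM]]; apply: measurable_bounded_integrable => //.
by exists M; split; [exact: num_real|move=> y My x _ /=; exact: le_trans (fM x) (ltW My)].
Qed.

Lemma bfun_Rintegral (mu : {measure set T -> \bar R}) : (mu setT < +oo)%E ->
  bounded_functional (Rintegral mu setT).
Proof.
move=> muT; split=> [f g bf bg|c f bf|F f M bF FM bf Ff].
- by rewrite RintegralD//; exact: bounded_measurable_integrable.
- by rewrite RintegralZl//; exact: bounded_measurable_integrable.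
- have M0 : bounded_measurable (fun _ : T => M) := bounded_measurable_cst _.
  have := @dominated_convergence _ _ _ mu setT measurableT
    (fun n => EFin \o F n) (EFin \o f) (fun _ => M%:E).
  case=> //=.
  - by move=> n; apply/measurable_EFinP; case: (bF n).
  - by apply/measurable_EFinP; case: bf.
  - by apply: aeW => x _; apply: cvg_EFin; [exact: nearW|exact: Ff].
  - exact: (bounded_measurable_integrable muT M0).
  - by apply: aeW => x n _; rewrite lee_fin.
  move=> _ _ H; apply: fine_cvg; rewrite fineK//.
  apply: integrable_fin_num => //; exact: (bounded_measurable_integrable muT bf).
Qed.

Lemma Rintegral_indicT (mu : {measure set T -> \bar R}) (A : set T) :
  measurable A -> Rintegral mu setT \1_A = fine (mu A).
Proof. by move=> mA; rewrite /Rintegral integral_indic// setIT. Qed.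

(** A charge is a function on all sets; the nonmeasurable ones get the default value 0. *)
Definition bfun_set (I : (T -> R) -> R) (A : set T) : \bar R :=
  (if pselect (measurable A) then I \1_A else 0)%:E.

Lemma bfun_setE I A : measurable A -> bfun_set I A = (I \1_A)%:E.
Proof. by rewrite /bfun_set; case: pselect. Qed.

Lemma bfun_set0 I : bounded_functional I -> bfun_set I set0 = 0%E.
Proof.
move=> bI; rewrite bfun_setE// (_ : \1_set0 = fun _ => 0) ?bfun0//.
by apply/funext => x; rewrite indicE in_set0.
Qed.

(** Countable additivity is bounded convergence for the indicators of the partial unions. *)
Lemma bfun_set_sigma_additive I : bounded_functional I -> semi_sigma_additive (bfun_set I).
Proof.
move=> bI F mF tF mUF; rewrite bfun_setE//.
have mUn n : measurable (\bigcup_(i < n) F i) by apply: bigcup_measurable => ? _.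
have E n : (\sum_(0 <= i < n) bfun_set I (F i))%E = (I \1_(\bigcup_(i < n) F i))%:E.
  rewrite big_mkord (eq_bigr (fun i : 'I_n => (I \1_(F i))%:E)); last by move=> i _; rewrite bfun_setE.
  rewrite sumEFin -(bfun_sum bI) => [|i]; last exact: bounded_measurable_indic.
  congr (I _)%:E; apply/funext => x; rewrite indicE.
  have [[i /= ilt Fix]|nx] := pselect ((\bigcup_(i < n) F i) x).
    rewrite mem_set//=; last by exists i.
    rewrite (bigD1 (Ordinal ilt))//= indicE mem_set// big1 ?addr0// => j ji.
    rewrite indicE memNset// => Fjx; move/eqP: ji; apply; apply/val_inj => /=.
    by apply: (tF j i Logic.I Logic.I); exists x.
  rewrite memNset// big1// => i _; rewrite indicE memNset// => Fix; apply: nx; exists i => //.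
  exact: ltn_ord.
under eq_fun do rewrite E.
apply: cvg_EFin; first exact: nearW.
apply: (bfun_cvg bI (M := 1)).
- by move=> n; exact: bounded_measurable_indic.
- by move=> n x; rewrite indicE ger0_norm// lern1; case: (_ \in _).
- exact: bounded_measurable_indic.
- move=> x; have [[i _ Fix]|nx] := pselect ((\bigcup_i F i) x); last first.
    rewrite (_ : (fun n => _) = fun _ => \1_(\bigcup_i F i) x); first exact: cvg_cst.
    apply/funext => n; rewrite !indicE !memNset// => -[j _ Fjx]; apply: nx; exists j => //.
  apply: cvg_near_cst; exists i.+1 => // n /= ni.
  by rewrite !indicE !mem_set//; exists i.
Qed.

Lemma bfun_measure I : bounded_functional I ->
  (forall f, bounded_measurable f -> (forall x, 0 <= f x) -> 0 <= I f) ->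
  exists mu : {measure set T -> \bar R}, (mu setT < +oo)%E /\
    forall f, bounded_measurable f -> Rintegral mu setT f = I f.
Proof.
move=> bI Ipos; have mge0 A : (0 <= bfun_set I A)%E.
  rewrite /bfun_set; case: pselect => //= mA; rewrite lee_fin; apply: Ipos => [|x].
    exact: bounded_measurable_indic.
  by rewrite indicE.
pose mu : {measure set T -> \bar R} := HB.pack_for (Measure.type T R) (bfun_set I)
  (isMeasure.Build _ T R (bfun_set I) (bfun_set0 bI) mge0 (bfun_set_sigma_additive bI)).
have muE A : measurable A -> mu A = (I \1_A)%:E by exact: bfun_setE.
exists mu; have muT : (mu setT < +oo)%E by rewrite muE// ltry.
split=> // f; apply: bfun_ext => //; first exact: bfun_Rintegral.
by move=> A mA; rewrite Rintegral_indicT// muE.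
Qed.

Lemma bfun_charge_Rintegral (mu : {charge set T -> \bar R}) :
  bounded_functional (charge_Rintegral mu setT).
Proof.
have := bfun_linear 1 (-1)
  (bfun_Rintegral (mu := jordan_pos (hahnP mu)) _)
  (bfun_Rintegral (mu := jordan_neg (hahnP mu)) _).
rewrite (_ : (fun f => _) = charge_Rintegral mu setT); last first.
  by apply/funext => f; rewrite mul1r mulN1r.
by apply; rewrite -ge0_fin_numE// fin_num_measure.
Qed.

Lemma charge_Rintegral_indic (mu : {charge set T -> \bar R}) A : measurable A ->
  (charge_Rintegral mu setT \1_A)%:E = mu A.
Proof.
move=> mA; rewrite /charge_Rintegral !Rintegral_indicT// EFinB !fineK ?fin_num_measure//.
by rewrite (jordan_decomp (hahnP mu) mA)/= /cadd/= cscaleN1.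
Qed.

Lemma charge_Rintegral_mkcond (mu : {charge set T -> \bar R}) D f :
  charge_Rintegral mu D f = charge_Rintegral mu setT (f \_ D).
Proof. by rewrite /charge_Rintegral 2!(Rintegral_mkcond _ D). Qed.

Lemma bfun_charge I : bounded_functional I ->
  exists mu : {charge set T -> \bar R},
    forall f, bounded_measurable f -> charge_Rintegral mu setT f = I f.
Proof.
move=> bI; have mfin : fin_num_fun (bfun_set I) by move=> A mA; rewrite bfun_setE.
pose mu : {charge set T -> \bar R} := HB.pack_for (Charge.type T R) (bfun_set I)
  (isCharge.Build _ T R (bfun_set I) (bfun_set0 bI) mfin (bfun_set_sigma_additive bI)).
have muE A : measurable A -> mu A = (I \1_A)%:E by exact: bfun_setE.
exists mu => f; apply: bfun_ext => //; first exact: bfun_charge_Rintegral.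
by move=> A mA; apply: EFin_inj; rewrite charge_Rintegral_indic// muE.
Qed.

(** The Weierstrass test: the bounds [M * c e] make the tails small for all [F n] at once, so that
    the limit in [n] passes through the sum. *)
Lemma bfun_series (J : nat -> (T -> R) -> R) (c : nat -> R) (C : R) :
  (forall e, bounded_functional (J e)) ->
  (forall e f M, bounded_measurable f -> (forall x, `|f x| <= M) -> `|J e f| <= M * c e) ->
  (forall e, 0 <= c e) -> (forall n, \sum_(0 <= e < n) c e <= C) ->
  bounded_functional (fun f => limn (series (fun e => J e f))) /\
  forall f, bounded_measurable f -> cvgn (series (fun e => J e f)).
Proof.
move=> bJ Jc c0 cC.
have cvc : cvgn (series c).
  apply: nondecreasing_is_cvgn; first by apply: nondecreasing_series => ? _ _; exact: c0.
  by exists C => _ [n _ <-]; exact: cC.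
have cvJ f : bounded_measurable f -> cvgn (series (fun e => J e f)).
  move=> bf; have [_ [M fM]] := bf; apply: normed_cvg.
  apply: (@series_le_cvg _ _ (fun e => M * c e)) => [e|e|e|].
  - exact: normr_ge0.
  - by rewrite (le_trans (normr_ge0 (J e f))) ?Jc.
  - exact: Jc.
  - exact: is_cvg_seriesZ.
split=> //; split=> [f g bf bg|k f bf|F f M bF FM bf Ff].
- rewrite -limD; [|exact: cvJ..]; congr (limn _).
  apply/funext => n; rewrite fctE /series/= -big_split; apply: eq_bigr => e _ /=.
  exact: (bfunD (bJ e)).
- transitivity (limn (fun n => k * series (fun e => J e f) n)).
    congr (limn _); apply/funext => n; rewrite /series/= mulr_sumr.
    by apply: eq_bigr => e _; exact: (bfunZ (bJ e)).
  by apply/cvg_lim => //; apply: cvgMl_tmp; exact: cvJ.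
pose S h n := series (fun e => J e h) n; pose L := limn (series c).
pose M1 := Num.max M 0.
have M10 : 0 <= M1 by rewrite le_max lexx orbT.
have FM1 n x : `|F n x| <= M1 by rewrite le_max FM.
have fM1 x : `|f x| <= M1.
  have Fx : `|F n x| @[n --> \oo] --> `|f x| by apply: cvg_norm; exact: Ff.
  by apply: (cvgr_to_le Fx); apply: nearW => n; exact: FM1.
have tail h K : bounded_measurable h -> (forall x, `|h x| <= M1) ->
    `|limn (S h) - S h K| <= M1 * (L - series c K).
  move=> bh hM.
  have Sx : `|S h m - S h K| @[m --> \oo] --> `|limn (S h) - S h K|.
    by apply: cvg_norm; apply: cvgB; [exact: cvJ|exact: cvg_cst].
  apply: (cvgr_to_le Sx); exists K => // m /= Km.
  rewrite /S sub_series_geq// (le_trans (ler_norm_sum _ _ _))//.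
  apply: (@le_trans _ _ (M1 * (series c m - series c K))).
    by rewrite sub_series_geq// mulr_sumr; apply: ler_sum => e _; exact: Jc.
  rewrite ler_wpM2l// lerB//; apply: nondecreasing_cvgn_le => //.
  by apply: nondecreasing_series => ? _ _; exact: c0.
apply/cvgrPdist_le => eps eps0.
have [K Keps] : exists K, M1 * (L - series c K) <= eps / 3.
  have : M1 * (L - series c K) @[K --> \oo] --> (0 : R).
    have -> : 0 = M1 * (L - L) by rewrite subrr mulr0.
    by apply: cvgMl_tmp; apply: cvgB; [exact: cvg_cst|exact: cvc].
  move=> /cvgrPdist_le/(_ (eps / 3)) []; first by rewrite divr_gt0.
  move=> K _ /(_ K (leqnn K)); rewrite sub0r normrN => H.
  by exists K; exact: le_trans (ler_norm _) H.
have : S (F n) K @[n --> \oo] --> S f K.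
  rewrite /S /series/=; elim: (K) => [|m IH].
    by rewrite big_nil (_ : (fun n => _) = fun=> 0); [exact: cvg_cst|apply/funext => n; rewrite big_nil].
  rewrite big_nat_recr//= (_ : (fun n => _) =
      fun n => \sum_(0 <= e < m) J e (F n) + J m (F n)); last first.
    by apply/funext => n; rewrite big_nat_recr.
  by apply: cvgD => //; exact: (bfun_cvg (bJ m) bF FM bf Ff).
move=> /cvgrPdist_le/(_ (eps / 3)); move=> /(_ _)[|N _ HN]; first by rewrite divr_gt0.
exists N => // n Nn; have tf := tail f K bf fM1; have tF := tail (F n) K (bF n) (FM1 n).
have := HN n Nn => /= HK; rewrite /= -/(S f) -/(S (F n)).
rewrite (_ : _ - _ = (limn (S f) - S f K) + (S f K - S (F n) K) + (S (F n) K - limn (S (F n)))); last by ring.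
apply: le_trans (ler_normD _ _) _; apply: le_trans (lerD (ler_normD _ _) (lexx _)) _.
rewrite [X in _ + X]distrC (_ : eps = eps / 3 + eps / 3 + eps / 3); last by field.
by apply: lerD; [apply: lerD => //; exact: le_trans Keps|exact: le_trans Keps].
Qed.

End bounded_functionals.

(** * Fourier uniqueness on the cylinder *)

Section threshold_polynomials.
Variable R : realType.
Implicit Types (x w : R).

Lemma bernoulli_ge (x : R) n : -1 <= x -> 1 + n%:R * x <= (1 + x) ^+ n.
Proof.
move=> x1; elim: n => [|n IH]; first by rewrite mul0r addr0 expr0.
have x0 : 0 <= 1 + x by rewrite addrC -lerBlDr sub0r.
rewrite exprS; apply: le_trans (ler_wpM2l x0 IH); rewrite -natr1.
have : 0 <= n%:R * x ^+ 2 by rewrite mulr_ge0// sqr_ge0.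
rewrite expr2; lra.
Qed.

(** Let [u = (1 - w^(2n))^(4^n)]. The critical point is [w = 1/2], where [4^n w^(2n) = 1]. Above it
    [n u] tends to 0, so the outer power does no harm. At or below it [u] stays at least [1/4] for
    [n >= 1], and the outer power drives [1 - u] to 0, even at [w = 1/2]. *)
Definition threshold n w : R := (1 - (1 - w ^+ n.*2) ^+ (4 ^ n)) ^+ n.

Lemma itv01X (x : R) n : 0 <= x <= 1 -> 0 <= x ^+ n <= 1.
Proof. by move=> /andP[x0 x1]; rewrite exprn_ge0// exprn_ile1. Qed.

Lemma itv01B (x : R) : 0 <= x <= 1 -> 0 <= 1 - x <= 1.
Proof. by move=> /andP[x0 x1]; rewrite subr_ge0 x1 lerBlDr lerDl. Qed.

Lemma threshold01 n w : 0 <= w <= 1 -> 0 <= threshold n w <= 1.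
Proof. by move=> w01; do 3 (apply: itv01X; try apply: itv01B). Qed.

Lemma threshold_cvg1 w : 2^-1 < w <= 1 -> threshold n w @[n --> \oo] --> (1 : R).
Proof.
move=> /andP[w2 w1]; pose v := 2 * w.
have w0 : 0 <= w <= 1 by rewrite w1 andbT; apply: ltW; apply: lt_trans w2; rewrite invr_gt0.
have v1 : 1 < v by rewrite /v -(@ltr_pM2l _ 2^-1) ?invr_gt0// mulKf// mulr1.
have v0 : 0 < v := lt_trans ltr01 v1.
apply: (@squeeze_cvgr _ _ _ _ (fun n => 1 - (v - 1)^-1 * v^-1 ^+ n) (fun _ => 1)).
- apply: nearW => n; have /andP[_ ->] := threshold01 n w0; rewrite andbT.
  have /andP[x0 x1] := itv01X n.*2 w0.
  pose u := (1 - w ^+ n.*2) ^+ (4 ^ n).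
  have /andP[u0 u1] : 0 <= u <= 1 by apply/itv01X/itv01B/itv01X.
  (* Bernoulli's inequality bounds [v^(2n) = 4^n w^(2n)] by [(1 + w^(2n))^(4^n)], and
     [(1 - x) (1 + x) <= 1]. *)
  have un : u * v ^+ n.*2 <= 1.
    have -> : v ^+ n.*2 = (4 ^ n)%:R * w ^+ n.*2.
      by rewrite exprMn -[in 2 ^+ _]muln2 mulnC exprM natrX; congr (_ ^+ _ * _); rewrite -natrX.
    apply: (@le_trans _ _ (u * (1 + w ^+ n.*2) ^+ (4 ^ n))).
      apply: ler_wpM2l => //; apply: le_trans (bernoulli_ge _ _); last by lra.
      by rewrite lerDr.
    rewrite /u -exprMn; have : 0 <= (1 - w ^+ n.*2) * (1 + w ^+ n.*2) <= 1.
      have -> : (1 - w ^+ n.*2) * (1 + w ^+ n.*2) = 1 - (w ^+ n.*2) ^+ 2 by ring.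
      by apply/itv01B/itv01X/itv01X.
    by move=> /(@itv01X _ (4 ^ n))/andP[].
  have nv : n%:R * (v - 1) <= v ^+ n.
    have := @bernoulli_ge (v - 1) n; rewrite [1 + (v - 1)]addrC subrK => H.
    by apply: le_trans (H _); [rewrite lerDr|lra].
  have nu : n%:R * u <= (v - 1)^-1 * v^-1 ^+ n.
    rewrite exprVn -invfM -[leRHS]mul1r ler_pdivlMr ?mulr_gt0 ?exprn_gt0 ?subr_gt0//.
    apply: le_trans un; rewrite -addnn exprD.
    have -> : n%:R * u * ((v - 1) * v ^+ n) = u * ((n%:R * (v - 1)) * v ^+ n) by ring.
    by apply: ler_wpM2l => //; apply: ler_wpM2r => //; rewrite exprn_ge0// ltW.
  apply: (@le_trans _ _ (1 + n%:R * - u)); first by rewrite mulrN lerB.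
  by apply: bernoulli_ge; rewrite lerN2.
- rewrite -[X in _ --> X]subr0; apply: cvgB; first exact: cvg_cst.
  rewrite -[X in _ --> X](mulr0 (v - 1)^-1); apply: cvgMl_tmp.
  by apply: cvg_expr; rewrite gtr0_norm ?invr_gt0// invf_lt1.
- exact: cvg_cst.
Qed.

Lemma threshold_cvg0 w : 0 <= w <= 2^-1 -> threshold n w @[n --> \oo] --> (0 : R).
Proof.
move=> /andP[w0 w2].
have w01 : 0 <= w <= 1 by rewrite w0 (le_trans w2)// invf_le1// ler1n.
apply: (@squeeze_cvgr _ _ _ _ (fun _ => 0) (fun n => (3 / 4) ^+ n)).
- exists 1%N => // n /= n0; have /andP[-> _] := threshold01 n w01 => /=.
  have /andP[u0 u1] : 0 <= 1 - (1 - w ^+ n.*2) ^+ (4 ^ n) <= 1.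
    by apply/itv01B/itv01X/itv01B/itv01X.
  have q0 : 0 <= 3 / 4 :> R by rewrite divr_ge0.
  rewrite /threshold lerXn2r ?nnegrE//.
  suff : 2^-1 ^+ 2 <= (1 - w ^+ n.*2) ^+ (4 ^ n) by rewrite expr2; lra.
  case: n n0 {u0 u1} => // n _.
  (* Bernoulli's inequality with half the exponent gives [1 - 1/2], to be squared; with the full
     exponent it would only give 0. *)
  have -> : (4 ^ n.+1 = (2 * 4 ^ n) * 2)%N by rewrite expnS; lia.
  have p0 : 0 <= (1 - w ^+ n.+1.*2) ^+ (2 * 4 ^ n).
    by apply: exprn_ge0; have /andP[] := itv01B (itv01X n.+1.*2 w01).
  rewrite exprM lerXn2r ?nnegrE ?invr_ge0//.
  have : w ^+ n.+1.*2 <= 4^-1 ^+ n.+1.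
    rewrite -muln2 mulnC exprM lerXn2r ?nnegrE ?sqr_ge0 ?invr_ge0//.
    rewrite (_ : 4^-1 = 2^-1 ^+ 2); last by field.
    by rewrite lerXn2r ?nnegrE ?invr_ge0.
  move=> H; have /andP[x0 x1] := itv01X n.+1.*2 w01.
  apply: le_trans (@bernoulli_ge (- w ^+ n.+1.*2) (2 * 4 ^ n) _); last by rewrite lerN2.
  have : (2 * 4 ^ n)%:R * w ^+ n.+1.*2 <= 2^-1.
    apply: le_trans (ler_wpM2l _ H) _; first exact: ler0n.
    rewrite natrM natrX exprS exprVn; have : 4 ^+ n != 0 :> R by rewrite expf_neq0.
    by move=> ?; rewrite le_eqVlt; apply/orP; left; apply/eqP; field.
  rewrite mulrN; lra.
- exact: cvg_cst.
- by apply: cvg_expr; rewrite ger0_norm ?divr_ge0//; lra.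
Qed.

Lemma threshold_polynomials (rho : R) : exists r : nat -> {poly R},
  (forall n c, -1 <= c <= 1 -> 0 <= (r n).[c] <= 1) /\
  forall c, -1 <= c <= 1 -> (r n).[c] @[n --> \oo] --> ((rho < c)%R%:R : R).
Proof.
(* [W] is affine, sends [rho] to [1/2] and maps [[-1, 1]] into [[0, 1]]. *)
pose B := `|rho| + 1; have B0 : 0 < B by rewrite ltr_wpDl.
pose W : {poly R} := (2^-1 - rho / (2 * B))%:P + (2 * B)^-1 *: 'X.
pose r n : {poly R} := (1 - (1 - W ^+ n.*2) ^+ (4 ^ n)) ^+ n.
have WE c : W.[c] = 2^-1 + (c - rho) / (2 * B).
  by rewrite /W !hornerE; ring.
have rE n c : (r n).[c] = threshold n W.[c].
  by rewrite /r /threshold !(hornerE, horner_exp).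
have W01 c : -1 <= c <= 1 -> 0 <= W.[c] <= 1.
  move=> /andP[c1 c2]; have /ler_normlP[r1 r2] : `|rho| <= B - 1 by rewrite /B addrK.
  have q1 : - 2^-1 <= (c - rho) / (2 * B) by rewrite ler_pdivlMr ?mulr_gt0//; lra.
  have q2 : (c - rho) / (2 * B) <= 2^-1 by rewrite ler_pdivrMr ?mulr_gt0//; lra.
  by rewrite WE; apply/andP; split; lra.
exists r; split=> [n c c01|c c01]; first by rewrite rE; apply/threshold01/W01.
under eq_fun do rewrite rE.
have /andP[W0 W1] := W01 c c01.
have [rc|rc] := ltP rho c.
  apply: threshold_cvg1; rewrite W1 andbT WE ltrDl divr_gt0 ?mulr_gt0// subr_gt0//.
apply: threshold_cvg0; rewrite W0 WE /= gerDl.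
by rewrite mulr_le0_ge0 ?invr_ge0 ?subr_le0// mulr_ge0// ltW.
Qed.

End threshold_polynomials.

(** * Continuous cutoff functions on the line *)

Section bump.
Variable R : realType.

Definition bump (al be : R) (m : nat) (t : R) : R :=
  Num.max 0 (Num.min 1 (m%:R * Num.min (t - al) (be - t))).

Lemma bump01 al be m t : 0 <= bump al be m t <= 1.
Proof. by rewrite /bump le_max lexx/= ge_max ler01/= ge_min lexx. Qed.

Lemma continuous_bump al be m : continuous (bump al be m).
Proof.
move=> t; apply: (@continuous_max _ _ (fun=> 0) (fun t => Num.min 1 (m%:R * Num.min (t - al) (be - t)))).
  exact: cvg_cst.
apply: (@continuous_min _ _ (fun=> 1) (fun t => m%:R * Num.min (t - al) (be - t))).
  exact: cvg_cst.
apply: cvgMl_tmp; apply: (@continuous_min _ _ (fun t => t - al) (fun t => be - t)).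
  by apply: cvgB; [exact: cvg_id|exact: cvg_cst].
by apply: cvgB; [exact: cvg_cst|exact: cvg_id].
Qed.

Lemma bump_eq0 al be m t : ~~ (al < t < be) -> bump al be m t = 0.
Proof.
rewrite negb_and -!leNgt => H; apply/eqP; rewrite eq_le; have /andP[-> _] := bump01 al be m t.
rewrite andbT ge_max lexx ge_min; apply/orP; right; rewrite mulr_ge0_le0//.
by rewrite ge_min !subr_le0.
Qed.

Lemma compactly_supported_itv (h : R -> R) (al be : R) :
  (forall t, ~~ (al < t < be) -> h t = 0) -> compactly_supported h.
Proof.
move=> h0; apply: (subclosed_compact _ (@segment_compact R al be)).
  exact: closed_closure.
have cl : closed `[al, be]%classic by exact: interval_closed.
rewrite [X in _ `<=` X](proj1 (closure_id _) cl); apply: closureS => t /= ht.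
rewrite in_itv/=; apply: contraNT ht => H; apply/eqP/h0.
by apply: contra H => /andP[? ?]; rewrite !ltW.
Qed.

Lemma bump_cvg al be t : bump al be m t @[m --> \oo] --> ((al < t < be)%R%:R : R).
Proof.
have [H|H] := boolP (al < t < be); last first.
  by under eq_fun do rewrite bump_eq0//; exact: cvg_cst.
have p0 : 0 < Num.min (t - al) (be - t) by case/andP: H => ? ?; rewrite lt_min !subr_gt0; apply/andP.
apply: cvg_near_cst; near=> m.
rewrite /bump min_l ?max_r//.
rewrite -ler_pdivrMr//; near: m; exact: nbhs_infty_ger.
Unshelve. all: by end_near. Qed.

Lemma bump_eq1 al be m t : 1 <= m%:R * (t - al) -> 1 <= m%:R * (be - t) ->
  bump al be m t = 1.
Proof.
move=> h1 h2; rewrite /bump min_l ?max_r//.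
by rewrite minr_pMr// le_min h1.
Qed.

Lemma compactly_supported_bounded (h : R -> R) : continuous h ->
  compactly_supported h -> exists M, forall t, `|h t| <= M.
Proof.
move=> ch sh; rewrite /compactly_supported in sh; set K := closure _ in sh.
have [[t0 Kt0]|K0] := pselect (K !=set0).
  have [|c _ cmax] := compact_EVT_max (f := fun t => `|h t|) (ex_intro _ t0 Kt0) sh.
    by apply: continuous_subspaceT => t; apply: cvg_norm; exact: ch.
  exists `|h c| => t; have [->|ht] := eqVneq (h t) 0; first by rewrite normr0.
  by apply: cmax; apply/mem_set; exact: subset_closure.
exists 0 => t; have [->|ht] := eqVneq (h t) 0; first by rewrite normr0.
by exfalso; apply: K0; exists t; exact: subset_closure.
Qed.

(** [f] is frozen outside [[a, b]] and multiplied by a trapezoid that is 1 on [[a, b]]. This turns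
    exponentials into admissible test functions without changing them over the slab. *)
Lemma compact_support_extension (a b : R) (f : R -> R) : a < b -> continuous f ->
  exists h : R -> R, [/\ continuous h, compactly_supported h,
    forall t, a <= t <= b -> h t = f t &
    (forall t, a <= t <= b -> 0 <= f t) -> forall t, 0 <= h t].
Proof.
move=> ab cf; pose clamp t := Num.max a (Num.min b t).
have clampE t : a <= t <= b -> clamp t = t.
  by move=> /andP[ta tb]; rewrite /clamp min_r// max_r.
have clamp_in t : a <= clamp t <= b.
  by rewrite /clamp le_max lexx/= ge_max (ltW ab)/= ge_min lexx.
have cclamp : continuous clamp.
  move=> t; apply: (@continuous_max _ _ (fun=> a) (fun t => Num.min b t)).
    exact: cvg_cst.
  by apply: (@continuous_min _ _ (fun=> b) id); [exact: cvg_cst|exact: cvg_id].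
exists (fun t => f (clamp t) * bump (a - 1) (b + 1) 1 t); split.
- move=> t; apply: cvgM; last exact: continuous_bump.
  by apply: continuous_comp; [exact: cclamp|exact: cf].
- by apply: (@compactly_supported_itv _ (a - 1) (b + 1)) => t H; rewrite bump_eq0 ?mulr0.
- move=> t /[dup] tab /andP[ta tb]; rewrite clampE// bump_eq1 ?mulr1// mul1r; lra.
- by move=> f0 t; rewrite mulr_ge0 ?f0//; have /andP[] := bump01 (a - 1) (b + 1) 1 t.
Qed.

End bump.

(** * Trigonometric polynomials on the torus *)

Section trigonometric.
Variables (R : realType) (n : nat).
Local Open Scope quotient_scope.
Implicit Types (k : 'rV[int]_n) (z : torus R n) (y : 'rV[R]_n).

(** The inductive form lets a linear functional that vanishes on cosines and sines be handled by
    induction. *)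
Inductive trig_poly : (torus R n -> R) -> Prop :=
| trig_cos k : trig_poly (tcos k)
| trig_sin k : trig_poly (tsin k)
| trig_add f g : trig_poly f -> trig_poly g -> trig_poly (fun z => f z + g z)
| trig_scale c f : trig_poly f -> trig_poly (fun z => c * f z).

Lemma phaseD k l y : phase (k + l) y = phase k y + phase l y.
Proof.
by rewrite /phase -big_split; apply: eq_bigr => j _ /=; rewrite mxE intrD mulrDl.
Qed.

Lemma phaseN k y : phase (- k) y = - phase k y.
Proof.
by rewrite /phase -sumrN; apply: eq_bigr => j _ /=; rewrite mxE mulrNz mulNr.
Qed.

Lemma phase0 y : phase 0 y = 0.
Proof. by rewrite /phase big1// => j _; rewrite mxE mul0r. Qed.

Lemma phase_delta j y : phase (delta_mx 0 j) y = y 0 j.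
Proof.
rewrite /phase (bigD1 j)//= mxE !eqxx mul1r big1 ?addr0// => i /negbTE ij.
by rewrite mxE ij andbF mul0r.
Qed.

Lemma cos_mul_cos (x y : R) : cos x * cos y = 2^-1 * cos (x + y) + 2^-1 * cos (x - y).
Proof. by rewrite cosD cosB; field. Qed.

Lemma sin_mul_sin (x y : R) : sin x * sin y = - 2^-1 * cos (x + y) + 2^-1 * cos (x - y).
Proof. by rewrite cosD cosB; field. Qed.

Lemma sin_mul_cos (x y : R) : sin x * cos y = 2^-1 * sin (x + y) + 2^-1 * sin (x - y).
Proof. by rewrite sinD sinB; field. Qed.

Lemma trig_polyM f g : trig_poly f -> trig_poly g -> trig_poly (fun z => f z * g z).
Proof.
have comb c d k l : trig_poly (fun z => c * tcos k z + d * tcos l z).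
  by apply: trig_add; apply: trig_scale; exact: trig_cos.
have combs c d k l : trig_poly (fun z => c * tsin k z + d * tsin l z).
  by apply: trig_add; apply: trig_scale; exact: trig_sin.
move=> tf; elim: tf g => {f} [k|k|f1 f2 _ IH1 _ IH2|c f _ IH] g.
- elim=> {g} [l|l|g1 g2 _ IH1 _ IH2|c g _ IH].
  + rewrite (_ : (fun z => _) = fun z => 2^-1 * tcos (k + l) z + 2^-1 * tcos (k - l) z)//.
    by apply/funext => z; rewrite /tcos cos_mul_cos !phaseD phaseN.
  + rewrite (_ : (fun z => _) = fun z => 2^-1 * tsin (l + k) z + 2^-1 * tsin (l - k) z)//.
    by apply/funext => z; rewrite /tcos /tsin mulrC sin_mul_cos !phaseD phaseN.
  + rewrite (_ : (fun z => _) = fun z => tcos k z * g1 z + tcos k z * g2 z); first exact: trig_add.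
    by apply/funext => z; rewrite mulrDr.
  + rewrite (_ : (fun z => _) = fun z => c * (tcos k z * g z)); first exact: trig_scale.
    by apply/funext => z; rewrite mulrCA.
- elim=> {g} [l|l|g1 g2 _ IH1 _ IH2|c g _ IH].
  + rewrite (_ : (fun z => _) = fun z => 2^-1 * tsin (k + l) z + 2^-1 * tsin (k - l) z)//.
    by apply/funext => z; rewrite /tcos /tsin sin_mul_cos !phaseD phaseN.
  + rewrite (_ : (fun z => _) = fun z => - 2^-1 * tcos (k + l) z + 2^-1 * tcos (k - l) z)//.
    by apply/funext => z; rewrite /tcos /tsin sin_mul_sin !phaseD phaseN.
  + rewrite (_ : (fun z => _) = fun z => tsin k z * g1 z + tsin k z * g2 z); first exact: trig_add.
    by apply/funext => z; rewrite mulrDr.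
  + rewrite (_ : (fun z => _) = fun z => c * (tsin k z * g z)); first exact: trig_scale.
    by apply/funext => z; rewrite mulrCA.
- move=> tg; rewrite (_ : (fun z => _) = fun z => f1 z * g z + f2 z * g z).
    by apply: trig_add; [exact: IH1|exact: IH2].
  by apply/funext => z; rewrite mulrDl.
- move=> tg; rewrite (_ : (fun z => _) = fun z => c * (f z * g z)).
    by apply: trig_scale; exact: IH.
  by apply/funext => z; rewrite mulrA.
Qed.

Lemma trig_poly_cst (c : R) : trig_poly (fun _ => c).
Proof.
rewrite (_ : (fun _ => c) = fun z => c * tcos 0 z); first by apply/trig_scale/trig_cos.
by apply/funext => z; rewrite /tcos phase0 cos0 mulr1.
Qed.

Lemma trig_poly_horner (p : {poly R}) f : trig_poly f -> trig_poly (fun z => p.[f z]).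
Proof.
move=> tf; elim/poly_ind: p => [|p c IH].
  by under eq_fun do rewrite horner0; exact: trig_poly_cst.
under eq_fun do rewrite hornerMXaddC.
by apply: trig_add; [exact: trig_polyM|exact: trig_poly_cst].
Qed.

Lemma trig_poly_prod m (F : 'I_m -> torus R n -> R) :
  (forall i, trig_poly (F i)) -> trig_poly (fun z => \prod_i F i z).
Proof.
elim: m F => [|m IH] F tF.
  by under eq_fun do rewrite big_ord0; exact: trig_poly_cst.
under eq_fun do rewrite big_ord_recl.
by apply: trig_polyM => //; exact: IH.
Qed.

(** Its superlevel sets are arcs centred at [q], which makes arcs accessible to trigonometric
    polynomials. *)
Definition tcos_shift (j : 'I_n) (q : R) (z : torus R n) : R :=
  cos (torus_repr z 0 j - q).

Lemma trig_poly_shift j q : trig_poly (tcos_shift j q).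
Proof.
rewrite (_ : tcos_shift j q = fun z => cos q * tcos (delta_mx 0 j) z + sin q * tsin (delta_mx 0 j) z).
  by apply: trig_add; apply: trig_scale; [exact: trig_cos|exact: trig_sin].
by apply/funext => z; rewrite /tcos_shift /tcos /tsin phase_delta cosB; ring.
Qed.

Lemma continuous_phase k : continuous (phase k : 'rV[R]_n -> R).
Proof.
rewrite (_ : phase k = \sum_j (fun y : 'rV[R]_n => (k 0 j)%:~R * y 0 j)); last first.
  by apply/funext => y; rewrite fct_sumE.
apply: (big_ind (fun f : 'rV[R]_n -> R => continuous f)).
- by move=> x; apply: (@cst_continuous _ _ (0 : R)).
- by move=> f g cf cg x; exact: (@continuousD _ _ _ f g x (cf x) (cg x)).
- move=> j _ x; apply: continuousM; first exact: cst_continuous.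
  exact: (@coord_continuous R 1 n 0 j x).
Qed.

Lemma continuous_tcos k : continuous (fun x : cylinder R n => tcos k x.2).
Proof.
move=> [t z]; apply: (@descent_continuous _ _ _ (fun x => cos (phase k x.2)) t z).
  by move=> t'; exact: cos_phase_periodic.
apply: continuous_comp; last exact: continuous_cos.
by apply: continuous_comp; [exact: cvg_snd|exact: continuous_phase].
Qed.

Lemma continuous_tsin k : continuous (fun x : cylinder R n => tsin k x.2).
Proof.
move=> [t z]; apply: (@descent_continuous _ _ _ (fun x => sin (phase k x.2)) t z).
  by move=> t'; exact: sin_phase_periodic.
apply: continuous_comp; last exact: continuous_sin.
by apply: continuous_comp; [exact: cvg_snd|exact: continuous_phase].
Qed.

Lemma borel_continuous_measurable (T : ptopologicalType) (f : T -> R) :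
  continuous f -> measurable_fun [set: borel T] f.
Proof.
move=> /continuousP cf; apply: (measurability _ (RGenOpens.measurableE R)).
move=> _ [_ [a [b ->] <-]]; rewrite setTI; apply: sub_sigma_algebra.
by apply: cf; exact: interval_open.
Qed.

Lemma bounded_measurable_continuous (T : ptopologicalType) (f : T -> R) (M : R) :
  continuous f -> (forall x, `|f x| <= M) -> bounded_measurable (f : borel T -> R).
Proof. by move=> cf fM; split; [exact: borel_continuous_measurable|exists M]. Qed.

Lemma bounded_measurable_fst (h : R -> R) (M : R) : continuous h -> (forall t, `|h t| <= M) ->
  bounded_measurable (fun x : borel (cylinder R n) => h x.1).
Proof.
move=> ch hM; apply: (@bounded_measurable_continuous (cylinder R n) (fun x => h x.1) M) => //.
by move=> x; apply: continuous_comp; [exact: cvg_fst|exact: ch].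
Qed.

Lemma bounded_measurable_tcos k :
  bounded_measurable (fun x : borel (cylinder R n) => tcos k x.2).
Proof.
apply: (@bounded_measurable_continuous (cylinder R n) (fun x => tcos k x.2) 1).
  exact: continuous_tcos.
by move=> x; exact: cos_max.
Qed.

Lemma bounded_measurable_tsin k :
  bounded_measurable (fun x : borel (cylinder R n) => tsin k x.2).
Proof.
apply: (@bounded_measurable_continuous (cylinder R n) (fun x => tsin k x.2) 1).
  exact: continuous_tsin.
by move=> x; exact: sin_max.
Qed.

Lemma bounded_measurable_trig g : trig_poly g ->
  bounded_measurable (fun x : borel (cylinder R n) => g x.2).
Proof.
elim=> [k|k|f1 f2 _ b1 _ b2|c f _ bf].
- exact: bounded_measurable_tcos.
- exact: bounded_measurable_tsin.
- exact: bounded_measurableD.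
- exact: bounded_measurableZ.
Qed.

End trigonometric.

(** * A functional is determined by its values on characters *)

Section fourier_uniqueness.
Variables (R : realType) (n : nat).
Local Notation X := (cylinder R n).
Implicit Types (k : 'rV[int]_n) (z : torus R n) (y : 'rV[R]_n).

Lemma cos_gt_dist (w del : R) : 0 < del <= pi -> cos del < cos w ->
  exists q : int, `|w - 2 * pi * q%:~R| < del.
Proof.
move=> /andP[d0 dpi] H; have pi0 := pi_gt0 R; have p2 : 0 < 2 * pi :> R by rewrite mulr_gt0.
pose q := Num.floor ((w + pi) / (2 * pi)); exists q.
have /andP[q1 q2] : q%:~R <= (w + pi) / (2 * pi) < (q + 1)%:~R by exact: floor_itv.
move: q1 q2; rewrite ler_pdivlMr// ltr_pdivrMr// intrD => q1 q2.
set w' := w - _; have w'pi : `|w'| <= pi by rewrite ler_norml /w'; apply/andP; split; lra.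
move: H; have -> : cos w = cos `|w'|.
  by rewrite cos_norm -(cosDint2pi w' q) /w' subrK.
by rewrite ltr_cos ?in_itv/= ?normr_ge0 ?(ltW d0).
Qed.

Definition box (al be rho : R) (q : 'rV[R]_n) : set X :=
  [set x | al < x.1 < be /\ forall j, rho < tcos_shift j (q 0 j) x.2].

Lemma box_base (U : set X) (x : X) : open U -> U x ->
  exists (al be rho : rat) (q : 'rV[rat]_n),
    box (ratr al) (ratr be) (ratr rho) (map_mx ratr q) x /\
    box (ratr al) (ratr be) (ratr rho) (map_mx ratr q) `<=` U.
Proof.
move: x => [t z] oU Ux.
have : nbhs ((t, z) : X) U by exact: open_nbhs_nbhs.
move=> [[A B] /= [At Bz] ABU].
have [e1 /= e10 eA] := (iffLR (nbhs_ballP _ _)) At.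
pose u := torus_repr z.
have [e2 /= e20 eB] : exists2 e, 0 < e & ball u e `<=` @torus_proj R n @^-1` B.
  apply/nbhs_ballP; apply: (@torus_proj_continuous R n u); by rewrite torus_reprK.
(* The centre is taken within [del] of the point and [rho] between [cos (2 del)] and [cos del]; the
   box then contains the point and stays within [3 del = e] of it in the angles. The bound [e <= pi]
   keeps the angles where cosine decreases. *)
pose e := Num.min e2 pi; pose del := e / 3.
have e0 : 0 < e by rewrite lt_min e20 pi_gt0.
have epi : e <= pi by rewrite ge_min lexx orbT.
have ee2 : e <= e2 by rewrite ge_min lexx.
have d0 : 0 < del by rewrite divr_gt0.
have dE : e = del * 3 by rewrite /del divfK.
have pi0 := pi_gt0 R.
have [al /andP[al1 al2]] : exists al : rat, t - e1 < ratr al < t.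
  by have [al] := @rat_in_itvoo R (t - e1) t (ltac:(by rewrite ltrBlDr ltrDl)); rewrite in_itv/=; exists al.
have [be /andP[be1 be2]] : exists al : rat, t < ratr al < t + e1.
  by have [be] := @rat_in_itvoo R t (t + e1) (ltac:(by rewrite ltrDl)); rewrite in_itv/=; exists be.
have [rho /andP[rho1 rho2]] : exists al : rat, cos (2 * del) < ratr al < cos del.
  have H : cos (2 * del) < cos del by rewrite ltr_cos ?in_itv/=; lra.
  by have [r] := @rat_in_itvoo R _ _ H; rewrite in_itv/=; exists r.
have H j : exists q : rat, `|u 0 j - ratr q| < del.
  have H : u 0 j - del < u 0 j by rewrite ltrBlDr ltrDl.
  have [r] := @rat_in_itvoo R _ _ H; rewrite in_itv/= => /andP[r1 r2]; exists r.
  by rewrite gtr0_norm; lra.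
have [f fP] := choice H.
exists al, be, rho, (\row_j f j); split.
  split; first by rewrite /= al2 be1.
  move=> j; apply: lt_trans rho2 _; rewrite /tcos_shift !mxE -[X in _ < X]cos_norm.
  have := fP j; rewrite /u mxE => fj.
  by rewrite ltr_cos ?in_itv/= ?normr_ge0//=; lra.
move=> [t' z'] /= [/andP[/= t'1 t'2] z'P]; apply: (ABU (t', z')); split => /=.
  by apply: eA; rewrite /ball/= ltr_norml; apply/andP; split; lra.
have H' j : exists m : int, `|torus_repr z' 0 j - ratr (f j) - 2 * pi * m%:~R| < 2 * del.
  apply: cos_gt_dist; first by apply/andP; split; lra.
  apply: lt_trans rho1 _; have := z'P j; by rewrite /tcos_shift !mxE.
have [m mP] := choice H'.
pose y' := torus_repr z' + lattice_shift R (- \row_j m j).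
have -> : z' = torus_proj y'.
  by rewrite -[LHS]torus_reprK; apply/esym/torus_projP; eexists.
apply: eB; split=> // i j; rewrite (ord1 i) /ball /= !mxE.
have := fP j; have := mP j; rewrite !mxE mulrNz !ltr_norml => /andP[m1 m2] /andP[f1 f2].
by apply/andP; split; lra.
Qed.

Lemma cvg_prod_ord m (F : 'I_m -> nat -> R) (l : 'I_m -> R) :
  (forall i, F i e @[e --> \oo] --> l i) ->
  \prod_i F i e @[e --> \oo] --> \prod_i l i.
Proof.
elim: m F l => [|m IH] F l Fl.
  by under eq_fun do rewrite big_ord0; rewrite big_ord0; exact: cvg_cst.
under eq_fun do rewrite big_ord_recl; rewrite big_ord_recl.
by apply: cvgM => //; exact: IH.
Qed.

(** The factors [h] and [g] are kept apart because functionals are known on products only; the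
    bounds 0 and 1 survive multiplication and allow bounded convergence. *)
Definition approximable (B : set (borel X)) : Prop := measurable B /\
  exists (h : nat -> R -> R) (g : nat -> torus R n -> R),
  [/\ forall m, continuous (h m) /\ compactly_supported (h m),
      forall m, trig_poly (g m),
      forall m t, 0 <= h m t <= 1, forall m z, 0 <= g m z <= 1 &
      forall x, h m x.1 * g m x.2 @[m --> \oo] --> (\1_B x : R)].

Lemma approximableI : setI_closed approximable.
Proof.
move=> A B [mA [h [g [hA gA h01 g01 cA]]]] [mB [h' [g' [hB gB h'01 g'01 cB]]]].
have b01 (x y : R) : 0 <= x <= 1 -> 0 <= y <= 1 -> 0 <= x * y <= 1.
  by move=> /andP[x0 x1] /andP[y0 y1]; rewrite mulr_ge0// mulr_ile1.
split; first exact: measurableI.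
exists (fun m t => h m t * h' m t), (fun m z => g m z * g' m z); split.
- move=> m; have [ch sh] := hA m; have [ch' sh'] := hB m; split.
    by move=> t; apply: cvgM; [exact: ch|exact: ch'].
  apply: (subclosed_compact _ sh); first exact: closed_closure.
  by apply: closureS => t /=; apply: contra => /eqP ->; rewrite mul0r.
- by move=> m; exact: trig_polyM.
- by move=> m t; exact: b01.
- by move=> m z; exact: b01.
- move=> x; rewrite indicI.
  rewrite (_ : (fun m => _) = (fun m => h m x.1 * g m x.2) \* (fun m => h' m x.1 * g' m x.2)).
    by apply: cvgM; [exact: cA|exact: cB].
  by apply/funext => m /=; ring.
Qed.

Lemma measurable_tcos_shift j (q rho : R) :
  measurable [set x : borel X | rho < tcos_shift j q x.2].
Proof.
have [mf _] := bounded_measurable_trig (trig_poly_shift j q).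
rewrite (_ : [set x | _] = (fun x : borel X => tcos_shift j q x.2) @^-1` `]rho, +oo[).
  by rewrite -[X in measurable X]setTI; apply: mf.
by apply/seteqP; split=> x /=; rewrite in_itv/= andbT.
Qed.

Lemma measurable_fst_cylinder : measurable_fun setT (fun x : borel X => x.1 : R).
Proof.
by apply: (@borel_continuous_measurable R (cylinder R n)) => x; exact: cvg_fst.
Qed.

Lemma measurable_box al be rho q : measurable (box al be rho q : set (borel X)).
Proof.
rewrite (_ : box al be rho q = ((fun x : borel X => x.1 : R) @^-1` `]al, be[) `&`
    \bigcap_(j in [set: 'I_n]) [set x : borel X | rho < tcos_shift j (q 0 j) x.2]); last first.
  apply/seteqP; split=> x /=; rewrite in_itv/= => -[H1 H2]; split=> //.
    by move=> j _; exact: H2.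
  by move=> j; exact: H2.
apply: measurableI; first by rewrite -[X in measurable X]setTI; apply: measurable_fst_cylinder.
by apply: fin_bigcap_measurable => // j _; exact: measurable_tcos_shift.
Qed.

Lemma approximable_box al be rho q : approximable (box al be rho q).
Proof.
split; first exact: measurable_box.
have [r [r01 rc]] := threshold_polynomials rho.
have c01 j z : -1 <= tcos_shift j (q 0 j) z <= 1 by rewrite cos_geN1 cos_le1.
exists (bump al be), (fun m z => \prod_j (r m).[tcos_shift j (q 0 j) z]); split.
- move=> m; split; first exact: continuous_bump.
  by apply: (@compactly_supported_itv _ _ al be) => t; exact: bump_eq0.
- by move=> m; apply: trig_poly_prod => j; apply: trig_poly_horner; exact: trig_poly_shift.
- by move=> m t; exact: bump01.
- move=> m z; have H j : 0 <= (r m).[tcos_shift j (q 0 j) z] <= 1 by exact: r01.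
  rewrite prodr_ge0/= => [|j _]; last by have /andP[] := H j.
  by apply: prodr_ile1 => j _; exact: H.
- move=> x; rewrite (_ : \1_(box al be rho q) x = (al < x.1 < be)%R%:R *
     \prod_j (rho < tcos_shift j (q 0 j) x.2)%R%:R); last first.
    rewrite indicE -natr_prod -natrM; congr (_%:R).
    rewrite (_ : \prod_(i < n) _ = [forall j, (rho < tcos_shift j (q 0 j) x.2)%R])%N.
      rewrite mulnb; congr (nat_of_bool _); apply/idP/andP => [/set_mem[H1 H2]|[H1 /forallP H2]].
        by split=> //; apply/forallP.
      by apply/mem_set; split.
    case: (boolP [forall j, (rho < tcos_shift j (q 0 j) x.2)%R]) => [/forallP H|].
      by rewrite big1// => i _; rewrite H.
    by rewrite negb_forall => /existsP[j nj]; rewrite (bigD1 j)//= (negbTE nj).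
  apply: cvgM; first exact: bump_cvg.
  by apply: cvg_prod_ord => j; exact: rc.
Qed.

Lemma open_cylinder_generated (G : set (set X)) :
  (forall al be rho q, G (box al be rho q)) -> forall U, open U -> <<s G >> U.
Proof.
move=> GB U oU.
pose B (p : rat * rat * rat * 'rV[rat]_n) : set X :=
  box (ratr p.1.1.1) (ratr p.1.1.2) (ratr p.1.2) (map_mx ratr p.2).
pose C (e : nat) : set X :=
  if unpickle e is Some p then (if pselect (B p `<=` U) then B p else set0) else set0.
have -> : U = \bigcup_e C e.
  apply/seteqP; split=> [x Ux|x [e _]]; last first.
    by rewrite /C; case: unpickle => [p|//]; case: pselect => // BU; exact: BU.
  have [al [be [rho [q [xB BU]]]]] := box_base oU Ux.
  apply: (ex_intro2 _ _ (pickle (al, be, rho, q)) Logic.I).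
  rewrite /C pickleK; case: pselect => [BU'|nBU]; first exact: xB.
  by exfalso; exact: nBU.
apply: sigma_algebra_bigcup => e; rewrite /C.
case: unpickle => [p|]; last exact: sigma_algebra0.
case: pselect => [BU|nBU]; last exact: sigma_algebra0.
by apply: sub_sigma_algebra; exact: GB.
Qed.

Lemma measurable_cylinder_generated :
  measurable = <<s approximable >> :> set (set (borel X)).
Proof.
apply/seteqP; split; last first.
  by apply: smallest_sub; [exact: sigma_algebra_measurable|move=> A []].
apply: smallest_sub; first exact: smallest_sigma_algebra.
by apply: open_cylinder_generated => *; exact: approximable_box.
Qed.

Lemma measurable_fun_cylinder d (T : measurableType d) (g : T -> borel X) :
  (forall al be rho q, measurable (g @^-1` box al be rho q)) -> measurable_fun setT g.
Proof.
move=> mg; pose G : set (set X) := [set B | exists al be rho q, B = box al be rho q].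
apply: (@measurability _ _ _ _ _ g G).
  apply/seteqP; split.
    apply: smallest_sub; first exact: smallest_sigma_algebra.
    by move=> U oU; apply: open_cylinder_generated => // al be rho q; exists al, be, rho, q.
  apply: smallest_sub; first exact: sigma_algebra_measurable.
  by move=> _ [al [be [rho [q ->]]]]; exact: measurable_box.
by move=> _ [_ [al [be [rho [q ->]]]] <-]; rewrite setTI; exact: mg.
Qed.

Lemma bfun_lim0 d (T : measurableType d) (I : (T -> R) -> R) F f M :
  bounded_functional I -> (forall m : nat, I (F m) = 0) ->
  (forall m, bounded_measurable (F m)) -> (forall m x, `|F m x| <= M) ->
  bounded_measurable f -> (forall x, F m x @[m --> \oo] --> f x) -> I f = 0.
Proof.
move=> bI I0 bF FM bf Ff; have := bfun_cvg bI bF FM bf Ff.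
rewrite (_ : (fun m => _) = fun=> 0); last exact/funext.
by move=> /(cvg_lim (@Rhausdorff R)) <-; apply: (cvg_lim (@Rhausdorff R)); exact: cvg_cst.
Qed.

(* The sets whose indicator is a bounded pointwise limit of products [h * g], with
   [g] a trigonometric polynomial, form a pi-system generating the Borel sets. *)
Lemma fourier_unique (I : (borel X -> R) -> R) : bounded_functional I ->
  (forall k h, continuous h -> compactly_supported h ->
    I (fun x => h x.1 * tcos k x.2) = 0 /\ I (fun x => h x.1 * tsin k x.2) = 0) ->
  forall f, bounded_measurable f -> I f = 0.
Proof.
move=> bI I0.
have bh h : continuous h -> compactly_supported h ->
    bounded_measurable (fun x : borel X => h x.1).
  move=> ch sh; have [M hM] := compactly_supported_bounded ch sh.
  exact: bounded_measurable_fst hM.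
have Itrig h g : continuous h -> compactly_supported h -> trig_poly g ->
    I (fun x => h x.1 * g x.2) = 0.
  move=> ch sh tg; elim: tg => {g} [k|k|f g tf f0 tg g0|c f tf f0].
  - by have [] := I0 k h ch sh.
  - by have [] := I0 k h ch sh.
  - rewrite (_ : (fun x => _) = fun x => h x.1 * f x.2 + h x.1 * g x.2).
      rewrite (bfunD bI) ?f0 ?g0 ?addr0//; apply: bounded_measurableM;
        by [exact: bh|exact: bounded_measurable_trig].
    by apply/funext => x; rewrite mulrDr.
  - rewrite (_ : (fun x => _) = fun x => c * (h x.1 * f x.2)).
      rewrite (bfunZ bI) ?f0 ?mulr0//; apply: bounded_measurableM;
        by [exact: bh|exact: bounded_measurable_trig].
    by apply/funext => x; rewrite mulrCA.
have Iapprox A : approximable A -> I \1_A = 0.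
  move=> [mA [h [g [hA gA h01 g01 cA]]]].
  apply: (bfun_lim0 (F := fun m (x : borel X) => h m x.1 * g m x.2) (M := 1) bI) => //.
  - by move=> m; apply: Itrig => //; case: (hA m).
  - move=> m; apply: bounded_measurableM; last exact: bounded_measurable_trig.
    by case: (hA m) => ? ?; exact: bh.
  - move=> m x; have /andP[? ?] := h01 m x.1; have /andP[? ?] := g01 m x.2.
    by rewrite ger0_norm ?mulr_ge0// mulr_ile1.
  - exact: bounded_measurable_indic.
have IA A : measurable A -> I \1_A = 0.
  rewrite measurable_cylinder_generated => sA.
  have : [set A : set (borel X) | measurable A /\ I \1_A = 0] A.
    move: A sA; apply: (@lambda_system_subset _ _ approximableI setT) => //.
    - split.
      + by [].
      + split; first exact: measurableT.
        (* The whole cylinder is reached with frequency 0 and cutoffs that exhaust the line. *)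
        apply: (bfun_lim0 (F := fun m (x : borel X) => bump (- m%:R) m%:R m x.1) (M := 1) bI).
        * move=> m; have := I0 0 (bump (- m%:R) m%:R m) (@continuous_bump _ _ _ _).
          case=> [|+ _].
            by apply: (@compactly_supported_itv _ _ (- m%:R) m%:R) => t; exact: bump_eq0.
          by move=> <-; congr I; apply/funext => x; rewrite /tcos phase0 cos0 mulr1.
        * move=> m; apply: (@bounded_measurable_fst _ _ (bump (- m%:R) m%:R m) 1).
            exact: continuous_bump.
          by move=> t; have /andP[? ?] := bump01 (- m%:R) m%:R m t; rewrite ger0_norm.
        * by move=> m x; have /andP[? ?] := bump01 (- m%:R) m%:R m x.1; rewrite ger0_norm.
        * exact: bounded_measurable_indic.
        * move=> x; rewrite indicT; apply: cvg_near_cst; near=> m.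
          have m1 : `|x.1| + 1 <= m%:R by near: m; exact: nbhs_infty_ger.
          have mx : 1 <= (m%:R : R) by apply: le_trans m1; rewrite lerDr.
          move: (ler_norm x.1) (ler_norm (- x.1)); rewrite normrN => ? ?.
          by apply: bump_eq1; rewrite (le_trans mx)// ler_peMr ?(le_trans ler01 mx)//; lra.
      + move=> A B BA [mA IA0] [mB IB0]; split; first exact: measurableD.
        rewrite (_ : \1_(A `\` B) = fun x => \1_A x - \1_B x).
          rewrite (bfunB bI) ?IA0 ?IB0 ?subr0//; exact: bounded_measurable_indic.
        apply/funext => x; rewrite !indicE in_setD.
        case: (boolP (x \in B)) => xB; last by rewrite subr0 andbT.
        by rewrite (mem_set (BA _ (set_mem xB))) andbF subrr.
      + move=> F ndF HF; have mF : measurable (\bigcup_i F i).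
          by apply: bigcupT_measurable => i; case: (HF i).
        split=> //; apply: (bfun_lim0 (F := fun m => \1_(F m)) (M := 1) bI).
        * by move=> m; case: (HF m).
        * by move=> m; apply: bounded_measurable_indic; case: (HF m).
        * by move=> m x; rewrite indicE ger0_norm// lern1; case: (_ \in _).
        * exact: bounded_measurable_indic.
        * move=> x; have [[i _ Fix]|nx] := pselect ((\bigcup_i F i) x); last first.
            rewrite (_ : (fun m => _) = fun=> \1_(\bigcup_i F i) x); first exact: cvg_cst.
            by apply/funext => m; rewrite !indicE !memNset// => Fmx; apply: nx; exists m.
          apply: cvg_near_cst; exists i => // m /= im.
          rewrite !indicE !mem_set//; first by exists i.
          by have /subsetPset := ndF _ _ im; apply.
    - by move=> A aA; split; [case: aA|exact: Iapprox].
  by case.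
move=> f bf; rewrite (@bfun_ext _ _ _ I (fun=> 0))//.
by split=> *; rewrite ?addr0 ?mulr0//; exact: cvg_cst.
Unshelve. all: by end_near. Qed.

End fourier_uniqueness.

(** * Positivity on the line *)

Section positivity.
Variable R : realType.

(** Approximation by cutoffs gives positivity on half-open intervals, hence a nondecreasing
    right-continuous distribution function. Its Lebesgue-Stieltjes measure represents [l], and
    integrals against it are positive. *)
Lemma positive_bounded_functional (l : (R -> R) -> R) :
  bounded_functional (T := R) l ->
  (forall h, continuous h -> compactly_supported h -> (forall t, 0 <= h t) -> 0 <= l h) ->
  forall f : R -> R, bounded_measurable f -> (forall t, 0 <= f t) -> 0 <= l f.
Proof.
move=> bl lpos.
have mitv (i : interval R) : bounded_measurable (\1_[set` i] : R -> R).
  by apply: bounded_measurable_indic; exact: measurable_itv.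
have loc x y : 0 <= l \1_`]x, y].
  (* The right flank has slope [m.+1] and width [m.+1%:R^-1]: it begins to descend only at [y], so
     the limit includes the end point [y]. *)
  pose h m := bump x (y + m.+1%:R^-1) m.+1.
  have h01 m t : 0 <= h m t <= 1 by exact: bump01.
  have hc : l (h m) @[m --> \oo] --> l \1_`]x, y].
    apply: (bfun_cvg bl (M := 1)) => //.
    - move=> m; split; first by apply: continuous_measurable_fun; exact: continuous_bump.
      by exists 1 => t; have /andP[? ?] := h01 m t; rewrite ger0_norm.
    - by move=> m t; have /andP[? ?] := h01 m t; rewrite ger0_norm.
    - move=> t; rewrite indicE; have [H|H] := boolP (x < t <= y).
        rewrite mem_set; last by rewrite /= in_itv.
        case/andP: H => xt ty; apply: cvg_near_cst; near=> m.
        apply: bump_eq1.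
          rewrite -ler_pdivrMr ?subr_gt0// mul1r.
          have : (t - x)^-1 <= m%:R by near: m; exact: nbhs_infty_ger.
          by move=> /le_trans; apply; rewrite ler_nat.
        rewrite addrAC mulrDr mulfV ?pnatr_eq0// lerDr.
        by rewrite mulr_ge0// subr_ge0.
      rewrite memNset; last by rewrite /= in_itv; exact/negP.
      rewrite negb_and -!leNgt -ltNge in H.
      case/orP: H => [tx|yt].
        rewrite (_ : (fun m => _) = fun=> 0); first exact: cvg_cst.
        apply/funext => m; rewrite /h bump_eq0// negb_and -!leNgt tx//.
      apply: cvg_near_cst; near=> m; rewrite /h bump_eq0// negb_and -!leNgt.
      apply/orP; right; rewrite -lerBrDl.
      have : (t - y)^-1 <= m%:R by near: m; exact: nbhs_infty_ger.
      move=> H; rewrite -[leRHS]invrK lef_pV2 ?posrE ?invr_gt0 ?subr_gt0//.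
      by apply: le_trans H _; rewrite ler_nat.
  apply: (cvgr_to_ge hc); apply: nearW => m; apply: lpos.
  - exact: continuous_bump.
  - by apply: (@compactly_supported_itv _ _ x (y + m.+1%:R^-1)) => t; exact: bump_eq0.
  - by move=> t; have /andP[] := h01 m t.
pose F x := l \1_`]-oo, x].
have FB x y : x <= y -> F y - F x = l \1_`]x, y].
  move=> xy; rewrite /F -(bfunB bl)//; congr l; apply/funext => t.
  rewrite !indicE !mem_setE !in_itv/=.
  have [tx|xt] := leP t x; first by rewrite (le_trans tx xy) subrr.
  by rewrite subr0.
have ndF : nondecreasing F by move=> x y xy; rewrite -subr_ge0 FB.
have rcF : right_continuous F.
  move=> x; apply/cvg_at_rightP => u [xu ux].
  apply: (bfun_cvg bl (M := 1)) => //.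
  - by move=> m t; rewrite indicE ger0_norm// lern1; case: (_ \in _).
  - move=> t; rewrite !indicE !mem_setE !in_itv/=; have [tx|xt] := leP t x.
      rewrite (_ : (fun m => _) = fun=> 1); first exact: cvg_cst.
      by apply/funext => m; rewrite indicE mem_setE in_itv/= (le_trans tx)// ltW.
    apply: cvg_near_cst; move/cvgrPdist_lt: ux => /(_ (t - x)).
    rewrite subr_gt0 => /(_ xt); apply: filterS => m H.
    rewrite indicE mem_setE in_itv/= leNgt (_ : u m < t)//.
    by move: H; rewrite distrC ltr_norml; lra.
pose FC : cumulative R R := HB.pack_for (cumulative R R) F (isCumulative.Build R _ R F ndF rcF).
pose tau' : {measure set (measurableTypeR R) -> \bar R} := lebesgue_stieltjes_measure FC.
(* The same measure, with [R] in place of [measurableTypeR R] as the underlying measurable space. *)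
pose tau : {measure set R -> \bar R} := HB.pack_for (Measure.type R R) (tau' : set R -> \bar R)
  (isMeasure.Build _ R R (tau' : set R -> \bar R) (measure0 tau') (measure_ge0 tau')
     (@measure_semi_sigma_additive _ _ _ tau')).
have tauE x y : x <= y -> tau `]x, y]%classic = (l \1_`]x, y])%:E.
  move=> xy; transitivity (wlength FC `]x, y]%classic).
    exact: (measurable_mu_extE (wlength FC) (is_ocitv x y)).
  by rewrite wlength_itv_bnd//= -(FB _ _ xy) EFinB.
have b1 : bounded_measurable (fun _ : R => 1 : R) by exact: bounded_measurable_cst.
have indic_sub (A B : set R) : measurable A -> measurable B -> B `<=` A ->
    l \1_(A `\` B) = l \1_A - l \1_B.
  move=> mA mB BA; rewrite -(bfunB bl); [|exact: bounded_measurable_indic..].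
  congr l; apply/funext => x; rewrite !indicE in_setD.
  case: (boolP (x \in B)) => xB; last by rewrite subr0 andbT.
  by rewrite (mem_set (BA _ (set_mem xB))) andbF subrr.
have lnd (A : nat -> set R) : nondecreasing_seq A -> (forall i, measurable (A i)) ->
    l \1_(A m) @[m --> \oo] --> l \1_(\bigcup_i A i).
  move=> ndA mA; have mU : measurable (\bigcup_i A i) by exact: bigcupT_measurable.
  apply: (bfun_cvg bl (M := 1)).
  - by move=> m; exact: bounded_measurable_indic.
  - by move=> m x; rewrite indicE ger0_norm// lern1; case: (_ \in _).
  - exact: bounded_measurable_indic.
  - move=> x; have [[i _ Fix]|nx] := pselect ((\bigcup_i A i) x); last first.
      rewrite (_ : (fun m => _) = fun=> \1_(\bigcup_i A i) x); first exact: cvg_cst.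
      by apply/funext => m; rewrite !indicE !memNset// => Fmx; apply: nx; exists m.
    apply: cvg_near_cst; exists i => // m /= im.
    rewrite !indicE !mem_set//; first by exists i.
    by have /subsetPset := ndA _ _ im; apply.
pose J (m : nat) : set R := `]- m%:R, m%:R]%classic.
have ndJ : nondecreasing_seq J.
  move=> m m' mm'; apply/subsetPset => x; rewrite /J/= !in_itv/= => /andP[x1 x2].
  have mm : m%:R <= m'%:R :> R by rewrite ler_nat.
  by rewrite (le_trans x2 mm) andbT (le_lt_trans _ x1)// lerN2.
have UJ : \bigcup_m J m = setT.
  apply/seteqP; split=> // x _; have [m mx] : exists m : nat, `|x| < m%:R.
    by exists (Num.Def.archi_bound `|x|); apply: archi_boundP.
  exists m => //; rewrite /J/= in_itv/=; move: mx; rewrite ltr_norml => /andP[-> /ltW->//].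
have mJ m : measurable (J m) by exact: measurable_itv.
have tauT : tau setT = (l \1_setT)%:E.
  have := nondecreasing_cvg_mu (mu := tau) mJ _ ndJ; rewrite UJ => /(_ measurableT).
  rewrite (_ : tau \o J = fun m => (l \1_(J m))%:E); last first.
    by apply/funext => m /=; rewrite tauE// (@le_trans _ _ 0)// oppr_le0.
  move=> /(cvg_lim (@ereal_hausdorff R)) H; apply: etrans (esym H) _; apply: (cvg_lim (@ereal_hausdorff R)).
  by apply: cvg_EFin; [exact: nearW|rewrite -UJ; exact: lnd].
have tauA A : measurable A -> tau A = (l \1_A)%:E.
  move=> mA; have sA : <<s (@ocitv R) >> A by exact: mA.
  have : [set A : set R | measurable A /\ tau A = (l \1_A)%:E] A.
    move: A sA {mA}; apply: (@lambda_system_subset _ _ (@ocitvI R) setT) => //.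
    - split=> //.
      + move=> A B BA [mA tA] [mB tB]; split; first exact: measurableD.
        have tAoo : (tau A < +oo)%E by rewrite tA ltry.
        transitivity (tau A - tau B)%E; last by rewrite tA tB indic_sub// EFinB.
        by rewrite -[in RHS](setIidr BA); exact: (measureD mA mB tAoo).
      + move=> A ndA HA; have mA i : measurable (A i) by case: (HA i).
        have mU : measurable (\bigcup_i A i) by exact: bigcupT_measurable.
        split=> //; have := nondecreasing_cvg_mu (mu := tau) mA mU ndA.
        rewrite (_ : tau \o A = fun m => (l \1_(A m))%:E); last first.
          by apply/funext => m /=; case: (HA m).
        move=> /(cvg_lim (@ereal_hausdorff R)) H; apply: etrans (esym H) _; apply: (cvg_lim (@ereal_hausdorff R)).
        by apply: cvg_EFin; [exact: nearW|exact: lnd].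
    - move=> _ [[x y] _ <-]; split; first exact: measurable_itv.
      have [xy|yx] := leP x y; first exact: tauE.
      rewrite set_itv_ge ?bnd_simp -?leNgt ?(ltW yx)// measure0.
      by rewrite (_ : \1_set0 = fun _ => 0) ?bfun0//; apply/funext => t; rewrite indicE in_set0.
  by case.
move=> f bf f0.
have tauoo : (tau setT < +oo)%E by rewrite tauT ltry.
rewrite (@bfun_ext _ _ _ l (Rintegral tau setT) bl (bfun_Rintegral tauoo) _ f bf).
  by apply: Rintegral_ge0.
by move=> A mA; rewrite Rintegral_indicT// tauA.
Unshelve. all: by end_near. Qed.

End positivity.

(** * Fourier synthesis *)

Section product_integrals.
Context d1 d2 (T1 : measurableType d1) (T2 : measurableType d2) (R : realType).
Variables (P1 : probability T1 R) (P2 : probability T2 R).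
Variable f : T1 * T2 -> R.
Hypothesis bf : bounded_measurable f.

Lemma probability_lty d (T : measurableType d) (P : probability T R) : (P setT < +oo)%E.
Proof. by rewrite probability_setT ltry. Qed.

Lemma Rintegral_probability_cst d (T : measurableType d) (P : probability T R) (c : R) :
  Rintegral P setT (fun _ => c) = c.
Proof.
transitivity (c * fine (P setT)); first exact: Rintegral_cst.
by rewrite probability_setT mulr1.
Qed.

Lemma le_normr_Rintegral_bound d (T : measurableType d) (P : probability T R) (g : T -> R) M :
  bounded_measurable g -> (forall x, `|g x| <= M) -> `|Rintegral P setT g| <= M.
Proof.
move=> bg gM; have ig := bounded_measurable_integrable (probability_lty P) bg.
apply: le_trans (le_normr_Rintegral _ _) _ => //.
have iM := bounded_measurable_integrable (probability_lty P) (bounded_measurable_cst _ M).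
have ing : P.-integrable setT (EFin \o (fun x => `|g x|)).
  apply: bounded_measurable_integrable; first exact: probability_lty.
  case: bg => mg _; split; first exact: measurableT_comp.
  by exists M => x; rewrite normr_id.
apply: le_trans (le_Rintegral measurableT ing iM (fun x _ => gM x)) _.
by rewrite Rintegral_probability_cst.
Qed.

Lemma bounded_measurable_slice x : bounded_measurable (fun y => f (x, y)).
Proof.
case: bf => mf [M fM]; split; last by exists M => y.
exact: measurableT_comp.
Qed.

Lemma slice_integralE x :
  ((Rintegral P2 setT (fun y => f (x, y)))%:E = fubini_F P2 (EFin \o f) x)%E.
Proof.
rewrite /fubini_F /Rintegral fineK//; apply: integrable_fin_num => //.
exact: (bounded_measurable_integrable (probability_lty P2) (bounded_measurable_slice x)).
Qed.

Lemma bounded_measurable_slice_integral :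
  bounded_measurable (fun x => Rintegral P2 setT (fun y => f (x, y))).
Proof.
have [mf [M fM]] := bf.
have If := bounded_measurable_integrable (probability_lty (P1 \x P2)%E) bf.
split; last first.
  by exists M => x; apply: le_normr_Rintegral_bound => //; exact: bounded_measurable_slice.
apply/measurable_EFinP; rewrite (_ : _ \o _ = fubini_F P2 (EFin \o f)).
  exact: measurable_fubini_F If.
by apply/funext => x /=; rewrite slice_integralE.
Qed.

Lemma Rintegral_prod : Rintegral (P1 \x P2)%E setT f =
  Rintegral P1 setT (fun x => Rintegral P2 setT (fun y => f (x, y))).
Proof.
have If := bounded_measurable_integrable (probability_lty (P1 \x P2)%E) bf.
rewrite /Rintegral -(integral12_prod_meas1 If); congr fine.
by apply: eq_integral => x _; rewrite -slice_integralE.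
Qed.

End product_integrals.

(** * A uniform random point of the torus *)

Section sample_space.
Variable R : realType.
Local Notation mu := (@lebesgue_measure R).

Lemma twopi_gt0 : 0 < 2 * pi :> R. Proof. by rewrite mulr_gt0// pi_gt0. Qed.

Lemma uniform_integral (f F : R -> R) (M : R) :
  (forall x : R, is_derive x 1 F (f x)) -> continuous f -> (forall x, 0 <= f x <= M) ->
  Rintegral (uniform_prob twopi_gt0) setT f = (2 * pi)^-1 * (F (2 * pi) - F 0).
Proof.
move=> dF cf f0.
have mf : measurable_fun setT (EFin \o f).
  by apply/measurable_EFinP; exact: continuous_measurable_fun.
rewrite /Rintegral integral_uniform//=; last by move=> x; rewrite lee_fin; case/andP: (f0 x).
rewrite (@continuous_FTC2 _ f F)//.
- by rewrite subr0.
- exact: twopi_gt0.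
- by apply: continuous_subspaceT => x; exact: cf.
- have cF x : F @ x --> F x.
    by apply: differentiable_continuous; apply/derivable1_diffP; case: (dF x).
  split; first by move=> x _; case: (dF x).
    exact/cvg_at_right_filter/cF.
  exact/cvg_at_left_filter/cF.
- by move=> x _; rewrite derive1E; case: (dF x).
Qed.

Lemma uniform_bfun : bounded_functional (Rintegral (uniform_prob twopi_gt0) setT).
Proof. by apply: bfun_Rintegral; exact: probability_lty. Qed.

Lemma uniform_cos_sin (q : int) :
  Rintegral (uniform_prob twopi_gt0) setT (fun x => cos (q%:~R * x)) = (q == 0)%:R /\
  Rintegral (uniform_prob twopi_gt0) setT (fun x => sin (q%:~R * x)) = 0.
Proof.
have b1 : bounded_measurable (fun _ : R => 1 : R) := bounded_measurable_cst _ 1.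
have I1 : Rintegral (uniform_prob twopi_gt0) setT (fun _ => 1) = 1.
  exact: Rintegral_probability_cst.
have [->|q0] := eqVneq q 0.
  have -> : (fun x : R => cos (0%:~R * x)) = fun=> 1 by apply/funext => x; rewrite mul0r cos0.
  have -> : (fun x : R => sin (0%:~R * x)) = fun=> 0 by apply/funext => x; rewrite mul0r sin0.
  by split=> //; rewrite (bfun0 uniform_bfun).
have qR : q%:~R != 0 :> R by rewrite intr_eq0.
have cq : continuous (fun x : R => q%:~R * x).
  by move=> x; apply: cvgMl_tmp; exact: cvg_id.
have bcos : bounded_measurable (fun x : R => cos (q%:~R * x)).
  split; last by exists 1 => x; exact: cos_max.
  apply: continuous_measurable_fun => x.
  by apply: continuous_comp; [exact: cq|exact: continuous_cos].
have bsin : bounded_measurable (fun x : R => sin (q%:~R * x)).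
  split; last by exists 1 => x; exact: sin_max.
  apply: continuous_measurable_fun => x.
  by apply: continuous_comp; [exact: cq|exact: continuous_sin].
have p0 := twopi_gt0.
(* [uniform_integral] takes nonnegative integrands, so [1 + cos] and [1 + sin] are integrated
   instead. *)
split; apply: (@addrI _ 1); rewrite -[X in X + _ = _]I1 -(bfunD uniform_bfun)//.
- have dF (x : R) : is_derive x 1 (fun x => x + q%:~R^-1 * sin (q%:~R * x)) (1 + cos (q%:~R * x)).
    by apply: is_derive_eq; rewrite /GRing.scale/=; field.
  rewrite addr0 (uniform_integral (M := 2) dF).
  + rewrite mulr0 sin0 mulr0 addr0 subr0.
    have -> : q%:~R * (2 * pi) = 0 + 2 * pi * q%:~R :> R by ring.
    by rewrite sinDint2pi sin0 mulr0 addr0 mulVf// gt_eqF.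
  + by move=> x; apply: cvgD; [exact: cvg_cst|apply: continuous_comp; [exact: cq|exact: continuous_cos]].
  + by move=> x; have := cos_geN1 (q%:~R * x); have := cos_le1 (q%:~R * x); move=> ? ?; apply/andP; split; lra.
- have dF (x : R) : is_derive x 1 (fun x => x - q%:~R^-1 * cos (q%:~R * x)) (1 + sin (q%:~R * x)).
    by apply: is_derive_eq; rewrite /GRing.scale/=; field.
  rewrite addr0 (uniform_integral (M := 2) dF).
  + rewrite mulr0 cos0 mulr1.
    have -> : q%:~R * (2 * pi) = 0 + 2 * pi * q%:~R :> R by ring.
    by rewrite cosDint2pi cos0 mulr1 sub0r opprK subrK mulVf// gt_eqF.
  + by move=> x; apply: cvgD; [exact: cvg_cst|apply: continuous_comp; [exact: cq|exact: continuous_sin]].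
  + by move=> x; have := sin_geN1 (q%:~R * x); have := sin_le1 (q%:~R * x); move=> ? ?; apply/andP; split; lra.
Qed.

(* A random point of [R^n] whose class is uniform on the torus. *)
Lemma sample_space n : exists (d : measure_display) (T : measurableType d)
    (P : probability T R) (theta : T -> 'rV[R]_n),
  (forall j, measurable_fun [set: T] (fun w => theta w 0 j)) /\
  forall k, Rintegral P setT (fun w => cos (phase k (theta w))) = (k == 0)%:R /\
            Rintegral P setT (fun w => sin (phase k (theta w))) = 0.
Proof.
elim: n => [|n [d [T [P [theta [mtheta Ptheta]]]]]].
  exists _, (measurableTypeR R), (uniform_prob twopi_gt0), (fun=> 0).
  split=> [[]//|k]; have -> : k = 0 by apply/rowP => -[].
  rewrite eqxx; have p0 (w : R) : phase (0 : 'rV[int]_0) (0 : 'rV[R]_0) = 0 by exact: phase0.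
  under eq_fun do rewrite phase0 cos0; under [in X in _ /\ X]eq_fun do rewrite phase0 sin0.
  by rewrite !Rintegral_probability_cst.
pose U := uniform_prob twopi_gt0.
(* An independent uniform angle becomes the first coordinate; the addition formulas then factor the
   integrals. *)
pose th (w : measurableTypeR R * T) : 'rV[R]_n.+1 :=
  \row_j (if unlift ord0 j is Some i then theta w.2 0 i else w.1).
have mth j : measurable_fun setT (fun w => th w 0 j).
  under eq_fun do rewrite mxE; case: unliftP => [i|] _; last exact: measurable_fst.
  exact: measurableT_comp (mtheta i) measurable_snd.
exists _, (measurableTypeR R * T)%type, (U \x P)%E, th; split=> // k.
pose k' : 'rV[int]_n := \row_i k 0 (lift ord0 i).
have phE w : phase k (th w) = (k 0 ord0)%:~R * w.1 + phase k' (theta w.2).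
  rewrite /phase big_ord_recl mxE unlift_none; congr (_ + _).
  by apply: eq_bigr => i _; rewrite !mxE liftK.
have mphase d0 (T0 : measurableType d0) m (th' : T0 -> 'rV[R]_m) (l : 'rV[int]_m) :
    (forall j, measurable_fun setT (fun w => th' w 0 j)) ->
    measurable_fun setT (fun w => phase l (th' w)).
  move=> mt; rewrite /phase; apply: measurable_sum => j.
  by apply: measurable_funM => //; exact: measurable_cst.
have bcos d0 (T0 : measurableType d0) (g : T0 -> R) : measurable_fun setT g ->
    bounded_measurable (fun w => cos (g w)).
  move=> mg; split; last by exists 1 => w; exact: cos_max.
  by apply: measurableT_comp mg; apply: continuous_measurable_fun; exact: continuous_cos.
have bsin d0 (T0 : measurableType d0) (g : T0 -> R) : measurable_fun setT g ->
    bounded_measurable (fun w => sin (g w)).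
  move=> mg; split; last by exists 1 => w; exact: sin_max.
  by apply: measurableT_comp mg; apply: continuous_measurable_fun; exact: continuous_sin.
have bP := bfun_Rintegral (probability_lty P).
have bU := bfun_Rintegral (probability_lty U).
have [EC ES] := Ptheta k'; have [UC US] := uniform_cos_sin (k 0 ord0).
have mk' := mphase _ _ _ _ k' mtheta.
have mk0 : measurable_fun setT (fun t : measurableTypeR R => (k 0 ord0)%:~R * t).
  apply: measurable_funM; [exact: measurable_cst|exact: measurable_id].
have kE : (k == 0)%:R = (k' == 0)%:R * (k 0 ord0 == 0)%:R :> R.
  rewrite -natrM mulnb; congr ((_ : bool)%:R); apply/eqP/andP => [k0|[/eqP k'0 /eqP k0]].
    by split; apply/eqP; [apply/rowP => i; rewrite mxE|]; rewrite k0 !mxE.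
  apply/rowP => j; rewrite mxE; case: (unliftP ord0 j) => [i|] ->; last exact: k0.
  by have /rowP/(_ i) := k'0; rewrite !mxE.
have bc := bcos _ _ _ mk'; have bs := bsin _ _ _ mk'.
split.
- rewrite Rintegral_prod; last by apply: bcos; exact: mphase.
  rewrite kE -UC -(bfunZ bU); last exact: bcos.
  congr (Rintegral _ _ _); apply/funext => t.
  rewrite (_ : (fun y => _) = fun y => cos ((k 0 ord0)%:~R * t) * cos (phase k' (theta y)) -
      sin ((k 0 ord0)%:~R * t) * sin (phase k' (theta y))); last first.
    by apply/funext => y; rewrite phE cosD.
  rewrite (bfunB bP (bounded_measurableZ _ bc) (bounded_measurableZ _ bs)).
  by rewrite !(bfunZ bP)// EC ES mulr0 subr0 mulrC.
- rewrite Rintegral_prod; last by apply: bsin; exact: mphase.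
  transitivity ((k' == 0)%:R * 0 : R); last by rewrite mulr0.
  rewrite -[X in _ = _ * X]US -(bfunZ bU); last exact: bsin.
  congr (Rintegral _ _ _); apply/funext => t.
  rewrite (_ : (fun y => _) = fun y => sin ((k 0 ord0)%:~R * t) * cos (phase k' (theta y)) +
      cos ((k 0 ord0)%:~R * t) * sin (phase k' (theta y))); last first.
    by apply/funext => y; rewrite phE sinD.
  rewrite (bfunD bP (bounded_measurableZ _ bc) (bounded_measurableZ _ bs)).
  by rewrite !(bfunZ bP)// EC ES mulr0 addr0 mulrC.
Qed.

End sample_space.

Lemma cvg_series_delta (R : realType) (p : nat) (L : R) :
  series (fun e => (e == p)%:R * L) @ \oo --> L.
Proof.
apply: cvg_near_cst; exists p.+1 => // m /= pm.
rewrite /series/= (bigD1_seq p)/= ?mem_index_iota ?iota_uniq ?eqxx ?mul1r//.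
by rewrite big1 ?addr0// => i /negbTE ->; rewrite mul0r.
Qed.

(** * Recovering a functional from its components *)

Section synthesis.
Variables (R : realType) (n : nat).
Local Notation X := (cylinder R n).
Variables (d : measure_display) (T : measurableType d) (P : probability T R).
Variable theta : T -> 'rV[R]_n.
Hypothesis mtheta : forall j, measurable_fun [set: T] (fun w => theta w 0 j).
Hypothesis theta_char : forall k,
  Rintegral P setT (fun w => cos (phase k (theta w))) = (k == 0)%:R /\
  Rintegral P setT (fun w => sin (phase k (theta w))) = 0.

Let bP : bounded_functional (Rintegral P setT).
Proof. exact: bfun_Rintegral (probability_lty P). Qed.

Lemma measurable_phase_theta k : measurable_fun setT (fun w => phase k (theta w)).
Proof.
rewrite /phase; apply: measurable_sum => j.
by apply: measurable_funM => //; exact: measurable_cst.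
Qed.

Lemma bounded_measurable_cos_theta k :
  bounded_measurable (fun w => cos (phase k (theta w))).
Proof.
split; last by exists 1 => w; exact: cos_max.
apply: measurableT_comp (measurable_phase_theta k).
by apply: continuous_measurable_fun; exact: continuous_cos.
Qed.

Lemma bounded_measurable_sin_theta k :
  bounded_measurable (fun w => sin (phase k (theta w))).
Proof.
split; last by exists 1 => w; exact: sin_max.
apply: measurableT_comp (measurable_phase_theta k).
by apply: continuous_measurable_fun; exact: continuous_sin.
Qed.

Lemma measurable_torus_sample :
  measurable_fun setT (fun x : R * T => ((x.1, torus_proj (theta x.2)) : borel X)).
Proof.
apply: measurable_fun_cylinder => al be rho q.
rewrite (_ : _ @^-1` _ = (fst @^-1` `]al, be[) `&`
    \bigcap_(j in [set: 'I_n]) [set x : R * T | rho < cos (theta x.2 0 j - q 0 j)]); last first.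
  have E j w : tcos_shift j (q 0 j) (torus_proj (theta w)) = cos (theta w 0 j - q 0 j).
    rewrite /tcos_shift; have [m ->] := torus_repr_proj (theta w).
    by rewrite !mxE addrAC cosDint2pi.
  apply/seteqP; split=> x /=; rewrite in_itv/= => -[H1 H2]; split=> // j.
    by move=> _ /=; rewrite -E.
  by rewrite E; exact: H2.
apply: measurableI.
  by rewrite -[X in measurable X]setTI; apply: measurable_fst => //; exact: measurable_itv.
apply: fin_bigcap_measurable => // j _.
have mc : measurable_fun setT (fun x : R * T => cos (theta x.2 0 j - q 0 j)).
  apply: measurableT_comp; first by apply: continuous_measurable_fun; exact: continuous_cos.
  apply: measurable_funB; last exact: measurable_cst.
  exact: measurableT_comp (mtheta j) measurable_snd.
rewrite (_ : mkset _ = (fun x : R * T => cos (theta x.2 0 j - q 0 j)) @^-1` `]rho, +oo[).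
  by rewrite -[X in measurable X]setTI; apply: mc => //; exact: measurable_itv.
by apply/seteqP; split=> x /=; rewrite in_itv/= andbT.
Qed.

(* The [k]-th Fourier coefficient of [f (t, .)]; the sine part is not needed,
   as all the functionals below are even in [k]. *)
Definition fourier_coef (k : 'rV[int]_n) (f : X -> R) (t : R) : R :=
  Rintegral P setT (fun w => f (t, torus_proj (theta w)) * cos (phase k (theta w))).

Lemma bounded_measurable_slice_cos k (f : borel X -> R) t : bounded_measurable f ->
  bounded_measurable (fun w => f (t, torus_proj (theta w)) * cos (phase k (theta w))).
Proof.
move=> [mf [M fM]]; apply: bounded_measurableM; last exact: bounded_measurable_cos_theta.
split; last by exists M => w.
have := measurableT_comp mf measurable_torus_sample.
move=> mg; have mp : measurable_fun setT (fun w : T => (t, w)).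
  by apply/measurable_fun_pairP; split; [exact: measurable_cst|exact: measurable_id].
exact: (measurableT_comp mg mp).
Qed.

Lemma bounded_measurable_fourier_coef k (f : borel X -> R) : bounded_measurable f ->
  bounded_measurable (fourier_coef k f).
Proof.
move=> bf; pose g (x : R * T) := f (x.1, torus_proj (theta x.2)) * cos (phase k (theta x.2)).
have bg : bounded_measurable g.
  case: bf => [mf [M fM]]; apply: bounded_measurableM.
    by split; [exact: measurableT_comp mf measurable_torus_sample|exists M => x].
  have [mc _] := bounded_measurable_cos_theta k.
  by split; [exact: measurableT_comp mc measurable_snd|exists 1 => x; exact: cos_max].
(* The Dirac mass only serves to form a product probability space; the conclusion, measurability in
   [t], does not depend on it. *)
exact: (bounded_measurable_slice_integral (\d_ (0 : R) : probability R R) P bg).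
Qed.

Lemma fourier_coef_le k (f : borel X -> R) M : bounded_measurable f ->
  (forall x, `|f x| <= M) -> forall t, `|fourier_coef k f t| <= M.
Proof.
move=> bf fM t; apply: le_normr_Rintegral_bound; first exact: bounded_measurable_slice_cos.
move=> w; rewrite normrM; apply: le_trans (ler_pM _ _ (fM _) (cos_max _)) _ => //.
by rewrite mulr1.
Qed.

Lemma bfun_fourier_coef k (l : (R -> R) -> R) : bounded_functional l ->
  bounded_functional (fun f : borel X -> R => l (fourier_coef k f)).
Proof.
move=> bl; have bs f t := @bounded_measurable_slice_cos k f t.
split=> [f g bf bg|c f bf|F f M bF FM bf Ff].
- rewrite -(bfunD bl); [|exact: bounded_measurable_fourier_coef..].
  congr l; apply/funext => t; rewrite /fourier_coef -(bfunD bP); [|exact: bs..].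
  by congr (Rintegral _ _ _); apply/funext => w; rewrite mulrDl.
- rewrite -(bfunZ bl); last exact: bounded_measurable_fourier_coef.
  congr l; apply/funext => t; rewrite /fourier_coef -(bfunZ bP); last exact: bs.
  by congr (Rintegral _ _ _); apply/funext => w; rewrite mulrA.
- apply: (bfun_cvg bl (M := M)).
  + by move=> m; exact: bounded_measurable_fourier_coef.
  + by move=> m t; exact: fourier_coef_le.
  + exact: bounded_measurable_fourier_coef.
  + move=> t; apply: (bfun_cvg bP (M := M)).
    * by move=> m; exact: bs.
    * move=> m w; rewrite normrM; apply: le_trans (ler_pM _ _ (FM m _) (cos_max _)) _ => //.
      by rewrite mulr1.
    * exact: bs.
    * by move=> w; apply: cvgM; [exact: Ff|exact: cvg_cst].
Qed.

Lemma fourier_coef_cos k m (h : R -> R) t :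
  fourier_coef k (fun x => h x.1 * tcos m x.2) t =
  h t * (2^-1 * (m + k == 0)%:R + 2^-1 * (m - k == 0)%:R).
Proof.
have b1 := bounded_measurable_cos_theta (m + k); have b2 := bounded_measurable_cos_theta (m - k).
have [E1 _] := theta_char (m + k); have [E2 _] := theta_char (m - k).
rewrite -E1 -E2 -!(bfunZ bP)// -(bfunD bP); [|exact: bounded_measurableZ..].
rewrite -(bfunZ bP); last by apply: bounded_measurableD; exact: bounded_measurableZ.
congr (Rintegral _ _ _); apply/funext => w /=.
by rewrite tcos_proj -mulrA cos_mul_cos !phaseD phaseN.
Qed.

Lemma fourier_coef_sin k m (h : R -> R) t :
  fourier_coef k (fun x => h x.1 * tsin m x.2) t = 0.
Proof.
have b1 := bounded_measurable_sin_theta (m + k); have b2 := bounded_measurable_sin_theta (m - k).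
have [_ E1] := theta_char (m + k); have [_ E2] := theta_char (m - k).
transitivity (h t * (2^-1 * 0 + 2^-1 * 0)); last by rewrite !mulr0 addr0 mulr0.
rewrite -[X in 2^-1 * X + _]E1 -[X in _ + 2^-1 * X]E2 -!(bfunZ bP)// -(bfunD bP); [|exact: bounded_measurableZ..].
rewrite -(bfunZ bP); last by apply: bounded_measurableD; exact: bounded_measurableZ.
congr (Rintegral _ _ _); apply/funext => w /=.
by rewrite tsin_proj -mulrA sin_mul_cos !phaseD phaseN.
Qed.

Section synthesis_series.
Variables (l : 'rV[int]_n -> (R -> R) -> R) (c : 'rV[int]_n -> R) (C : R).
Hypothesis bl : forall k, bounded_functional (l k).
Hypothesis lc : forall k g M, bounded_measurable g -> (forall t, `|g t| <= M) ->
  `|l k g| <= M * c k.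
Hypothesis c0 : forall k, 0 <= c k.
Hypothesis cC : forall s : seq 'rV[int]_n, uniq s -> \sum_(k <- s) c k <= C.
Hypothesis lN : forall k, l (- k) = l k.

(** [pickle_inv] is an exact partial inverse of [pickle], so every frequency occurs at one index
    only. *)
Definition synthesis_term (f : X -> R) (e : nat) : R :=
  if @pickle_inv 'rV[int]_n e is Some k then l k (fourier_coef k f) else 0.

(* [\sum_k l k (fourier_coef k f)], the sum being enumerated by [pickle]. *)
Definition synthesis (f : X -> R) : R := limn (series (synthesis_term f)).

Lemma synthesis_sum_le m :
  \sum_(0 <= e < m) oapp c 0 (@pickle_inv 'rV[int]_n e) <= C.
Proof.
have -> : \sum_(0 <= e < m) oapp c 0 (@pickle_inv 'rV[int]_n e) =
    \sum_(k <- pmap (@pickle_inv 'rV[int]_n) (index_iota 0 m)) c k.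
  elim: (index_iota 0 m) => [|e s IH]; first by rewrite !big_nil.
  rewrite big_cons IH /=; case: (@pickle_inv 'rV[int]_n e) => [k|] /=; last by rewrite add0r.
  by rewrite big_cons.
by apply: cC; apply: (pmap_uniq (@pickle_invK _)); exact: iota_uniq.
Qed.

Lemma synthesis_bounded_functional :
  bounded_functional (synthesis : (borel X -> R) -> R) /\
  forall f : borel X -> R, bounded_measurable f -> cvgn (series (synthesis_term f)).
Proof.
pose J (e : nat) (f : borel X -> R) := synthesis_term f e.
have := @bfun_series _ _ _ J
  (fun e => oapp c 0 (@pickle_inv 'rV[int]_n e)) C; apply.
- move=> e; rewrite /J /synthesis_term; case: (@pickle_inv 'rV[int]_n e) => [k|].
    exact: bfun_fourier_coef.
  split=> [*|*|*]; first by rewrite addr0.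
    by rewrite mulr0.
  exact: cvg_cst.
- move=> e f M bf fM; rewrite /J /synthesis_term; case: (@pickle_inv 'rV[int]_n e) => [k|] /=.
    apply: lc; first exact: bounded_measurable_fourier_coef.
    exact: fourier_coef_le.
  by rewrite normr0 mulr0.
- by move=> e; case: (@pickle_inv 'rV[int]_n e) => [k|] /=.
- exact: synthesis_sum_le.
Qed.

Lemma pickle_inv_eq (k : 'rV[int]_n) e :
  @pickle_inv 'rV[int]_n e = Some k <-> e = @pickle 'rV[int]_n k.
Proof.
split=> [E|->]; last exact: pickleK_inv.
have := @pickle_invK 'rV[int]_n e.
by rewrite E /= => ->.
Qed.

(** The cosine of frequency [m] has coefficient [1/2] at [m] and at [- m], and [lN] makes both
    contributions equal. For [m = 0] both halves fall on the same index; two separate delta series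
    cover this case too. *)
Lemma synthesis_cos m (h : R -> R) : bounded_measurable h ->
  synthesis (fun x => h x.1 * tcos m x.2) = l m h.
Proof.
move=> bh; pose p k := @pickle 'rV[int]_n k.
have -> : l m h = 2^-1 * l m h + 2^-1 * l m h.
  by rewrite -mulrDl (_ : 2^-1 + 2^-1 = 1) ?mul1r//; lra.
rewrite /synthesis.
rewrite (_ : series _ = series (fun e => (e == p (- m))%:R * (2^-1 * l m h)) \+
                        series (fun e => (e == p m)%:R * (2^-1 * l m h))); last first.
  apply/funext => N; rewrite /series/= -big_split/=; apply: eq_bigr => e _.
  rewrite /synthesis_term; case E : (@pickle_inv 'rV[int]_n e) => [k|]; last first.
    suff H k : (e == p k) = false by rewrite !H !mul0r addr0.
    by apply/eqP => /pickle_inv_eq; rewrite E.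
  have -> : fourier_coef k (fun x => h x.1 * tcos m x.2) =
      (fun t => (2^-1 * (m + k == 0)%:R + 2^-1 * (m - k == 0)%:R) * h t).
    by apply/funext => t; rewrite fourier_coef_cos mulrC.
  rewrite (bfunZ (bl k))//.
  have H k' : (e == p k') = (k == k').
    apply/eqP/eqP => [/pickle_inv_eq|kk]; first by rewrite E => -[].
    by apply/pickle_inv_eq; rewrite E kk.
  have -> : (m + k == 0) = (k == - m) by rewrite addrC addr_eq0.
  have -> : (m - k == 0) = (k == m) by rewrite subr_eq0 eq_sym.
  rewrite !H mulrDl -!mulrA ![2^-1 * (_ * _)]mulrCA; congr (_ + _).
    by case: eqP => [->|_]; rewrite ?lN ?mul0r.
  by case: eqP => [->|_]; rewrite ?mul0r.
apply: cvg_lim => //; apply: cvgD; exact: cvg_series_delta.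
Qed.

Lemma synthesis_sin m (h : R -> R) : synthesis (fun x => h x.1 * tsin m x.2) = 0.
Proof.
rewrite /synthesis (_ : series _ = fun=> 0); first by apply: cvg_lim => //; exact: cvg_cst.
apply/funext => N; rewrite /series/= big1// => e _.
rewrite /synthesis_term; case: (@pickle_inv 'rV[int]_n e) => [k|]//.
have -> : fourier_coef k (fun x => h x.1 * tsin m x.2) = cst 0.
  by apply/funext => t; rewrite fourier_coef_sin.
exact: bfun0.
Qed.

End synthesis_series.
End synthesis.

(** * Components of a signed measure *)

(** Supports are defined point by point. With a countable base, rational boxes or intervals, this
    turns points outside a support into a null set. *)
Lemma measure_null_cover d (T : measurableType d) (R : realType)
    (nu : {measure set T -> \bar R}) (I : countType) (B : I -> set T) (A : set T) :
  measurable A -> (forall i, measurable (B i)) ->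
  (forall x, A x -> exists2 i, B i x & nu (B i) = 0%E) -> nu A = 0%E.
Proof.
move=> mA mB AB.
pose C (e : nat) : set T :=
  if unpickle e is Some i then (if nu (B i) == 0%E then B i else set0) else set0.
have mC e : measurable (C e).
  by rewrite /C; case: unpickle => [i|]//; case: eqP.
have C0 e : nu (C e) = 0%E.
  by rewrite /C; case: unpickle => [i|]; [case: eqP|]; rewrite ?measure0.
have AC : A `<=` \bigcup_e C e.
  move=> x /AB[i Bix Bi0]; apply: (ex_intro2 _ _ (pickle i) Logic.I).
  by rewrite /C pickleK Bi0 eqxx.
apply/eqP; rewrite eq_le measure_ge0 andbT.
apply: le_trans (measure_sigma_subadditive _ mC mA AC) _.
by rewrite eseries0.
Qed.

Lemma bfunM d (T : measurableType d) (R : realType) (I : (T -> R) -> R) (g : T -> R) :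
  bounded_functional I -> bounded_measurable g ->
  bounded_functional (fun f => I (fun x => f x * g x)).
Proof.
move=> bI bg; have bM f : bounded_measurable f -> bounded_measurable (fun x => f x * g x).
  by move=> bf; exact: bounded_measurableM.
split=> [f h bf bh|c f bf|F f M bF FM bf Ff].
- rewrite -(bfunD bI); [|exact: bM..].
  by congr (I _); apply/funext => x; rewrite mulrDl.
- rewrite -(bfunZ bI); last exact: bM.
  by congr (I _); apply/funext => x; rewrite mulrA.
- have [_ [K gK]] := bg.
  apply: (bfun_cvg bI (M := M * K)).
  + by move=> m; exact: bM.
  + by move=> m x; rewrite normrM ler_pM.
  + exact: bM.
  + by move=> x; apply: cvgM; [exact: Ff|exact: cvg_cst].
Qed.

Section signed_measures.
Variables (R : realType) (n : nat).
Local Notation X := (cylinder R n).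
Variables (a b : R).
Implicit Types (mu sigma : signed_measure R n) (k : 'rV[int]_n).

Lemma measurable_slab : measurable (slab a b : set (borel X)).
Proof.
rewrite (_ : slab a b = (fun x : borel X => x.1 : R) @^-1` `[a, b]); last first.
  by apply/seteqP; split=> x /=; [case|].
by rewrite -[X in measurable X]setTI; apply: measurable_fst_cylinder.
Qed.

Lemma open_slabC : open (~` slab a b : set X).
Proof.
rewrite (_ : ~` _ = fst @^-1` ~` `[a, b]); last first.
  by apply/seteqP; split=> x /= nx Hx; apply: nx => //; case: Hx.
by apply: open_comp; [move=> x _; exact: cvg_fst|exact/closed_openC/itv_closed].
Qed.

Lemma null_outside_slab mu (A : set (borel X)) : charge_support mu `<=` slab a b ->
  measurable A -> A `<=` ~` slab a b -> mu A = 0%E.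
Proof.
move=> smu mA AS; apply/eqP; rewrite -abse_eq0 eq_le abse_ge0 andbT.
apply: le_trans (abse_charge_variation (hahnP mu) mA) _.
pose nu : {measure set (borel X) -> \bar R} := charge_variation (hahnP mu).
suff : nu A = 0%E by move=> /= ->.
pose B (p : rat * rat * rat * 'rV[rat]_n) : set X :=
  box (ratr p.1.1.1) (ratr p.1.1.2) (ratr p.1.2) (map_mx ratr p.2).
apply: (@measure_null_cover _ _ _ nu _ B) => // [p|x /AS nSx].
  exact: measurable_box.
have : ~ charge_support mu x by move=> /smu.
rewrite /charge_support /measure_support /= => /existsNP[U /not_implyP[oU /not_implyP[Ux nU]]].
have U0 : nu U = 0%E.
  apply/eqP; rewrite eq_le measure_ge0 andbT leNgt; apply/negP; exact: nU.
have [al [be [rho [q [xB BU]]]]] := box_base oU Ux.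
exists (al, be, rho, q) => //; apply/eqP; rewrite eq_le measure_ge0 andbT -U0.
apply: le_measure => //; rewrite inE; first exact: measurable_box.
exact: sub_sigma_algebra.
Qed.

Lemma charge_support_sub mu :
  (forall A : set (borel X), measurable A -> A `<=` ~` slab a b -> mu A = 0%E) ->
  charge_support mu `<=` slab a b.
Proof.
move=> mu0 x sx; apply: contrapT => nSx; have := sx _ open_slabC nSx.
have mS : measurable (~` slab a b : set (borel X)).
  by apply: measurableC; exact: measurable_slab.
have [[mP _] [mN _] _ _] := hahnP mu.
have jp : jordan_pos (hahnP mu) (~` slab a b) = 0%E.
  rewrite jordan_posE cjordan_posE /crestr0 mem_set// /crestr; apply: mu0; first exact: measurableI.
  exact: subIsetl.
have jn : jordan_neg (hahnP mu) (~` slab a b) = 0%E.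
  rewrite jordan_negE cjordan_negE /crestr0 mem_set// /crestr.
  have -> : mu (~` slab a b `&` hahn_neg mu) = 0%E; last by rewrite oppe0.
  apply: mu0; [exact: measurableI|exact: subIsetl].
by rewrite /Defs.total_variation /charge_variation jp jn adde0 ltxx.
Qed.

Lemma slab_integralE mu : charge_Rintegral mu (slab a b) =
  fun f => charge_Rintegral mu setT (fun x => f x * \1_(slab a b) x).
Proof.
apply/funext => f; rewrite charge_Rintegral_mkcond.
by congr charge_Rintegral; apply/funext => x; rewrite patchE indicE; case: ifP; rewrite ?mulr1 ?mulr0.
Qed.

Lemma eq_slab_integral mu f g : (forall x, slab a b x -> f x = g x) ->
  charge_Rintegral mu (slab a b) f = charge_Rintegral mu (slab a b) g.
Proof.
move=> fg; rewrite slab_integralE; congr charge_Rintegral; apply/funext => x.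
rewrite indicE; have [/set_mem/fg ->//|] := boolP (x \in slab a b).
by rewrite !mulr0.
Qed.

Lemma bfun_slab_integral mu :
  bounded_functional (charge_Rintegral mu (slab a b) : (borel X -> R) -> R).
Proof.
rewrite slab_integralE; apply: bfunM; first exact: bfun_charge_Rintegral.
by apply: bounded_measurable_indic; exact: measurable_slab.
Qed.

Lemma slab_integral_setT mu f : charge_support mu `<=` slab a b -> bounded_measurable f ->
  charge_Rintegral mu (slab a b) f = charge_Rintegral mu setT f.
Proof.
move=> smu; apply: bfun_ext; [exact: bfun_slab_integral|exact: bfun_charge_Rintegral|].
move=> A mA; rewrite slab_integralE; apply: EFin_inj.
have -> : (fun x => \1_A x * \1_(slab a b) x) = \1_(A `&` slab a b) :> (borel X -> R).
  by rewrite indicI.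
have mS := measurable_slab.
rewrite !charge_Rintegral_indic//; last exact: measurableI.
rewrite (charge_partition _ mA mS (measurableC mS)) ?setICr ?setUCr//.
rewrite [X in _ = (_ + X)%E]null_outside_slab ?adde0//.
by apply: measurableI => //; exact: measurableC.
Qed.

(** For a pseudo-positive [mu] this is integration against the component measure, the sine part
    being 0; as a functional it also accepts functions that are neither continuous nor compactly
    supported. *)
Definition component mu k (g : R -> R) : R :=
  charge_Rintegral mu (slab a b) (fun x => g x.1 * tcos k x.2).

Definition sine_component mu k (g : R -> R) : R :=
  charge_Rintegral mu (slab a b) (fun x => g x.1 * tsin k x.2).

Lemma character_integralE mu k (h : R -> R) :
  charge_Cintegral mu (slab a b) (fun x => ((h x.1)%:C * character k x.2)%C) =
  (component mu k h +i* sine_component mu k h)%C.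
Proof.
rewrite (_ : (fun x => _) =
  fun x : X => ((h x.1 * tcos k x.2) +i* (h x.1 * tsin k x.2))%C) //.
apply/funext => x; rewrite characterE.
by apply/eqP; rewrite eq_complex /= !mul0r subr0 addr0 !eqxx.
Qed.

Lemma bounded_measurable_comp_fst (g : R -> R) : bounded_measurable g ->
  bounded_measurable (fun x : borel X => g x.1).
Proof.
move=> [mg [M gM]]; split; last by exists M => x.
by have := measurableT_comp mg (@measurable_fst_cylinder R n).
Qed.

Lemma bfun_comp_fst (I : (borel X -> R) -> R) : bounded_functional I ->
  bounded_functional (fun g : R -> R => I (fun x => g x.1)).
Proof.
move=> bI; split=> [f g bf bg|c f bf|F f M bF FM bf Ff].
- by rewrite (bfunD bI)//; exact: bounded_measurable_comp_fst.
- by rewrite (bfunZ bI)//; exact: bounded_measurable_comp_fst.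
- apply: (bfun_cvg bI (M := M)) => [m|m x||x] //; exact: bounded_measurable_comp_fst.
Qed.

Lemma bfun_component mu k : bounded_functional (component mu k).
Proof.
apply: (bfun_comp_fst (I := fun f => charge_Rintegral mu (slab a b) (fun x => f x * tcos k x.2))).
by apply: bfunM; [exact: bfun_slab_integral|exact: bounded_measurable_tcos].
Qed.

Lemma bfun_sine_component mu k : bounded_functional (sine_component mu k).
Proof.
apply: (bfun_comp_fst (I := fun f => charge_Rintegral mu (slab a b) (fun x => f x * tsin k x.2))).
by apply: bfunM; [exact: bfun_slab_integral|exact: bounded_measurable_tsin].
Qed.

Lemma componentN mu k : component mu (- k) = component mu k.
Proof.
by apply/funext => g; congr charge_Rintegral; apply/funext => x; rewrite /tcos phaseN cosN.
Qed.

Lemma pseudo_positiveP mu : pseudo_positive a b mu <->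
  forall k h, continuous h -> compactly_supported h -> (forall t, 0 <= h t) ->
    0 <= component mu k h /\ sine_component mu k h = 0.
Proof.
split=> H k h ch sh h0; have := H k h ch sh h0; rewrite character_integralE lecE /=.
  by move=> /andP[/eqP -> ->].
by move=> [-> ->]; rewrite eqxx.
Qed.

Lemma bounded_measurable_compactly_supported (h : R -> R) :
  continuous h -> compactly_supported h -> bounded_measurable h.
Proof.
move=> ch sh; split; first exact: continuous_measurable_fun.
exact: compactly_supported_bounded.
Qed.

(** Pseudo-positivity gives this for nonnegative functions; the general case splits [h] into
    positive and negative parts. *)
Lemma sine_component_eq0 mu k (h : R -> R) : pseudo_positive a b mu ->
  continuous h -> compactly_supported h -> sine_component mu k h = 0.
Proof.
move=> /pseudo_positiveP pmu ch sh.
have S f : continuous f -> (forall t, h t = 0 -> f t = 0) -> compactly_supported f.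
  move=> cf hf; apply: (subclosed_compact _ sh); first exact: closed_closure.
  by apply: closureS => t /=; apply: contra => /eqP /hf ->.
pose hp t := Num.max (h t) 0; pose hn t := Num.max (- h t) 0.
have cp : continuous hp by move=> t; apply: (@continuous_max _ _ h (fun=> 0)); [exact: ch|exact: cvg_cst].
have cn : continuous hn.
  by move=> t; apply: (@continuous_max _ _ (fun t => - h t) (fun=> 0));
    [apply: continuousN; exact: ch|exact: cvg_cst].
have sp : compactly_supported hp by apply: S => // t ht; rewrite /hp ht maxxx.
have sn : compactly_supported hn by apply: S => // t ht; rewrite /hn ht oppr0 maxxx.
have [_ E1] := pmu k _ cp sp (fun t => ltac:(by rewrite /hp le_max lexx orbT)).
have [_ E2] := pmu k _ cn sn (fun t => ltac:(by rewrite /hn le_max lexx orbT)).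
have bp := bounded_measurable_compactly_supported cp sp.
have bn := bounded_measurable_compactly_supported cn sn.
have := bfunB (bfun_sine_component mu k) bp bn.
rewrite E1 E2 subr0 => <-; congr sine_component; apply/funext => t.
rewrite /hp /hn; case/orP: (le_total 0 (h t)) => h0.
  by rewrite max_l// max_r ?subr0// oppr_le0.
by rewrite max_r// max_l ?opprK ?add0r// oppr_ge0.
Qed.

Lemma component_ge0 mu k (g : R -> R) : pseudo_positive a b mu ->
  bounded_measurable g -> (forall t, 0 <= g t) -> 0 <= component mu k g.
Proof.
move=> /pseudo_positiveP pmu; apply: positive_bounded_functional.
  exact: bfun_component.
by move=> h ch sh h0; have [] := pmu k h ch sh h0.
Qed.

Lemma positive_bfun_le (l : (R -> R) -> R) (g : R -> R) M : bounded_functional l ->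
  (forall f : R -> R, bounded_measurable f -> (forall t, 0 <= f t) -> 0 <= l f) ->
  bounded_measurable g -> (forall t, `|g t| <= M) -> `|l g| <= M * l (fun _ => 1).
Proof.
move=> bl l0 bg gM; have b1 : bounded_measurable (fun _ : R => 1 : R).
  exact: bounded_measurable_cst.
have bM := bounded_measurableZ M b1.
rewrite -(bfunZ bl)// ler_norml; apply/andP; split.
  rewrite -subr_ge0 opprK -(bfunD bl)//; apply: l0 => [|t]; first exact: bounded_measurableD.
  by have := gM t; rewrite ler_norml => /andP[+ _]; rewrite mulr1; lra.
rewrite -subr_ge0 -(bfunB bl)//; apply: l0 => [|t]; first exact: bounded_measurableB.
by have := gM t; rewrite ler_norml => /andP[_ +]; rewrite mulr1; lra.
Qed.

Lemma Re_character_integral mu k :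
  complex.Re (charge_Cintegral mu (slab a b) (fun x => character k x.2)) =
  component mu k (fun _ => 1).
Proof.
rewrite (_ : (fun x => _) = fun x : X => (tcos k x.2 +i* tsin k x.2)%C); last first.
  by apply/funext => x; rewrite characterE.
by congr charge_Rintegral; apply/funext => x; rewrite mul1r.
Qed.

Lemma component_sum_bounded mu : pseudo_positive a b mu ->
  (\esum_(k in [set: 'rV[int]_n])
     (complex.Re (charge_Cintegral mu (slab a b)
            (fun x => character k x.2)))%:E < +oo)%E ->
  exists C, forall s : seq 'rV[int]_n, uniq s ->
    \sum_(k <- s) component mu k (fun _ => 1) <= C.
Proof.
move=> pmu hC.
have c0 k : 0 <= component mu k (fun _ => 1).
  by apply: component_ge0 => //; exact: bounded_measurable_cst.
set S := (\esum_(k in _) _)%E in hC.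
have S0 : (0 <= S)%E by apply: esum_ge0 => k _; rewrite lee_fin Re_character_integral.
exists (fine S) => s us; rewrite -lee_fin fineK ?ge0_fin_numE//.
have -> : ((\sum_(k <- s) component mu k (fun _ => 1))%:E =
    \sum_(k \in [set` s]) (complex.Re (charge_Cintegral mu (slab a b)
            (fun x => character k x.2)))%:E)%E.
  rewrite -fsbig_seq// -sumEFin; apply: eq_bigr => k _.
  by rewrite Re_character_integral.
apply: esum_ge; exists [set` s] => //; split=> //.
exact: finite_seq.
Qed.

Lemma signed_measure_ext mu sigma :
  charge_support mu `<=` slab a b -> charge_support sigma `<=` slab a b ->
  (forall k h, continuous h -> compactly_supported h ->
     component mu k h = component sigma k h /\ sine_component mu k h = sine_component sigma k h) ->
  forall A, measurable A -> mu A = sigma A.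
Proof.
move=> smu ssi H A mA.
have bA : bounded_measurable (\1_A : borel X -> R) by exact: bounded_measurable_indic.
rewrite -!charge_Rintegral_indic// -!slab_integral_setT//; congr EFin; apply/eqP.
rewrite -subr_eq0; apply/eqP.
have := bfun_linear 1 (-1) (bfun_slab_integral mu) (bfun_slab_integral sigma).
move=> /fourier_unique - /(_ _ _ bA); rewrite mul1r mulN1r; apply => k h ch sh.
by have [E1 E2] := H k h ch sh;
  rewrite !mul1r !mulN1r -!/(component _ _ _) -!/(sine_component _ _ _) E1 E2 !subrr.
Qed.

End signed_measures.

(** * Existence *)

Section quadrature.
Variable R : realType.

Lemma cvg_sum_ord m (T : Type) (F : set_system T) (FF : Filter F)
    (f : 'I_m -> T -> R) (l : 'I_m -> R) :
  (forall i, f i x @[x --> F] --> l i) -> \sum_i f i x @[x --> F] --> \sum_i l i.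
Proof.
elim: m f l => [|m IH] f l fl.
  by under eq_fun do rewrite big_ord0; rewrite big_ord0; exact: cvg_cst.
under eq_fun do rewrite big_ord_recl; rewrite big_ord_recl.
by apply: cvgD => //; exact: IH.
Qed.

(** Exponentials are unbounded on the line; the cut brings them into the domain of bounded
    functionals and changes nothing over [[a, b]]. *)
Definition cut (a b : R) (g : R -> R) (t : R) : R := g t * \1_(`[a, b]%classic) t.

Lemma cutE (a b : R) g t : a <= t <= b -> cut a b g t = g t.
Proof.
move=> tab; rewrite /cut indicE mem_set ?mulr1//=; by rewrite in_itv.
Qed.

Lemma bounded_measurable_cut (a b : R) (g : R -> R) : continuous g ->
  bounded_measurable (cut a b g).
Proof.
move=> cg; have mi : bounded_measurable (\1_(`[a, b]%classic) : R -> R).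
  by apply: bounded_measurable_indic; exact: measurable_itv.
split; first by apply: measurable_funM; [exact: continuous_measurable_fun|case: mi].
have [ab|ba] := leP a b; last first.
  exists 0 => t; rewrite /cut indicE memNset ?mulr0 ?normr0//= in_itv/=.
  by move=> /andP[ta /(le_trans ta)]; rewrite leNgt ba.
have cn : {within `[a, b], continuous (fun t => `|g t|)}.
  apply: continuous_subspaceT => t; apply: continuous_comp; [exact: cg|exact: norm_continuous].
have [c _ cM] := EVT_max ab cn.
exists `|g c| => t; rewrite /cut indicE; have [/set_mem/cM|] := boolP (_ \in _).
  by rewrite mulr1.
by rewrite mulr0 normr0.
Qed.

(* [q] is the discrete measure with atoms [q.1] and weights [q.2]. *)
Definition point_sum (q : seq R * (R -> R)) (g : R -> R) : R :=
  \sum_(z <- q.1) q.2 z * g z.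

Lemma bfun_point_sum q : bounded_functional (point_sum q).
Proof.
split=> [f g _ _|c f _|F f M _ _ _ Ff].
- by rewrite /point_sum -big_split; apply: eq_bigr => z _; rewrite mulrDr.
- by rewrite /point_sum mulr_sumr; apply: eq_bigr => z _; rewrite mulrCA.
- rewrite /point_sum; elim: (q.1) => [|z s IH].
    under eq_fun do rewrite big_nil.
    by rewrite big_nil; exact: cvg_cst.
  under eq_fun do rewrite big_cons.
  rewrite big_cons; apply: cvgD => //; apply: cvgM; [exact: cvg_cst|exact: Ff].
Qed.

Lemma continuous_epoly (rho : R) (P : {poly R}) : continuous (epoly rho P).
Proof.
move=> t; apply/differentiable_continuous/derivable1_diffP.
by have [] := is_derive_epoly rho P t.
Qed.

Lemma continuous_exp_system (k : R) s (i : 'I_(s.*2.*2).+1) j :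
  continuous (exp_system k i j).
Proof. exact: continuous_epoly. Qed.

(** The mass bound is the optimized inequality, and it concerns the mass only for [k != 0], where
    the optimized function is the constant 1. *)
Definition exponential_moments (a b k : R) s (l : (R -> R) -> R) (q : seq R * (R -> R)) : Prop :=
  [/\ uniq q.1 /\ (size q.1 <= s.*2)%N,
      forall z, z \in q.1 -> a <= z <= b /\ 0 <= q.2 z,
      forall i : 'I_(s.*2.*2), l (cut a b (exp_system k (lift ord0 i) 0%N)) =
        point_sum q (exp_system k (lift ord0 i) 0%N) &
      k != 0 -> point_sum q (fun _ => 1) <= l (cut a b (fun _ => 1))].

Lemma exists_exponential_moments (a b k : R) s (l : (R -> R) -> R) : a < b -> (0 < s)%N ->
  bounded_functional l ->
  (forall f : R -> R, bounded_measurable f -> (forall t, 0 <= f t) -> 0 <= l f) ->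
  exists q, exponential_moments a b k s l q.
Proof.
(* With [s.+1] in place of [s], the dimension [s.+1.*2.*2] is convertible to [r.+1.*2] for
   [r = s.*2.+1], and [r.+1] is the desired number of nodes. *)
case: s => // s ab _ bl l0; pose W := @exp_system R k s.+1.
have [e We] := @exp_system_const R k s.+1 isT.
have lin_cut (c : 'rV[R]_(s.+1.*2.*2).+1) :
    lin (fun i => l (cut a b (W i 0%N))) c = l (cut a b (combination W c)).
  have bW i : bounded_measurable (cut a b (W i 0%N)).
    by apply: bounded_measurable_cut; exact: continuous_exp_system.
  transitivity (\sum_i l (fun t => c 0 i * cut a b (W i 0%N) t)).
    by apply: eq_bigr => i _; rewrite (bfunZ bl).
  rewrite -(bfun_sum bl) => [|i]; last exact: bounded_measurableZ.
  by congr l; apply/funext => t; rewrite /cut mulr_suml; apply: eq_bigr => i _; rewrite mulrA.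
have bc (c : 'rV[R]_(s.+1.*2.*2).+1) : bounded_measurable (cut a b (combination W c)).
  apply: bounded_measurable_cut => t; rewrite /combination /lin.
  apply: cvg_sum_ord => i; apply: cvgM; [exact: cvg_cst|exact: continuous_exp_system].
have := @gauss_quadrature R a b s.*2.+1 (alternating k) W _ _ _ _ _
  (fun i => l (cut a b (W i 0%N))) _ e _.
case.
- exact: (@exp_system_chain R k s.+1 setT).
- exact: (@exp_system_top R k s.+1).
- exact: (@exp_system_kernel R k s.+1).
- exact: (@exp_system_free R k s.+1).
- by move=> x _; exact: exp_system_ge0.
- move=> c cpos; rewrite lin_cut; apply: l0 => // t.
  rewrite /cut indicE; have [/set_mem /= tab|] := boolP (_ \in _); last by rewrite mulr0.
  by rewrite mulr1; apply: cpos; rewrite in_itv in tab.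
- by move=> x _; rewrite We.
move=> zs [w [szs zab mom m0]]; exists (zs, w); split=> // k0.
have E : W ord0 0%N = fun _ => 1 by apply/funext => t; exact: exp_system_ord0.
by move: m0; rewrite E.
Qed.

End quadrature.

(** * Assembling the quadratures into a signed measure *)

Section gauss_charge.
Variables (R : realType) (n : nat).
Local Notation X := (cylinder R n).

Definition frequency (k : 'rV[int]_n) : R := Num.sqrt (\sum_j (k 0 j)%:~R ^+ 2).

Lemma frequencyN k : frequency (- k) = frequency k.
Proof. by congr Num.sqrt; apply: eq_bigr => j _; rewrite mxE mulrNz sqrrN. Qed.

Lemma frequency_sqr k : frequency k ^+ 2 = \sum_j (k 0 j)%:~R ^+ 2.
Proof. by rewrite sqr_sqrtr// sumr_ge0// => j _; exact: sqr_ge0. Qed.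

Lemma frequency_neq0 k : k != 0 -> frequency k != 0.
Proof.
apply: contra_neq => k0; have : \sum_j (k 0 j)%:~R ^+ 2 = 0 :> R.
  by rewrite -frequency_sqr k0 expr0n.
move=> /psumr_eq0P => k0'; apply/rowP => j; rewrite mxE.
have /eqP := k0' (fun j _ => sqr_ge0 _) j isT.
by rewrite sqrf_eq0 intr_eq0 => /eqP.
Qed.

Variables (d : measure_display) (T : measurableType d) (P : probability T R).
Variable theta : T -> 'rV[R]_n.
Hypothesis mtheta : forall j, measurable_fun [set: T] (fun w => theta w 0 j).
Hypothesis theta_char : forall k,
  Rintegral P setT (fun w => cos (phase k (theta w))) = (k == 0)%:R /\
  Rintegral P setT (fun w => sin (phase k (theta w))) = 0.

Lemma synthesis_unique (I : (borel X -> R) -> R)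
    (l : 'rV[int]_n -> (R -> R) -> R) (c : 'rV[int]_n -> R) (C : R) :
  bounded_functional I ->
  (forall k, bounded_functional (l k)) ->
  (forall k g M, bounded_measurable g -> (forall t, `|g t| <= M) -> `|l k g| <= M * c k) ->
  (forall k, 0 <= c k) ->
  (forall s : seq 'rV[int]_n, uniq s -> \sum_(k <- s) c k <= C) ->
  (forall k, l (- k) = l k) ->
  (forall k h, continuous h -> compactly_supported h ->
    I (fun x => h x.1 * tcos k x.2) = l k h /\ I (fun x => h x.1 * tsin k x.2) = 0) ->
  forall f, bounded_measurable f -> I f = synthesis P theta l f.
Proof.
move=> bI bl lc c0 cC lN Ih f bf.
have [bS _] := synthesis_bounded_functional P mtheta bl lc c0 cC.
apply/eqP; rewrite -subr_eq0; apply/eqP.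
have := bfun_linear 1 (-1) bI bS.
move=> /fourier_unique - /(_ _ _ bf); rewrite mul1r mulN1r; apply => k h ch sh.
have bh := bounded_measurable_compactly_supported ch sh.
have [E1 E2] := Ih k h ch sh.
rewrite !mul1r !mulN1r E1 E2 (synthesis_cos (theta := theta) (P := P))//.
by rewrite (synthesis_sin (theta := theta) (P := P))// !subrr.
Qed.

Variables (a b : R) (s : nat) (mu : signed_measure R n).
Hypotheses (ab : a < b) (s0 : (0 < s)%N).
Hypothesis pmu : pseudo_positive a b mu.
Hypothesis hC : (\esum_(k in [set: 'rV[int]_n])
     (complex.Re (charge_Cintegral mu (slab a b)
            (fun x => character k x.2)))%:E < +oo)%E.

(* The quadrature is chosen as a function of [frequency k] and [component mu k]
   only, hence it is even in [k] and the resulting measure is real. *)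
Lemma exists_quadratures : exists q : 'rV[int]_n -> seq R * (R -> R),
  (forall k, exponential_moments a b (frequency k) s (component a b mu k) (q k)) /\
  forall k, q (- k) = q k.
Proof.
have [F FP] : {F : R * ((R -> R) -> R) -> seq R * (R -> R) &
    forall p, (exists q, exponential_moments a b p.1 s p.2 q) ->
      exponential_moments a b p.1 s p.2 (F p)}.
  apply: (@choice _ _ (fun p F => (exists q, exponential_moments a b p.1 s p.2 q) ->
    exponential_moments a b p.1 s p.2 F)) => p.
  have [[q qP]|nq] := pselect (exists q, exponential_moments a b p.1 s p.2 q).
    by exists q.
  by exists ([::], fun=> 0) => /nq.
exists (fun k => F (frequency k, component a b mu k)); split=> k.
  apply: (FP (_, _)); apply: exists_exponential_moments => //; first exact: bfun_component.
  by move=> f; exact: component_ge0.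
by rewrite frequencyN componentN.
Qed.

Lemma component_cut (nu : signed_measure R n) k g :
  component a b nu k (cut a b g) = component a b nu k g.
Proof. by apply: eq_slab_integral => x [+ _]; rewrite /= in_itv/= => /cutE ->. Qed.

Let c1 k := component a b mu k (fun _ => 1).

(** Parseval's identity for [mu]. It follows from uniqueness of functionals, so convergence of the
    Fourier series of [f] plays no part. *)
Lemma slab_integral_synthesis (f : borel X -> R) : bounded_measurable f ->
  charge_Rintegral mu (slab a b) f = synthesis P theta (component a b mu) f.
Proof.
have [C cC] := component_sum_bounded pmu hC.
apply: (synthesis_unique (c := c1) (C := C)) => //.
- exact: bfun_slab_integral.
- by move=> k; exact: bfun_component.
- move=> k g M bg gM; apply: positive_bfun_le => //; first exact: bfun_component.
  by move=> h; exact: component_ge0.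
- by move=> k; apply: component_ge0 => //; exact: bounded_measurable_cst.
- by move=> k; exact: componentN.
- by move=> k h ch sh; split=> //; exact: (sine_component_eq0 k pmu ch sh).
Qed.

(** The last clause applies Parseval's identity on both sides: equality of two integrals is reduced
    to one Fourier coefficient at a time. *)
Lemma exists_gauss_charge : exists (sigma : signed_measure R n)
    (q : 'rV[int]_n -> seq R * (R -> R)),
  [/\ forall k, exponential_moments a b (frequency k) s (component a b mu k) (q k),
      charge_support sigma `<=` slab a b,
      forall k g, bounded_measurable g -> component a b sigma k g = point_sum (q k) g,
      forall k g, bounded_measurable g -> sine_component a b sigma k g = 0 &
      forall f : borel X -> R, bounded_measurable f ->
        (forall k, component a b mu k (fourier_coef P theta k f) =
                   point_sum (q k) (fourier_coef P theta k f)) ->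
        charge_Rintegral mu (slab a b) f = charge_Rintegral sigma (slab a b) f].
Proof.
have [q [qP qN]] := exists_quadratures.
have [C cC] := component_sum_bounded pmu hC.
pose w k := point_sum (q k) (fun _ => 1).
have w0 k : 0 <= w k.
  have [_ qab _ _] := qP k; rewrite /w /point_sum big_seq sumr_ge0// => z zq.
  by rewrite mulr1; have [] := qab z zq.
have bq k : bounded_functional (point_sum (q k)) by exact: bfun_point_sum.
have qle k g M : bounded_measurable g -> (forall t, `|g t| <= M) ->
    `|point_sum (q k) g| <= M * w k.
  move=> bg gM; have [_ qab _ _] := qP k.
  rewrite /w /point_sum mulr_sumr; apply: le_trans (ler_norm_sum _ _ _) _.
  rewrite big_seq [leRHS]big_seq; apply: ler_sum => z /qab[_ qz].
  by rewrite normrM mulr1 ger0_norm// mulrC ler_wpM2r.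
(* For [k != 0] the mass is at most that of the component of [mu]; frequency 0 occurs at most once
   in [r] and is paid for by the extra term [w 0]. *)
have wC (r : seq 'rV[int]_n) : uniq r -> \sum_(k <- r) w k <= C + w 0.
  move=> ur; apply: (@le_trans _ _ (\sum_(k <- r) (c1 k + (k == 0)%:R * w 0))).
    apply: ler_sum => k _; have [->|k0] := eqVneq k 0.
      rewrite mul1r lerDr; apply: component_ge0 => //; exact: bounded_measurable_cst.
    rewrite mul0r addr0; have [_ _ _ H] := qP k.
    by rewrite /c1 -component_cut; apply: H; exact: frequency_neq0.
  rewrite big_split /= lerD ?cC// -mulr_suml ler_piMl// -natr_sum lern1.
  rewrite (_ : (\sum_(k <- r) (k == 0%R))%N = count_mem (0 : 'rV[int]_n) r).
    by rewrite count_uniq_mem// leq_b1.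
  by rewrite -sum1_count [RHS]big_mkcond; apply: eq_bigr => k _ /=; case: (k == 0).
have [bS cvS] := synthesis_bounded_functional P mtheta bq qle w0 wC.
have [sigma sigmaE] := bfun_charge bS.
(* All nodes lie in [[a, b]], where the indicator of a set off the slab is 0, and so are its Fourier
   coefficients. *)
have ssi : charge_support sigma `<=` slab a b.
  apply: charge_support_sub => A mA AS; rewrite -charge_Rintegral_indic//.
  rewrite sigmaE; last exact: bounded_measurable_indic.
  rewrite /synthesis (_ : series _ = fun=> 0); first by rewrite lim_cst.
  apply/funext => N; rewrite /series/= big1// => e _; rewrite /synthesis_term.
  case: (@pickle_inv 'rV[int]_n e) => [k|//].
  rewrite /point_sum big_seq big1// => z zq; have [_ qab _ _] := qP k.
  rewrite (_ : fourier_coef _ _ _ _ _ = 0) ?mulr0// /fourier_coef.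
  rewrite (_ : (fun _ => _) = fun=> 0); first exact: (bfun0 (bfun_Rintegral (probability_lty P))).
  apply/funext => om; rewrite indicE memNset ?mul0r// => /AS; apply.
  by split=> //=; rewrite in_itv/=; have [] := qab z zq.
exists sigma, q; split=> // [k g bg|k g bg|f bf fq].
- rewrite /component slab_integral_setT//; last first.
    by apply: bounded_measurableM; [exact: bounded_measurable_comp_fst|exact: bounded_measurable_tcos].
  rewrite sigmaE; last first.
    by apply: bounded_measurableM; [exact: bounded_measurable_comp_fst|exact: bounded_measurable_tcos].
  rewrite (synthesis_cos (theta := theta) (P := P))// => m.
  by rewrite qN.
- rewrite /sine_component slab_integral_setT//; last first.
    by apply: bounded_measurableM; [exact: bounded_measurable_comp_fst|exact: bounded_measurable_tsin].
  rewrite sigmaE; last first.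
    by apply: bounded_measurableM; [exact: bounded_measurable_comp_fst|exact: bounded_measurable_tsin].
  by rewrite (synthesis_sin (theta := theta) (P := P)).
- rewrite slab_integral_synthesis// slab_integral_setT// sigmaE//.
  rewrite /synthesis; congr (limn (series _)); apply/funext => e; rewrite /synthesis_term.
  by case: (@pickle_inv 'rV[int]_n e) => [k|//]; exact: fq.
Qed.

End gauss_charge.

(** * Fourier coefficients of polyharmonic functions *)

Section cont_diff.
Variables (R : realType) (n : nat).
Local Notation V := (R * 'rV[R]_n)%type.
Implicit Types (u v : V -> R) (O : set V) (i : option 'I_n).

Lemma near_open_eq O u v x : open O -> {in O, u =1 v} -> O x -> \forall z \near x, u z = v z.
Proof.
move=> oO uv Ox; have : nbhs x O by exact: open_nbhs_nbhs.
by apply: filterS => z Oz; apply: uv; rewrite inE.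
Qed.

Lemma continuous_near_eq u v x : (\forall z \near x, u z = v z) ->
  {for x, continuous u} -> {for x, continuous v}.
Proof.
move=> uv cu; have e : u x = v x by exact: nbhs_singleton uv.
rewrite /prop_for /continuous_at -e; apply: cvg_trans cu.
by apply: near_eq_cvg; exact: uv.
Qed.

Lemma cont_diff_on_eq m O u v : open O -> {in O, u =1 v} -> cont_diff_on m O u ->
  cont_diff_on m O v.
Proof.
move=> oO; elim: m u v => [|m IH] u v uv /= [cu du]; split=> //.
- by move=> x Ox; exact: (continuous_near_eq (near_open_eq oO uv Ox) (cu x Ox)).
- by move=> x Ox; exact: (continuous_near_eq (near_open_eq oO uv Ox) (cu x Ox)).
- move=> i; have [di ci] := du i; split.
    by move=> x Ox; apply: near_eq_derivable (di x Ox); exact: (near_open_eq oO uv Ox).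
  apply: IH ci => x /set_mem Ox.
  by apply: near_eq_derive; exact: (near_open_eq oO uv Ox).
Qed.

Lemma cont_diff_onW m O u : cont_diff_on m.+1 O u -> cont_diff_on m O u.
Proof.
elim: m u => [|m IH] u /= [cu du]; split=> // i.
by have [di ci] := du i; split=> //; exact: IH.
Qed.

Lemma cont_diff_onD m O u v : open O -> cont_diff_on m O u -> cont_diff_on m O v ->
  cont_diff_on m O (fun x => u x + v x).
Proof.
move=> oO; elim: m u v => [|m IH] u v /= [cu du] [cv dv]; split=> //.
- by move=> x Ox; apply: cvgD; [exact: cu|exact: cv].
- by move=> x Ox; apply: cvgD; [exact: cu|exact: cv].
- move=> i; have [diu ciu] := du i; have [div civ] := dv i; split=> [x Ox|].
    by apply: derivableD; [exact: diu|exact: div].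
  apply: cont_diff_on_eq (IH _ _ ciu civ) => // x /set_mem Ox.
  by rewrite /partial -deriveD//; [exact: diu|exact: div].
Qed.

Lemma cont_diff_on_cst m O (c : R) : cont_diff_on m O (fun _ => c).
Proof.
elim: m c => [|m IH] c /=; split=> //; try by move=> x _; exact: cvg_cst.
move=> i; split=> [x _|]; first exact: derivable_cst.
rewrite (_ : partial i _ = fun=> 0)//; apply/funext => x.
by rewrite /partial derive_cst.
Qed.

Lemma cont_diff_on_laplacian m O u : open O -> cont_diff_on m.+2 O u ->
  cont_diff_on m O (laplacian u).
Proof.
move=> oO [_ du]; rewrite /laplacian; elim: index_enum => [|i r IH].
  under eq_fun do rewrite big_nil.
  exact: cont_diff_on_cst.
under eq_fun do rewrite big_cons.
apply: cont_diff_onD => //.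
by have [_ [_ ddu]] := du i; have [] := ddu i.
Qed.

Lemma cont_diff_on_iter_laplacian p m O u : open O -> cont_diff_on (m.*2 + p) O u ->
  cont_diff_on p O (iter m (@laplacian R n) u).
Proof.
move=> oO; elim: m p u => [|m IH] p u cu //=.
by apply: cont_diff_on_laplacian => //; apply: IH; rewrite addnS addnS -addSn -addSn -doubleS.
Qed.

Definition torus_periodic (T : Type) (v : V -> T) :=
  forall t, lattice_periodic (fun y => v (t, y)).

Lemma torus_periodic_partial i v : torus_periodic v -> torus_periodic (partial i v).
Proof.
move=> pv t y m; rewrite /partial /derive /=.
suff -> : (fun h : R => h^-1 *: (v (h *: coord_vec R i + (t, y + lattice_shift R m)) -
    v (t, y + lattice_shift R m))) =
  (fun h : R => h^-1 *: (v (h *: coord_vec R i + (t, y)) - v (t, y))) by [].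
apply/funext => h; rewrite (pv t y m); congr (_ *: (_ - _)).
have := pv (h * (coord_vec R i).1 + t) (h *: (coord_vec R i).2 + y) m.
by rewrite /= -addrA.
Qed.

Lemma torus_periodic_laplacian v : torus_periodic v -> torus_periodic (laplacian v).
Proof.
by move=> pv t y m; apply: eq_bigr => i _; do 2!apply: torus_periodic_partial.
Qed.

Lemma torus_periodic_iter_laplacian m v : torus_periodic v ->
  torus_periodic (iter m (@laplacian R n) v).
Proof. by move=> pv; elim: m => [//|m IH]; rewrite iterS; apply: torus_periodic_laplacian. Qed.

Lemma is_derive_line v i (x : V) (s : R) : derivable v (x + s *: coord_vec R i) (coord_vec R i) ->
  is_derive s 1 (fun s' => v (x + s' *: coord_vec R i)) (partial i v (x + s *: coord_vec R i)).
Proof.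
move=> dv; have E : (fun h => h^-1 *: (v (x + (h *: 1 + s) *: coord_vec R i) - v (x + s *: coord_vec R i))) =
    (fun h : R => h^-1 *: (v (h *: coord_vec R i + (x + s *: coord_vec R i)) - v (x + s *: coord_vec R i))).
  apply/funext => h; congr (_ *: (v _ - _)).
  by rewrite [h *: 1]mulr1 scalerDl addrCA.
by split; [rewrite /derivable E|rewrite /derive E].
Qed.

Lemma compact_torus : compact [set: torus R n].
Proof.
pose B := [set y : 'rV[R]_n | forall j, (`[0, 2 * pi]%classic : set R) (y ord0 j)].
rewrite (_ : setT = @torus_proj R n @` B).
  apply: continuous_compact; first by apply: continuous_subspaceT; exact: torus_proj_continuous.
  apply: (@rV_compact R n (fun=> `[0, 2 * pi]%classic)) => j; exact: segment_compact.
apply/seteqP; split=> // z _; have p0 : (0 : R) < 2 * pi by rewrite mulr_gt0 ?pi_gt0.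
pose y := torus_repr z; pose m := \row_j Num.floor (y 0 j / (2 * pi)).
exists (y - lattice_shift R m); last first.
  rewrite -[RHS]torus_reprK; apply/torus_projP; exists (- m).
  by apply/rowP => j; rewrite !mxE mulrNz mulrN.
move=> j; rewrite /= in_itv/=.
have -> : (y - lattice_shift R m) ord0 j = y 0 j - 2 * pi * (Num.floor (y 0 j / (2 * pi)))%:~R.
  by rewrite mxE; congr (_ + _); rewrite !mxE.
have /andP[f1 f2] := floor_itv (y 0 j / (2 * pi)).
rewrite ler_pdivlMr// in f1; rewrite ltr_pdivrMr// rmorphD/= mulrDl mul1r in f2.
by apply/andP; split; lra.
Qed.

Lemma compact_slab (a b : R) : compact (slab a b : set (cylinder R n)).
Proof. by apply: compact_setX; [exact: segment_compact|exact: compact_torus]. Qed.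

Lemma slab_bounded (a b : R) (g : cylinder R n -> R) : {within slab a b, continuous g} ->
  exists M, forall x, slab a b x -> `|g x| <= M.
Proof.
move=> cg; have /compact_bounded[M [_ gM]] := continuous_compact cg (compact_slab (a:=a) (b:=b)).
by exists (M + 1) => x sx; apply: (gM (M + 1)); [rewrite ltrDl|exists x].
Qed.

Definition descent (v : V -> R) (x : cylinder R n) : R := v (x.1, torus_repr x.2).

Lemma descent_proj v t y : torus_periodic v -> descent v (t, torus_proj y) = v (t, y).
Proof. by move=> pv; rewrite /descent /= (periodic_torus_repr y (pv t)). Qed.

(** Descending to the compact torus gives a bound uniform in [y]; it dominates the derivative under
    the expectation. *)
Lemma periodic_bounded v (c d : R) : torus_periodic v ->
  (forall t y, c <= t <= d -> {for (t, y), continuous v}) ->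
  exists M, forall t y, c <= t <= d -> `|v (t, y)| <= M.
Proof.
move=> pv cv; have [|M vM] := @slab_bounded c d (descent v).
  apply: continuous_in_subspaceT => -[t z] /set_mem[/=]; rewrite in_itv/= => tcd _.
  by apply: (@descent_continuous R n _ v t z pv); exact: cv.
exists M => t y tcd; rewrite -descent_proj//; apply: vM.
by split=> //=; rewrite in_itv.
Qed.

End cont_diff.

Lemma phaseDr (R : realType) n (k : 'rV[int]_n) (y z : 'rV[R]_n) :
  phase k (y + z) = phase k y + phase k z.
Proof. by rewrite /phase -big_split; apply: eq_bigr => j _ /=; rewrite mxE mulrDr. Qed.

Lemma phaseZ (R : realType) n (k : 'rV[int]_n) (c : R) (y : 'rV[R]_n) :
  phase k (c *: y) = c * phase k y.
Proof. by rewrite /phase mulr_sumr; apply: eq_bigr => j _ /=; rewrite mxE mulrCA. Qed.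

Lemma phase_deltar (R : realType) n (k : 'rV[int]_n) j :
  phase k (delta_mx 0 j : 'rV[R]_n) = (k 0 j)%:~R.
Proof.
rewrite /phase (bigD1 j)//= mxE !eqxx mulr1 big1 ?addr0// => i /negbTE ij.
by rewrite mxE ij andbF mulr0.
Qed.

Section fourier_derivatives.
Variables (R : realType) (n : nat).
Local Notation X := (cylinder R n).
Local Notation V := (R * 'rV[R]_n)%type.
Variables (d : measure_display) (T : measurableType d) (P : probability T R).

Definition is_uniform_sample (theta : T -> 'rV[R]_n) : Prop :=
  (forall j, measurable_fun [set: T] (fun w => theta w 0 j)) /\
  forall k, Rintegral P setT (fun w => cos (phase k (theta w))) = (k == 0)%:R /\
    Rintegral P setT (fun w => sin (phase k (theta w))) = 0.

Variable theta : T -> 'rV[R]_n.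
Hypothesis thetaP : is_uniform_sample theta.

Let bP : bounded_functional (Rintegral P setT).
Proof. exact: bfun_Rintegral (probability_lty P). Qed.

(** A translation rotates the pair of integrals of frequency [k] by the angle [phase k y]. For
    [k != 0] the pair is 0, for [k = 0] the angle is 0. *)
Lemma is_uniform_sampleD (y : 'rV[R]_n) : is_uniform_sample (fun w => theta w + y).
Proof.
have [mt tc] := thetaP; split=> [j|k].
  rewrite (_ : (fun _ => _) = (fun w => theta w 0 j + y 0 j)).
    by apply: measurable_funD => //; exact: measurable_cst.
  by apply/funext => w; rewrite mxE.
have bc := bounded_measurable_cos_theta mt k; have bs := bounded_measurable_sin_theta mt k.
have [Ec Es] := tc k; split.
- transitivity (cos (phase k y) * (k == 0)%:R + - sin (phase k y) * 0).
    rewrite -Ec -Es -!(bfunZ bP)// -(bfunD bP); [|exact: bounded_measurableZ..].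
    congr (Rintegral _ _ _); apply/funext => w.
    by rewrite [phase k (theta w + y)]phaseDr cosD; ring.
  rewrite mulr0 addr0; case: eqP => [->|]; last by rewrite mulr0.
  by rewrite phase0 cos0 mul1r.
- transitivity (sin (phase k y) * (k == 0)%:R + cos (phase k y) * 0).
    rewrite -Ec -Es -!(bfunZ bP)// -(bfunD bP); [|exact: bounded_measurableZ..].
    congr (Rintegral _ _ _); apply/funext => w.
    by rewrite [phase k (theta w + y)]phaseDr sinD; ring.
  rewrite mulr0 addr0; case: eqP => [->|]; last by rewrite mulr0.
  by rewrite phase0 sin0 mul0r.
Qed.

Lemma bounded_measurable_descent (F : 'rV[R]_n -> R) : lattice_periodic F -> continuous F ->
  bounded_measurable (fun x : borel X => F (torus_repr x.2)).
Proof.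
move=> pF cF; pose v (x : V) := F x.2.
have cv x : {for x, continuous v} by apply: continuous_comp; [exact: cvg_snd|exact: cF].
have pv : torus_periodic v by move=> t y m; exact: pF.
have [M vM] := @periodic_bounded R n v 0 0 pv (fun t y _ => cv _).
apply: (@bounded_measurable_continuous _ _ (fun x : cylinder R n => F (torus_repr x.2)) M).
  by move=> -[t z]; apply: (@descent_continuous R n _ v t z pv); exact: cv.
by move=> [t z]; have := vM 0 (torus_repr z); rewrite lexx; apply.
Qed.

End fourier_derivatives.

Section translation.
Variables (R : realType) (n : nat).
Local Notation X := (cylinder R n).
Local Notation V := (R * 'rV[R]_n)%type.
Variables (d : measure_display) (T : measurableType d) (P : probability T R).
Variable theta : T -> 'rV[R]_n.
Hypothesis thetaP : is_uniform_sample P theta.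

Let bP : bounded_functional (Rintegral P setT).
Proof. exact: bfun_Rintegral (probability_lty P). Qed.

Lemma bounded_measurable_sample (F : 'rV[R]_n -> R) : lattice_periodic F -> continuous F ->
  bounded_measurable (fun w => F (theta w)).
Proof.
move=> pF cF; have := bounded_measurable_slice_cos thetaP.1 0 0 (bounded_measurable_descent pF cF).
rewrite (_ : (fun w => _) = fun w => F (theta w))//.
by apply/funext => w; rewrite /= (periodic_torus_repr _ pF) phase0 cos0 mulr1.
Qed.

Lemma fourier_coef_descent (F : 'rV[R]_n -> R) t : lattice_periodic F ->
  fourier_coef P theta 0 (fun x => F (torus_repr x.2)) t =
  Rintegral P setT (fun w => F (theta w)).
Proof.
move=> pF; congr (Rintegral _ _ _); apply/funext => w.
by rewrite /= (periodic_torus_repr _ pF) phase0 cos0 mulr1.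
Qed.

End translation.

Section sample_derivatives.
Variables (R : realType) (n : nat).
Local Notation X := (cylinder R n).
Local Notation V := (R * 'rV[R]_n)%type.
Variables (d : measure_display) (T : measurableType d) (P : probability T R).
Variable theta : T -> 'rV[R]_n.
Hypothesis thetaP : is_uniform_sample P theta.

Let bP : bounded_functional (Rintegral P setT).
Proof. exact: bfun_Rintegral (probability_lty P). Qed.

(* Both sides integrate the same characters to the same values. *)
Lemma expectation_translate (F : 'rV[R]_n -> R) (y : 'rV[R]_n) :
  lattice_periodic F -> continuous F ->
  Rintegral P setT (fun w => F (theta w + y)) = Rintegral P setT (fun w => F (theta w)).
Proof.
move=> pF cF; have thetaP' := is_uniform_sampleD thetaP y.
(* Evaluation at time 0, with frequency 0, presents an expectation of a function of [y] alone as a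
   functional on the cylinder, where [fourier_unique] applies. *)
pose ev (g : R -> R) := g 0.
have bev : bounded_functional ev by split=> // f g M _ _ _; apply.
have b1 := bfun_fourier_coef P thetaP.1 0 bev.
have b2 := bfun_fourier_coef P thetaP'.1 0 bev.
rewrite -(fourier_coef_descent P theta 0 pF).
rewrite -(fourier_coef_descent P (fun w => theta w + y) 0 pF).
apply/eqP; rewrite -subr_eq0; apply/eqP.
have := bfun_linear 1 (-1) b2 b1.
move=> /fourier_unique - /(_ _ _ (bounded_measurable_descent pF cF)).
rewrite /ev mul1r mulN1r; apply => k h ch sh.
rewrite (fourier_coef_cos thetaP.1 thetaP.2) (fourier_coef_cos thetaP'.1 thetaP'.2).
rewrite (fourier_coef_sin thetaP.1 thetaP.2) (fourier_coef_sin thetaP'.1 thetaP'.2).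
by rewrite !mul1r !mulN1r !subrr.
Qed.

Lemma continuous_slice (v : V -> R) (t : R) (y0 : 'rV[R]_n) : (forall y : 'rV[R]_n, {for (t, y), continuous v}) ->
  continuous (fun y : 'rV[R]_n => v (t, y + y0)).
Proof.
move=> cv y; apply: (@continuous_comp _ _ _ (fun y : 'rV[R]_n => (t, y + y0)) v); last exact: cv.
have c1 : (fun=> t) @ nbhs y --> nbhs t by exact: cvg_cst.
have c2 : (fun y : 'rV[R]_n => y + y0) @ nbhs y --> nbhs (y + y0).
  by apply: cvgD; [exact: cvg_id|exact: cvg_cst].
exact: (cvg_pair c1 c2).
Qed.

Lemma periodic_slice (v : V -> R) (t : R) (y0 : 'rV[R]_n) : torus_periodic v ->
  lattice_periodic (fun y : 'rV[R]_n => v (t, y + y0)).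
Proof. by move=> pv y m; rewrite addrAC pv. Qed.

Lemma is_derive_expectation (a b : R) (v : V -> R) i (c : T -> R) (t s : R) :
  torus_periodic v ->
  (forall x, (`]a, b[ `*` setT) x -> {for x, continuous v}) ->
  (forall x, (`]a, b[ `*` setT) x -> derivable v x (coord_vec R i)) ->
  (forall x, (`]a, b[ `*` setT) x -> {for x, continuous (partial i v)}) ->
  bounded_measurable c -> a < t + s * (coord_vec R i).1 < b ->
  is_derive s 1 (fun s' => Rintegral P setT (fun w => v ((t, theta w) + s' *: coord_vec R i) * c w))
    (Rintegral P setT (fun w => partial i v ((t, theta w) + s *: coord_vec R i) * c w)).
Proof.
move=> pv cv dv cdv bc pab; set p := t + _ in pab; set e := coord_vec R i.
have ppv := torus_periodic_partial i pv.
(* Half the distance to the ends keeps the time in a compact part of []a, b[]; its speed [e.1] is 0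
   or 1. *)
pose del := Num.min (p - a) (b - p) / 2.
have [del0 adel bdel] : [/\ 0 < del, a < p - del & p + del < b].
  have h0 : 0 < Num.min (p - a) (b - p).
    by case/andP: pab => ? ?; rewrite lt_min !subr_gt0; apply/andP.
  have h1 : Num.min (p - a) (b - p) <= p - a by rewrite ge_min lexx.
  have h2 : Num.min (p - a) (b - p) <= b - p by rewrite ge_min lexx orbT.
  by split; rewrite /del; lra.
have e01 : 0 <= e.1 <= 1 by rewrite /e; case: (i) => [j|] /=; rewrite ?lexx ?ler01.
have I1 s' : s' \in `]s - del, s + del[ -> p - del <= t + s' * e.1 <= p + del.
  rewrite in_itv/= => /andP[s1 s2]; rewrite /p -/e; case/andP: e01 => e0 e1.
  by apply/andP; split; nra.
have IO s' y : s' \in `]s - del, s + del[ -> (`]a, b[ `*` setT) (t + s' * e.1, y : 'rV[R]_n).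
  by move=> /I1/andP[s1 s2]; split=> //=; rewrite in_itv/=; apply/andP; split; lra.
have Is : s \in `]s - del, s + del[ by rewrite in_itv/=; apply/andP; split; lra.
have bm (u : V -> R) s' : torus_periodic u ->
    (forall x, (`]a, b[ `*` setT) x -> {for x, continuous u}) ->
    s' \in `]s - del, s + del[ -> bounded_measurable (fun w => u ((t, theta w) + s' *: e) * c w).
  move=> pu cu Is'; apply: bounded_measurableM => //.
  apply: (bounded_measurable_sample thetaP (F := fun y => u (t + s' * e.1, y + s' *: e.2))).
    exact: periodic_slice.
  by apply: continuous_slice => y; apply: cu; exact: IO.
have cdv' (t' : R) (y : 'rV[R]_n) : p - del <= t' <= p + del -> {for (t', y), continuous (partial i v)}.
  by move=> /andP[t1 t2]; apply: cdv; split=> //=; rewrite in_itv/=; apply/andP; split; lra.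
have [M vM] := @periodic_bounded R n (partial i v) (p - del) (p + del) ppv cdv'.
have [_ [K cK]] := bc.
have M0 : 0 <= M by rewrite (le_trans _ (vM p 0 _))//; apply/andP; split; lra.
have int (g : T -> R) : bounded_measurable g -> P.-integrable setT (EFin \o g).
  by move=> bg; apply: bounded_measurable_integrable => //; exact: probability_lty.
pose f (s' : R) (w : T) := v ((t, theta w) + s' *: e) * c w.
have df s' w : s' \in `]s - del, s + del[ ->
    is_derive s' 1 (f^~ w) (partial i v ((t, theta w) + s' *: e) * c w).
  move=> Is'; have dl : derivable v ((t, theta w) + s' *: e) e by apply: dv; exact: IO.
  have dl' := is_derive_line dl.
  rewrite (_ : f^~ w = c w *: (fun s' : R => v ((t, theta w) + s' *: e))); last first.
    by apply/funext => s'' /=; rewrite /f mulrC.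
  by rewrite mulrC; exact: (is_deriveZ (c w) dl').
have d1f s' w : s' \in `]s - del, s + del[ ->
    (partial1of2 f) s' w = partial i v ((t, theta w) + s' *: e) * c w.
  by move=> Is'; rewrite partial1of2E; have [_ ->] := df s' w Is'.
have H1 : forall x, (`]s - del, s + del[%classic : set R) x -> P.-integrable setT (EFin \o f x).
  by move=> x Ix; apply: int; exact: bm.
have H2 : forall x y, (`]s - del, s + del[%classic : set R) x -> setT y -> derivable (f ^~ y) x 1.
  by move=> x y Ix _; have [] := df x y Ix.
have H3 : P.-integrable setT (EFin \o (fun _ : T => M * K)).
  by apply: int; exact: bounded_measurable_cst.
have K0 (y : T) : 0 <= M * K by rewrite mulr_ge0// (le_trans _ (cK y)).
have H4 : forall x y, (`]s - del, s + del[%classic : set R) x -> setT y -> `|(partial1of2 f) x y| <= M * K.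
  move=> x y Ix _; rewrite d1f// normrM ler_pM//.
  by apply: (vM (t + x * e.1) (theta y + x *: e.2)); exact: I1.
have D1 := @derivable_under_integral R d T P f setT measurableT s (s - del) (s + del) Is H1 H2
  (fun=> M * K) K0 H3 H4.
have D2 := @differentiation_under_integral R d T P f setT measurableT s (s - del) (s + del) Is H1 H2
  (fun=> M * K) K0 H3 H4.
split; first exact: D1.
rewrite -derive1E D2; congr (Rintegral _ _ _); apply/funext => w; exact: d1f.
Qed.

End sample_derivatives.

Lemma sum_option (R : realType) n (F : option 'I_n -> R) :
  \sum_i F i = F None + \sum_j F (Some j).
Proof.
rewrite (bigD1 None)//=; congr (_ + _).
rewrite (reindex_omap Some id) => [|[i|]]//=.
by apply: eq_bigl => i; rewrite eqxx.
Qed.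

Lemma cvg_within_comp (S T U : topologicalType) (A : set T) (g : T -> U) (F : set_system S)
    (h : S -> T) (x : T) : Filter F -> {within A, continuous g} -> A x ->
  (forall y, A (h y)) -> h @ F --> x -> g \o h @ F --> g x.
Proof.
move=> FF /subspace_continuousP cg Ax Ah hx; apply: cvg_trans (cg x Ax).
move=> N gN; have H : F (h @^-1` [set y | A y -> N (g y)]) by exact: hx.
suff : F ((g \o h) @^-1` N) by [].
by apply: filterS H => y; apply; exact: Ah.
Qed.

Lemma continuous_slice0 (R : realType) n (v : R * 'rV[R]_n -> R) (t : R) :
  (forall y : 'rV[R]_n, {for (t, y), continuous v}) -> continuous (fun y : 'rV[R]_n => v (t, y)).
Proof.
move=> cv; have := continuous_slice (y0 := 0) cv.
by under eq_fun do rewrite addr0.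
Qed.

(** * The Laplacian on Fourier coefficients *)

Section polyharmonic.
Variables (R : realType) (n : nat).
Local Notation X := (cylinder R n).
Local Notation V := (R * 'rV[R]_n)%type.
Variables (d : measure_display) (T : measurableType d) (P : probability T R).
Variable theta : T -> 'rV[R]_n.
Hypothesis thetaP : is_uniform_sample P theta.
Variables (a b : R) (k : 'rV[int]_n).
Local Notation O := ((`]a, b[%classic : set R) `*` (setT : set 'rV[R]_n)).
Local Notation expect := (Rintegral P setT).

Let bP : bounded_functional expect.
Proof. exact: bfun_Rintegral (probability_lty P). Qed.

Let inO t (y : 'rV[R]_n) : a < t < b -> O (t, y).
Proof. by move=> tab; split=> //=; rewrite in_itv. Qed.

Let openO : open O.
Proof.
rewrite (_ : O = fst @^-1` `]a, b[); last by apply/seteqP; split=> x /= => [[]|].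
by apply: open_comp; [move=> x _; exact: cvg_fst|exact: interval_open].
Qed.

Let bcos := bounded_measurable_cos_theta thetaP.1 k.
Let bsin := bounded_measurable_sin_theta thetaP.1 k.

Definition sample_coef (c : R -> R) (v : V -> R) (t : R) : R :=
  expect (fun w => v (t, theta w) * c (phase k (theta w))).

Lemma bounded_measurable_slice_sample (v : V -> R) t (c : T -> R) : torus_periodic v ->
  (forall y : 'rV[R]_n, {for (t, y), continuous v}) -> bounded_measurable c ->
  bounded_measurable (fun w => v (t, theta w) * c w).
Proof.
move=> pv cv bc; apply: bounded_measurableM => //.
apply: (bounded_measurable_sample thetaP (F := fun y => v (t, y))); first exact: pv.
exact: continuous_slice0.
Qed.

Lemma time_derivative (v : V -> R) t : torus_periodic v -> cont_diff_on 1 O v -> a < t < b ->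
  is_derive t 1 (sample_coef cos v) (sample_coef cos (partial None v) t).
Proof.
move=> pv [cv dv] tab; have [d0 [cd0 _]] := dv None.
have tab' : a < 0 + t * (coord_vec R (None : option 'I_n)).1 < b by rewrite add0r mulr1.
have := is_derive_expectation thetaP pv cv d0 cd0 bcos tab'.
have E s w : (0, theta w) + s *: coord_vec R (None : option 'I_n) = (s, theta w) :> V.
  by congr (_, _); rewrite /= ?add0r ?scaler0 ?addr0// /GRing.scale/= mulr1.
have E1 (u : V -> R) : (fun s => expect (fun w => u ((0, theta w) +
    s *: coord_vec R (None : option 'I_n)) * cos (phase k (theta w)))) = sample_coef cos u.
  by apply/funext => s; congr (Rintegral _ _ _); apply/funext => w; rewrite E.
by rewrite (E1 v) (congr1 (@^~ t) (E1 (partial None v))).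
Qed.

(* Integration by parts: differentiate at [s = 0] the translation-invariant
   expectation of [v (t, theta + s e_j) c (<k, theta>)]. *)
Lemma space_derivative (v : V -> R) t j (c c' : R -> R) : torus_periodic v ->
  cont_diff_on 1 O v -> a < t < b ->
  continuous c -> lattice_periodic (fun y : 'rV[R]_n => c (phase k y)) ->
  (forall x y, c (x - y) = cos y * c x + sin y * c' x) ->
  bounded_measurable (fun w => c (phase k (theta w))) ->
  bounded_measurable (fun w => c' (phase k (theta w))) ->
  sample_coef c (partial (Some j) v) t = (k 0 j)%:~R * sample_coef c' v t.
Proof.
move=> pv [cv dv] tab cc pc cB bc bc'; have [d0 [cd0 _]] := dv (Some j).
have tab' : a < t + 0 * (coord_vec R (Some j : option 'I_n)).1 < b by rewrite mulr0 addr0.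
have D1 := is_derive_expectation thetaP pv cv d0 cd0 bc tab'.
have cvt y : {for (t, y), continuous v} by apply: cv; exact: inO.
pose A := sample_coef c v t; pose B := sample_coef c' v t; pose kj : R := (k 0 j)%:~R.
have E : (fun s : R => expect (fun w => v ((t, theta w) + s *: coord_vec R (Some j)) *
    c (phase k (theta w)))) = (fun s => cos (s * kj) * A + sin (s * kj) * B).
  apply/funext => s; pose z : 'rV[R]_n := s *: delta_mx 0 j.
  have kz : phase k z = s * kj by rewrite phaseZ phase_deltar.
  pose F y := v (t, y) * c (phase k y - s * kj).
  transitivity (expect (fun w => F (theta w + z))).
    congr (Rintegral _ _ _); apply/funext => w; rewrite /F phaseDr kz addrK.
    by congr (v (_, _) * _) => /=; rewrite scaler0 addr0.
  have cph : continuous (fun y : 'rV[R]_n => c (phase k y - s * kj)).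
    move=> y; apply: (@continuous_comp _ _ _ (fun y => phase k y - s * kj) c); last exact: cc.
    have cp : phase k x @[x --> y] --> (phase k y : R) by exact: continuous_phase.
    exact: (cvgB cp (cvg_cst _)).
  rewrite (expectation_translate thetaP).
  - have bA := bounded_measurable_slice_sample pv cvt bc.
    have bB := bounded_measurable_slice_sample pv cvt bc'.
    rewrite /A /B /sample_coef -(bfunZ bP _ bA) -(bfunZ bP _ bB) -(bfunD bP).
    + by congr (Rintegral _ _ _); apply/funext => w; rewrite /F cB; ring.
    + exact: bounded_measurableZ.
    + exact: bounded_measurableZ.
  - move=> y m; rewrite /F pv; congr (_ * _).
    have := pc (y - z) m; rewrite /= addrAC !phaseDr.
    by rewrite -scaleN1r phaseZ kz mulN1r.
  - move=> y; have cvy : v (t, x) @[x --> y] --> v (t, y) by exact: continuous_slice0.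
    exact: (cvgM cvy (cph y)).
rewrite E in D1.
have D2 : is_derive (0 : R) 1 (fun s => cos (s * kj) * A + sin (s * kj) * B) (kj * B).
  by clear D1; apply: is_derive_eq; rewrite mul0r sin0 cos0 /GRing.scale/=; ring.
have [_ E1] := D1; have [_ E2] := D2; rewrite -E2 E1.
congr (Rintegral _ _ _); apply/funext => w; congr (partial _ _ _ * _).
by congr (_, _) => /=; rewrite scale0r addr0.
Qed.

Lemma cont_diff_on_le p q (v : V -> R) : (p <= q)%N -> cont_diff_on q O v -> cont_diff_on p O v.
Proof.
move=> /subnK <-; elim: (q - p)%N => [//|m IH] cv.
by apply: IH; apply: cont_diff_onW.
Qed.

(** Two integrations by parts in each [y_j] turn cosine into sine and then into minus cosine, each
    with a factor [k_j]. *)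
Lemma laplacian_coef (v : V -> R) t : torus_periodic v -> cont_diff_on 2 O v -> a < t < b ->
  sample_coef cos (laplacian v) t =
  sample_coef cos (partial None (partial None v)) t - frequency R k ^+ 2 * sample_coef cos v t.
Proof.
move=> pv cv tab; have [_ dv] := cv.
have cv1 : cont_diff_on 1 O v by exact: cont_diff_on_le cv.
have bd i : bounded_measurable (fun w => partial i (partial i v) (t, theta w) * cos (phase k (theta w))).
  have pii : torus_periodic (partial i (partial i v)) by do 2!apply: torus_periodic_partial.
  apply: (bounded_measurable_slice_sample pii _ bcos) => y.
  have [_ [_ ddv]] := dv i; have [_ c0] := ddv i.
  by case: c0 => c0 _; apply: c0; exact: inO.
rewrite /sample_coef.
rewrite (_ : (fun w => laplacian v (t, theta w) * _) =
  fun w => partial None (partial None v) (t, theta w) * cos (phase k (theta w)) +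
    \sum_j partial (Some j) (partial (Some j) v) (t, theta w) * cos (phase k (theta w))); last first.
  by apply/funext => w; rewrite /laplacian sum_option mulrDl mulr_suml.
rewrite (bfunD bP)//; last exact: bounded_measurable_sum.
rewrite (bfun_sum bP)//; congr (_ + _).
rewrite frequency_sqr mulr_suml -sumrN; apply: eq_bigr => j _.
have [_ cj] := dv (Some j).
have pj := torus_periodic_partial (Some j) pv.
have cos_sub (x y : R) : cos (x - y) = cos y * cos x + sin y * sin x by rewrite cosB; ring.
have sin_sub (x y : R) : sin (x - y) = cos y * sin x + sin y * - cos x by rewrite sinB; ring.
have bcosN : bounded_measurable (fun w => - cos (phase k (theta w))).
  rewrite (_ : (fun w => _) = fun w => -1 * cos (phase k (theta w))).
    exact: bounded_measurableZ.
  by apply/funext => w; rewrite mulN1r.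
have E1 := @space_derivative (partial (Some j) v) t j cos sin pj cj tab
  (@continuous_cos R) (@cos_phase_periodic R n k) cos_sub bcos bsin.
have E2 := @space_derivative v t j sin (fun x => - cos x) pv cv1 tab
  (@continuous_sin R) (@sin_phase_periodic R n k) sin_sub bsin bcosN.
rewrite [LHS]E1 E2 mulrA -expr2 -mulrN; congr (_ * _); rewrite /sample_coef -mulN1r -(bfunZ bP).
  by congr (Rintegral _ _ _); apply/funext => w; ring.
apply: (bounded_measurable_slice_sample pv _ bcos) => y.
by case: cv => c0 _; apply: c0; exact: inO.
Qed.

(* Even entries are the Fourier coefficients of the iterated laplacians of [u],
   since the laplacian acts on the [k]-th coefficient as [D^2 - |k|^2]. *)
Definition polyharmonic_chain (u : V -> R) (j : nat) (t : R) : R :=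
  let v := iter j./2 (@laplacian R n) u in
  if odd j then sample_coef cos (partial None v) t - frequency R k * sample_coef cos v t
  else sample_coef cos v t.

Lemma chain_polyharmonic (u : V -> R) s : torus_periodic u ->
  cont_diff_on (2 * (2 * s)) O u ->
  chain `]a, b[ (alternating (frequency R k)) s.*2.*2 (polyharmonic_chain u).
Proof.
move=> pu cu j t jN; rewrite /= in_itv/= => tab.
set v := iter j./2 (@laplacian R n) u.
have pv : torus_periodic v by exact: torus_periodic_iter_laplacian.
have cv : cont_diff_on 2 O v.
  apply: cont_diff_on_iter_laplacian => //; apply: cont_diff_on_le cu.
  have := odd_double_half j; move: jN; rewrite -!muln2; lia.
have cv1 : cont_diff_on 1 O v by exact: cont_diff_on_le cv.
have dv := time_derivative pv cv1 tab.
have [_ dv'] := cv; have [_ cv'] := dv' None.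
have ddv := time_derivative (torus_periodic_partial None pv) cv' tab.
rewrite /alternating; have [oj|ej] := boolP (odd j).
  have Ej : polyharmonic_chain u j =
      sample_coef cos (partial None v) - frequency R k *: sample_coef cos v.
    by apply/funext => t'; rewrite /polyharmonic_chain oj.
  have Ej1 : polyharmonic_chain u j.+1 t = sample_coef cos (laplacian v) t.
    by rewrite /polyharmonic_chain /= oj /= uphalf_half oj add1n iterS.
  have Ejt : polyharmonic_chain u j t =
      sample_coef cos (partial None v) t - frequency R k * sample_coef cos v t by rewrite Ej.
  rewrite Ej1 laplacian_coef// Ejt Ej.
  have := is_deriveB ddv (is_deriveZ (frequency R k) dv).
  move: (sample_coef cos (partial None (partial None v)) t) => x2.
  move: (sample_coef cos (partial None v) t) => x1; move: (sample_coef cos v t) => x0.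
  move: (frequency R k) => f D; apply: (is_derive_eq D).
  rewrite /GRing.scale/=; ring.
have Ej : polyharmonic_chain u j = sample_coef cos v.
  by apply/funext => t'; rewrite /polyharmonic_chain (negbTE ej).
have Ej1 : polyharmonic_chain u j.+1 t =
    sample_coef cos (partial None v) t - frequency R k * sample_coef cos v t.
  by rewrite /polyharmonic_chain /= ej uphalf_half (negbTE ej) add0n.
by rewrite Ej1 Ej; apply: is_derive_eq; rewrite subrK.
Qed.

End polyharmonic.

(** * Fourier coefficients are exponential polynomials *)

Section fourier_coefficients_polyharmonic.
Variables (R : realType) (n : nat).
Local Notation X := (cylinder R n).
Local Notation V := (R * 'rV[R]_n)%type.
Variables (a b : R).
Hypothesis ab : a < b.

Lemma interior_points N : exists zs : seq R,
  [/\ sorted <%R zs, size zs = N & forall z, z \in zs -> a < z < b].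
Proof.
pose x (j : nat) : R := a + (b - a) * (j.+1%:R / N.+1%:R).
have ba0 : 0 < b - a by rewrite subr_gt0.
exists [seq x j | j <- iota 0 N]; split.
- rewrite sorted_map; apply: sub_sorted (iota_ltn_sorted 0 N) => i j ij /=.
  by rewrite /x ltrD2l ltr_pM2l// ltr_pM2r ?invr_gt0// ltr_nat ltnS.
- by rewrite size_map size_iota.
- move=> _ /mapP[j +] ->; rewrite mem_iota add0n /= => jN.
  have h1 : (0 : R) < j.+1%:R / N.+1%:R by rewrite divr_gt0.
  have h2 : j.+1%:R / N.+1%:R < (1 : R) by rewrite ltr_pdivrMr// mul1r ltr_nat ltnS.
  have h3 : 0 < (b - a) * (j.+1%:R / N.+1%:R) by rewrite mulr_gt0.
  have h4 : (b - a) * (j.+1%:R / N.+1%:R) < b - a by rewrite gtr_pMr.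
  move: h3 h4; rewrite /x; move: (_ * _) => q h3 h4.
  by apply/andP; split; lra.
Qed.

(** Interpolate [F 0] by the kernel at as many interior points as there are operators. The
    difference is a chain with that many zeros whose last function is 0, hence it vanishes. *)
Lemma chain_combination s (kap : R) (F : nat -> R -> R) : (0 < s)%N ->
  chain `]a, b[ (alternating kap) s.*2.*2 F ->
  (forall t, a < t < b -> F s.*2.*2 t = 0) ->
  exists c : 'rV[R]_(s.*2.*2).+1, c 0 ord0 = 0 /\
    forall t, a < t < b -> F 0%N t = combination (@exp_system R kap s) c t.
Proof.
case: s => // s _ cF FN; pose N := s.+1.*2.*2.
have [zs [zs_sorted szs zsab]] := interior_points N.
pose x (j : 'I_N) := nth 0 zs j.
have injx : injective x.
  move=> i j /eqP; rewrite nth_uniq ?szs//; first by move=> /eqP/val_inj.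
  exact: lt_sorted_uniq.
have [c c0 cx] := @chebyshev_interpolation R s.*2.+1 (alternating kap) (@exp_system R kap s.+1)
  (@exp_system_chain R kap s.+1 setT) (@exp_system_kernel R kap s.+1)
  (@exp_system_free R kap s.+1) x (fun j => F 0%N (x j)) injx.
exists c; split=> // t tab.
pose G j y := F j y - \sum_i c 0 i * @exp_system R kap s.+1 i j y.
have cG : chain `]a, b[ (alternating kap) N G.
  move=> j y jN yab.
  have D1 := cF j y jN yab.
  have D2 := @chain_sum R `]a, b[ (alternating kap) N _ (c 0) (@exp_system R kap s.+1)
    (@exp_system_chain R kap s.+1 `]a, b[) j y jN yab.
  by apply: (is_derive_eq (is_deriveB D1 D2)); rewrite /G; ring.
have GN y : `]a, b[%classic y -> G N y = 0.
  rewrite /= in_itv/= => yab; rewrite /G FN// big_ord_recl c0 mul0r sub0r big1 ?addr0 ?oppr0// => i _.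
  by rewrite exp_system_kernel mulr0.
have Gzs z : z \in zs -> `]a, b[%classic z /\ G 0%N z = 0.
  move=> zzs; split; first by rewrite /= in_itv/=; exact: zsab.
  have iN : (index z zs < N)%N by rewrite -szs index_mem.
  have := cx (Ordinal iN); rewrite /x /= nth_index// /combination /lin => E.
  by rewrite /G E subrr.
have Iab : is_interval (`]a, b[%classic : set R) by exact: interval_is_interval.
have tab' : `]a, b[%classic t by rewrite /= in_itv.
have := chain_eq0 Iab cG GN zs_sorted szs Gzs tab'.
by rewrite /G => /eqP; rewrite subr_eq0 => /eqP.
Qed.

Variables (d : measure_display) (T : measurableType d) (P : probability T R).
Variable theta : T -> 'rV[R]_n.
Hypothesis thetaP : is_uniform_sample P theta.

Let bP : bounded_functional (Rintegral P setT).
Proof. exact: bfun_Rintegral (probability_lty P). Qed.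

Lemma slab_slice_continuous (g : X -> R) t : {within slab a b, continuous g} -> a <= t <= b ->
  continuous (fun y : 'rV[R]_n => g (t, torus_proj y)).
Proof.
move=> cg tab y.
apply: (@cvg_within_comp 'rV[R]_n X R (slab a b) g (nbhs y) (fun y => (t, torus_proj y)) (t, torus_proj y)) => //.
have c1 : (fun=> t) @ nbhs y --> nbhs t by exact: cvg_cst.
have c2 : @torus_proj R n @ nbhs y --> nbhs (torus_proj y) by exact: torus_proj_continuous.
exact: (cvg_pair c1 c2).
Qed.

Lemma slice_lattice_periodic (g : X -> R) (t : R) :
  lattice_periodic (fun y : 'rV[R]_n => g (t, torus_proj y)).
Proof. by move=> y m; congr (g (_, _)); apply/torus_projP; exists m. Qed.

Lemma bounded_measurable_slab_slice (g : X -> R) t : {within slab a b, continuous g} ->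
  a <= t <= b -> bounded_measurable (fun w => g (t, torus_proj (theta w))).
Proof.
move=> cg tab.
apply: (bounded_measurable_sample thetaP (F := fun y => g (t, torus_proj y))).
  exact: slice_lattice_periodic.
exact: slab_slice_continuous.
Qed.

Lemma interior_sequence t : a <= t <= b -> exists u : nat -> R,
  (forall m, a < u m < b) /\ u @ \oo --> t.
Proof.
move=> /andP[ta tb]; pose mid := (a + b) / 2.
exists (fun m => t + (mid - t) * m.+1%:R^-1); split=> [m|].
  have h1 : (0 : R) < m.+1%:R^-1 by rewrite invr_gt0.
  have h2 : m.+1%:R^-1 <= (1 : R) by rewrite invf_le1// ler1n.
  move: h1 h2; move: (m.+1%:R^-1) => q q0 q1.
  have p1 : 0 <= (1 - q) * (t - a) by rewrite mulr_ge0// subr_ge0.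
  have p2 : 0 <= (1 - q) * (b - t) by rewrite mulr_ge0// subr_ge0.
  have p3 : 0 < q * (b - a) by rewrite mulr_gt0// subr_gt0.
  by rewrite /mid; apply/andP; split; lra.
rewrite -[X in _ --> X]addr0 -(mulr0 (mid - t)).
apply: cvgD; first exact: cvg_cst.
by apply: cvgM; [exact: cvg_cst|exact: cvg_harmonic].
Qed.

Lemma fourier_coef_cvg (g : X -> R) k (u : nat -> R) t : {within slab a b, continuous g} ->
  (forall m, a <= u m <= b) -> a <= t <= b -> u @ \oo --> t ->
  fourier_coef P theta k g (u m) @[m --> \oo] --> fourier_coef P theta k g t.
Proof.
move=> cg uab tab ut; have [M gM] := slab_bounded cg.
have bc := bounded_measurable_cos_theta thetaP.1 k.
apply: (bfun_cvg bP (M := M)).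
- by move=> m; apply: bounded_measurableM => //; exact: bounded_measurable_slab_slice.
- move=> m w; rewrite normrM -[M]mulr1 ler_pM//; last exact: cos_max.
  by apply: gM; split=> //=; rewrite in_itv/=; exact: uab.
- by apply: bounded_measurableM => //; exact: bounded_measurable_slab_slice.
- move=> w; apply: cvgM; last exact: cvg_cst.
  apply: (@cvg_within_comp nat X R (slab a b) g \oo (fun m => (u m, torus_proj (theta w)))
    (t, torus_proj (theta w))) => //.
  + by move=> m; split=> //=; rewrite in_itv/=; exact: uab.
  + have c2 : (fun=> torus_proj (theta w)) @ \oo --> nbhs (torus_proj (theta w)) by exact: cvg_cst.
    exact: (cvg_pair ut c2).
Qed.

Lemma fourier_coef_exponential (g : X -> R) k s : (0 < s)%N ->
  {within slab a b, continuous g} ->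
  polyharmonic_on (2 * s) (`]a, b[ `*` setT) (fun x : V => g (x.1, torus_proj x.2)) ->
  exists c : 'rV[R]_(s.*2.*2).+1, c 0 ord0 = 0 /\
    forall t, a <= t <= b -> fourier_coef P theta k g t =
      combination (@exp_system R (frequency R k) s) c t.
Proof.
move=> s0 cg [cu lu]; set u := (fun x : V => _) in cu lu.
have pu : torus_periodic u by move=> t; exact: slice_lattice_periodic.
have cF := chain_polyharmonic thetaP k pu cu.
have F0 : polyharmonic_chain P theta k u 0 = fourier_coef P theta k g by [].
have FN t : a < t < b -> polyharmonic_chain P theta k u s.*2.*2 t = 0.
  move=> tab; rewrite /polyharmonic_chain odd_double doubleK /sample_coef.
  rewrite (_ : (fun _ => _) = fun=> 0); first exact: (bfun0 bP).
  by apply/funext => w; rewrite -mul2n lu ?mul0r.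
have [c [c0 cE]] := chain_combination s0 cF FN.
(* The chain lives on the open interval; the end points are reached as limits, by continuity of both
   sides on [[a, b]]. *)
exists c; split=> // t tab; have [v [vab vt]] := interior_sequence tab.
have vab' m : a <= v m <= b by have /andP[/ltW -> /ltW ->] := vab m.
have := fourier_coef_cvg (k := k) cg vab' tab vt.
rewrite (_ : (fun m => _) = fun m => combination (@exp_system R (frequency R k) s) c (v m)); last first.
  by apply/funext => m; rewrite -F0 cE.
move=> L1; have L2 : combination (@exp_system R (frequency R k) s) c (v m) @[m --> \oo] -->
    combination (@exp_system R (frequency R k) s) c t.
  apply: (@cvg_comp _ _ _ v (combination (@exp_system R (frequency R k) s) c) _ (nbhs t)) => //.
  apply: cvg_sum_ord => i; apply: cvgM; [exact: cvg_cst|exact: continuous_exp_system].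
by rewrite -(cvg_lim (@Rhausdorff R) L1) -(cvg_lim (@Rhausdorff R) L2).
Qed.

End fourier_coefficients_polyharmonic.

Section complex_topology.
Variable R : realType.

Lemma continuous_Re : continuous (@complex.Re R : (R[i])^o -> R).
Proof.
move=> z N /nbhs_ballP[e /= e0 eN]; apply/(@nbhs_ballP _ (R[i])^o).
exists (e%:C)%C; first by rewrite /= ltcR.
move=> w; rewrite /ball/= => zw; apply: eN; rewrite /ball/= -ltcR; apply: le_lt_trans zw.
by rewrite -raddfB; exact: normc_ge_Re.
Qed.

Lemma continuous_Im : continuous (@complex.Im R : (R[i])^o -> R).
Proof.
move=> z N /nbhs_ballP[e /= e0 eN]; apply/(@nbhs_ballP _ (R[i])^o).
exists (e%:C)%C; first by rewrite /= ltcR.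
move=> w; rewrite /ball/= => zw; apply: eN; rewrite /ball/= -ltcR; apply: le_lt_trans zw.
by rewrite -raddfB normc_def lecR -sqrtr_sqr ler_wsqrtr// lerDr sqr_ge0.
Qed.

Lemma continuous_real_complex : continuous (fun x : R => (x%:C)%C : (R[i])^o).
Proof.
move=> x N /(@nbhs_ballP _ (R[i])^o)[e /= e0 eN]; apply/nbhs_ballP.
have eE : e = ((complex.Re e)%:C)%C.
  by apply/eqP; rewrite eq_complex /= eqxx /=; move: e0; rewrite ltcE /= => /andP[/eqP -> _].
exists (complex.Re e) => /=; first by move: e0; rewrite eE ltcR.
move=> y; rewrite /ball /= => xy; apply: eN; rewrite /ball /=.
by rewrite -rmorphB /= normc_def /= expr0n addr0 sqrtr_sqr eE ltcR.
Qed.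

End complex_topology.

(** * Separated polyharmonic functions *)

Section modes.
Variables (R : realType) (n : nat).
Local Notation X := (cylinder R n).
Local Notation V := (R * 'rV[R]_n)%type.
Variable k : 'rV[int]_n.

Lemma is_derive_from_line (v : V -> R) (x e : V) (df : R) :
  is_derive (0 : R) 1 (fun h : R => v (h *: e + x)) df -> is_derive x e v df.
Proof.
have E : (fun h : R => h^-1 *: (v ((h *: 1 + 0 : R) *: e + x) - v ((0 : R) *: e + x))) =
    (fun h : R => h^-1 *: (v (h *: e + x) - v x)).
  by apply/funext => h; rewrite addr0 [h *: 1]mulr1 scale0r add0r.
by move=> [d1 d2]; split; [move: d1; rewrite /derivable E|move: d2; rewrite /derive E].
Qed.

(** Both [al] and [be] are carried because a derivative in [y] exchanges cosine and sine; the family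
    is then closed under all partial derivatives. *)
Definition mode (rho : R) (p : {poly R}) (al be : R) (x : V) : R :=
  epoly rho p x.1 * (al * cos (phase k x.2) + be * sin (phase k x.2)).

Definition dcoef (i : option 'I_n) (rho : R) (p : {poly R}) (al be : R) : V -> R :=
  if i is Some j then mode rho p (be * (k 0 j)%:~R) (- (al * (k 0 j)%:~R))
  else mode rho (p^`() + rho *: p) al be.

Lemma is_derive_mode i rho p al be x :
  is_derive x (coord_vec R i) (mode rho p al be) (dcoef i rho p al be x).
Proof.
apply: is_derive_from_line; case: i => [j|] /=.
- rewrite (_ : (fun h : R => _) = fun h : R => epoly rho p x.1 *
      (al * cos (h * (k 0 j)%:~R + phase k x.2) + be * sin (h * (k 0 j)%:~R + phase k x.2))); last first.
    apply/funext => h; rewrite /mode /=.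
    by rewrite phaseDr phaseZ phase_deltar [h *: 0]mulr0 add0r.
  apply: is_derive_eq.
  rewrite mul0r add0r /mode /GRing.scale/=; ring.
- rewrite (_ : (fun h : R => _) = fun h : R => (al * cos (phase k x.2) + be * sin (phase k x.2)) *
      epoly rho p (h + x.1)); last first.
    apply/funext => h; rewrite /mode /= scaler0 add0r mulrC.
    by rewrite [h *: 1]mulr1.
  apply: is_derive_eq.
  rewrite add0r /mode /GRing.scale/=; ring.
Qed.

Lemma partial_mode i rho p al be : partial i (mode rho p al be) = dcoef i rho p al be.
Proof. by apply/funext => x; have [_] := is_derive_mode i rho p al be x. Qed.

Lemma continuous_mode rho p al be : continuous (mode rho p al be).
Proof.
move=> x; apply: cvgM.
  by apply: (@continuous_comp _ _ _ fst (epoly rho p)); [exact: cvg_fst|exact: continuous_epoly].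
have cp : {for x, continuous (fun x : V => phase k x.2)}.
  by apply: (@continuous_comp _ _ _ snd (phase k)); [exact: cvg_snd|exact: continuous_phase].
apply: cvgD; (apply: cvgM; first exact: cvg_cst).
  by apply: (@continuous_comp _ _ _ (fun x : V => phase k x.2) cos) => //; exact: continuous_cos.
by apply: (@continuous_comp _ _ _ (fun x : V => phase k x.2) sin) => //; exact: continuous_sin.
Qed.

Lemma cont_diff_on_mode m O rho p al be : cont_diff_on m O (mode rho p al be).
Proof.
elim: m rho p al be => [|m IH] rho p al be /=; split=> //; try by move=> x _; exact: continuous_mode.
move=> i; split=> [x _|]; first by have [] := is_derive_mode i rho p al be x.
by rewrite partial_mode; case: i => [j|] /=; exact: IH.
Qed.

Lemma laplacian_mode rho p : laplacian (mode rho p 1 0) =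
  mode rho ((p^`() + rho *: p)^`() + rho *: (p^`() + rho *: p) - (frequency R k ^+ 2) *: p) 1 0.
Proof.
apply/funext => x; rewrite /laplacian sum_option partial_mode /= partial_mode /=.
rewrite (eq_bigr (fun j => - ((k 0 j)%:~R ^+ 2 * mode rho p 1 0 x))) => [|j _]; last first.
  by rewrite partial_mode /= partial_mode /= /mode; ring.
rewrite sumrN -mulr_suml -frequency_sqr /mode.
rewrite [epoly rho (_ - _) _]/epoly hornerD hornerN hornerZ /epoly; ring.
Qed.

(** One Laplacian is two steps of the chain, [D - |k|] and [D + |k|]. *)
Lemma iter_laplacian_mode rho p m : iter m (@laplacian R n) (mode rho p 1 0) =
  mode rho (poly_chain (alternating (frequency R k)) rho p m.*2) 1 0.
Proof.
elim: m => [//|m IH]; rewrite iterS IH laplacian_mode doubleS.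
rewrite [poly_chain _ _ _ _.+2]/= alternating_odd alternating_even.
congr (mode rho _ 1 0); move: (poly_chain _ _ _ _) => q.
rewrite -!mul_polyC !derivD !derivM !derivC opprK polyCB polyCD polyCM; ring.
Qed.

Lemma polyharmonic_mode s (i : 'I_(s.*2.*2)) O :
  polyharmonic_on (2 * s) O
    (fun x : V => @exp_system R (frequency R k) s (lift ord0 i) 0 x.1 * cos (phase k x.2)).
Proof.
set dt := exp_system_data (frequency R k) s (lift ord0 i).
have -> : (fun x : V => @exp_system R (frequency R k) s (lift ord0 i) 0 x.1 * cos (phase k x.2)) =
    mode dt.1 dt.2 1 0.
  by apply/funext => x; rewrite /mode mul1r mul0r addr0.
split; first exact: cont_diff_on_mode.
move=> x _; rewrite iter_laplacian_mode /mode -/dt.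
have := @exp_system_kernel R (frequency R k) s i x.1.
by rewrite /exp_system -/dt -mul2n -mul2n mul2n => ->; rewrite mul0r.
Qed.

Lemma iter_laplacian0 p (x : V) : iter p (@laplacian R n) (fun=> 0) x = 0.
Proof.
have -> : iter p (@laplacian R n) (fun=> 0) = fun=> 0; last by [].
elim: p => [//|p IH]; rewrite iterS IH; apply/funext => y.
rewrite /laplacian big1// => i _.
have -> : partial i (fun=> 0) = (fun=> 0) :> (V -> R).
  by apply/funext => z; rewrite /partial derive_cst.
by rewrite /partial derive_cst.
Qed.

(** These test functions extract the exponential moments of each component from equality of
    integrals on [PH]. *)
Lemma PH_mode (a b : R) s (i : 'I_(s.*2.*2)) :
  PH (2 * s) a b (fun x : X =>
    ((@exp_system R (frequency R k) s (lift ord0 i) 0 x.1 * tcos k x.2)%:C)%C).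
Proof.
split; [|split].
- apply: continuous_subspaceT => x.
  apply: (@continuous_comp _ _ _ (fun x : X => exp_system (frequency R k) (lift ord0 i) 0 x.1 * tcos k x.2)
    (fun r : R => (r%:C)%C : (R[i])^o)); last exact: continuous_real_complex.
  apply: cvgM; last exact: continuous_tcos.
  apply: (@continuous_comp _ _ _ fst (exp_system (frequency R k) (lift ord0 i) 0)); first exact: cvg_fst.
  exact: continuous_exp_system.
- rewrite (_ : (fun x => _) = (fun x : V => @exp_system R (frequency R k) s (lift ord0 i) 0 x.1 *
    cos (phase k x.2))); first exact: polyharmonic_mode.
  by apply/funext => x; rewrite /periodic_ext /= tcos_proj.
- split; first exact: (cont_diff_on_cst _ _ 0).
  by move=> x _; exact: iter_laplacian0.
Qed.

End modes.

(** * Discrete components and uniqueness *)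

Lemma seq_card_le (T : eqType) (x0 : T) (s : seq T) : ([set` s] #<= `I_(size s))%card.
Proof.
apply: (@card_le_trans _ _ _ (nth x0 s @` `I_(size s))); last exact: card_image_le.
apply: subset_card_le => x /= xs; exists (index x s); first by rewrite /= index_mem.
exact: nth_index.
Qed.

Lemma card_le_seq (T : choiceType) (S : set T) m : (S #<= `I_m)%card ->
  exists s : seq T, [/\ uniq s, (size s <= m)%N & S = [set` s]].
Proof.
move=> Sm; have fS : finite_set S by apply/finite_set_leP; exists m.
have [k Sk] := (finite_setP S).1 fS.
exists (finmap.enum_fset (fset_set S)); split.
- exact: finmap.fset_uniq.
- have E := card_fset_set Sk.
  move: Sm; rewrite (card_le_eql Sk) card_le_II; congr (_ <= _)%N.
  by rewrite -E.
- by rewrite -[LHS](fset_setK fS).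
Qed.

Lemma measure_fin_num d (T : measurableType d) (R : realType) (nu : {measure set T -> \bar R})
  (A : set T) : (nu setT < +oo)%E -> measurable A -> nu A \is a fin_num.
Proof.
move=> nuT mA; rewrite ge0_fin_numE//; apply: le_lt_trans nuT.
by apply: le_measure; rewrite ?inE.
Qed.

Lemma set_seq_cons (T : eqType) (z : T) (s : seq T) : [set` z :: s] = [set z] `|` [set` s].
Proof.
apply/seteqP; split=> y /=; rewrite inE.
  by move=> /orP[/eqP|]; [left|right].
by case=> [->|ys]; rewrite ?eqxx// ys orbT.
Qed.

Lemma measurable_seq (R : realType) (s : seq R) : measurable ([set` s] : set (measurableTypeR R)).
Proof.
elim: s => [|z s IH]; first by rewrite set_nil.
by rewrite set_seq_cons; apply: measurableU => //; exact: measurable_set1.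
Qed.

Section discrete_measures.
Variable R : realType.
Local Notation TR := (measurableTypeR R).

Lemma bfun_point_sum_borel (q : seq R * (R -> R)) :
  bounded_functional (point_sum q : (TR -> R) -> R).
Proof.
have [bD bZ bC] := bfun_point_sum q.
split=> [f g [mf fM] [mg gM]|c f [mf fM]|F f M bF FM [mf fM] Ff].
- exact: bD.
- exact: bZ.
- by apply: (bC F f M) => // m; have [mF FMm] := bF m.
Qed.

Lemma point_measure (q : seq R * (R -> R)) : (forall z, z \in q.1 -> 0 <= q.2 z) ->
  exists nu : {measure set TR -> \bar R},
    [/\ (nu setT < +oo)%E,
        forall f : TR -> R, bounded_measurable f -> Rintegral nu setT f = point_sum q f &
        measure_support (T := R) nu `<=` [set` q.1]].
Proof.
move=> q0; have [f _ f0|nu [nuT nuE]] := bfun_measure (bfun_point_sum_borel q).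
  by rewrite /point_sum big_seq sumr_ge0// => z /q0 qz; rewrite mulr_ge0.
exists nu; split=> // x sx; apply: contrapT => /negP xq.
pose U : set R := ~` [set` q.1].
have oU : open U.
  apply: closed_openC; have acc := hausdorff_accessible (@Rhausdorff R).
  by move/accessible_finite_set_closed : acc; apply; exact: finite_seq.
have mU : measurable (U : set TR) by exact: open_measurable.
have Ux : U x by exact/negP.
have := sx U oU Ux.
have -> : nu U = 0%E; last by rewrite ltxx.
have nuU : nu U \is a fin_num by exact: measure_fin_num.
rewrite -[LHS]fineK// -Rintegral_indicT// nuE; last exact: bounded_measurable_indic.
by rewrite /point_sum big_seq big1// => z zq; rewrite indicE memNset ?mulr0.
Qed.

Lemma null_outside_support (nu : {measure set TR -> \bar R}) (A : set TR) :
  measurable A -> A `<=` ~` measure_support (T := R) nu -> nu A = 0%E.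
Proof.
move=> mA AS; pose B (p : rat * rat) : set TR := `]ratr p.1, ratr p.2[%classic.
apply: (@measure_null_cover _ _ _ nu _ B) => // [p|x /AS]; first exact: measurable_itv.
rewrite /measure_support /= => /existsNP[U /not_implyP[oU /not_implyP[Ux nU]]].
have U0 : nu U = 0%E.
  apply/eqP; rewrite eq_le measure_ge0 andbT leNgt; apply/negP; exact: nU.
have /nbhs_ballP[e /= e0 eU] : nbhs (x : R) U by exact: open_nbhs_nbhs.
have xe : x - e < x by rewrite ltrBlDr ltrDl.
have xe' : x < x + e by rewrite ltrDl.
have [al] := rat_in_itvoo xe; rewrite in_itv/= => /andP[a1 a2].
have [be] := rat_in_itvoo xe'; rewrite in_itv/= => /andP[b1 b2].
exists (al, be); first by rewrite /B/= in_itv/=; apply/andP.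
apply/eqP; rewrite eq_le measure_ge0 andbT -U0.
apply: le_measure; rewrite ?inE; [exact: measurable_itv|exact: open_measurable|].
move=> y; rewrite /B /= in_itv/= => /andP[y1 y2]; apply: eU; rewrite /ball/= ltr_norml.
by apply/andP; split; lra.
Qed.

(** The complement of the support is null, so the measure is the sum of its atoms on [zs]. *)
Lemma finite_support_measure (nu : {measure set TR -> \bar R}) (zs : seq R) :
  (nu setT < +oo)%E -> uniq zs -> measure_support (T := R) nu = [set` zs] ->
  forall f : TR -> R, bounded_measurable f ->
    Rintegral nu setT f = point_sum (zs, fun z => fine (nu [set z])) f.
Proof.
move=> nuT uz nuS f; apply: bfun_ext; first exact: bfun_Rintegral.
  exact: bfun_point_sum_borel.
move=> A mA; rewrite Rintegral_indicT//.
have nufin (B : set TR) : measurable B -> nu B \is a fin_num.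
  exact: measure_fin_num.
have mz (s : seq R) := measurable_seq s.
have H (s : seq R) : uniq s -> fine (nu (A `&` [set` s])) =
    point_sum (s, fun z => fine (nu [set z])) \1_A.
  rewrite /point_sum /=; elim: s => [|z s IH] /=.
    by rewrite set_nil setI0 measure0 big_nil.
  move=> /andP[zs' us]; rewrite big_cons -IH// set_seq_cons setIUr measureU; last 3 first.
  - by apply: measurableI => //; exact: measurable_set1.
  - exact: measurableI.
  - apply/seteqP; split=> // y /= [[_ ->] [_ zs2]].
    by rewrite zs2 in zs'.
  have fA : nu (A `&` [set z]) \is a fin_num.
    by apply: nufin; apply: measurableI => //; exact: measurable_set1.
  have fB : nu (A `&` [set` s]) \is a fin_num by apply: nufin; exact: measurableI.
  rewrite fineD//.
  congr (_ + _); rewrite indicE; have [/set_mem Az|/negP Az] := boolP (z \in A).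
    by rewrite mulr1; congr (fine (nu _)); apply/seteqP; split=> y /= => [[]|->].
  rewrite mulr0 (_ : _ `&` _ = set0) ?measure0//; apply/seteqP; split=> // y /= [Ay yz].
  by apply: Az; rewrite inE -yz.
rewrite -H// -nuS; congr fine; set S := measure_support _ in nuS *.
have mS : measurable (S : set TR) by rewrite nuS.
have mAS : measurable (A `&` ~` S) by apply: measurableI => //; exact: measurableC.
have {1}-> : A = (A `&` S) `|` (A `&` ~` S) by rewrite -setIUr setUv setIT.
have mAS' : measurable (A `&` S) by exact: measurableI.
rewrite measureU//; last by rewrite setIACA setICr setI0.
by rewrite [X in (_ + X)%E](null_outside_support mAS) ?adde0.
Qed.

End discrete_measures.

Section moments.
Variable R : realType.

Lemma cut_combination (a b kap : R) s (l : (R -> R) -> R) q (c : 'rV[R]_(s.*2.*2).+1) :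
  bounded_functional l -> exponential_moments a b kap s l q -> c 0 ord0 = 0 ->
  l (cut a b (combination (@exp_system R kap s) c)) =
  point_sum q (combination (@exp_system R kap s) c).
Proof.
move=> bl [_ _ mom _] c0.
have bW i : bounded_measurable (cut a b (@exp_system R kap s i 0%N)).
  by apply: bounded_measurable_cut; exact: continuous_exp_system.
transitivity (\sum_i l (fun t => c 0 i * cut a b (@exp_system R kap s i 0%N) t)).
  rewrite -(bfun_sum bl) => [|i]; last exact: bounded_measurableZ.
  by congr l; apply/funext => t; rewrite /cut mulr_suml; apply: eq_bigr => i _; rewrite mulrA.
transitivity (\sum_i c 0 i * point_sum q (@exp_system R kap s i 0%N)); last first.
  rewrite /point_sum; under eq_bigr do rewrite mulr_sumr.
  rewrite exchange_big; apply: eq_bigr => z _ /=; rewrite /combination /lin mulr_sumr.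
  by apply: eq_bigr => i _; rewrite mulrCA.
apply: eq_bigr => i _; rewrite (bfunZ bl)//; case: (unliftP ord0 i) => [j ->|->].
  by rewrite mom.
by rewrite c0 !mul0r.
Qed.

(** The union of both node sets has at most [4 s] points. Padded with points of weight 0 to exactly
    [4 s], the difference of the two sums annihilates the kernel, so all its weights are 0. *)
Lemma exponential_moments_unique (kap : R) s (q q' : seq R * (R -> R)) : (0 < s)%N ->
  uniq q.1 -> (size q.1 <= s.*2)%N -> uniq q'.1 -> (size q'.1 <= s.*2)%N ->
  (forall i : 'I_(s.*2.*2), point_sum q (@exp_system R kap s (lift ord0 i) 0%N) =
     point_sum q' (@exp_system R kap s (lift ord0 i) 0%N)) ->
  forall g, point_sum q g = point_sum q' g.
Proof.
case: s => // s _ uq sq uq' sq' mom g.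
pose zs := undup (q.1 ++ q'.1).
pose D z := (z \in q.1)%:R * q.2 z - (z \in q'.1)%:R * q'.2 z.
have sum_zs (r : seq R * (R -> R)) (h : R -> R) : uniq r.1 -> {subset r.1 <= zs} ->
    \sum_(z <- zs) (z \in r.1)%:R * r.2 z * h z = point_sum r h.
  move=> ur rzs; rewrite /point_sum (bigID (mem r.1)) /= [X in _ + X]big1 ?addr0.
    rewrite -big_filter (perm_big r.1); last first.
      apply: uniq_perm => //; first by rewrite filter_uniq// undup_uniq.
      by move=> z; rewrite mem_filter andb_idr//; exact: rzs.
    by rewrite big_seq [RHS]big_seq; apply: eq_bigr => z ->; rewrite mul1r.
  by move=> z /negbTE ->; rewrite !mul0r.
have qzs : {subset q.1 <= zs} by move=> z zq; rewrite mem_undup mem_cat zq.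
have qzs' : {subset q'.1 <= zs} by move=> z zq; rewrite mem_undup mem_cat zq orbT.
have sumD h : \sum_(z <- zs) D z * h z = point_sum q h - point_sum q' h.
  rewrite -(sum_zs q)// -(sum_zs q')// -sumrB; apply: eq_bigr => z _.
  by rewrite /D mulrBl.
have szs : (size zs <= s.+1.*2.*2)%N.
  apply: leq_trans (size_undup _) _; rewrite size_cat.
  by apply: leq_trans (leq_add sq sq') _; rewrite -!muln2; lia.
have [x injx xzs] := @seq_extension R s.*2.+1 zs (undup_uniq _) szs.
pose dd (j : 'I_(s.*2.+1.+1.*2)) := if (j < size zs)%N then D (x j) else 0.
have sumd h : \sum_j dd j * h (x j) = \sum_(z <- zs) D z * h z.
  pose F i := D zs`_i * h zs`_i.
  rewrite [RHS](big_nth 0) big_mkord -[RHS]/(\sum_(i < size zs) F i) (big_ord_widen _ F szs).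
  rewrite [RHS]big_mkcond; apply: eq_bigr => j _ /=; rewrite /dd.
  by case: ifP => jz; rewrite ?mul0r// xzs.
have dd0 : forall j, dd j = 0.
  apply: (@chebyshev_evaluations_free R s.*2.+1 (alternating kap) (@exp_system R kap s.+1)
    (@exp_system_chain R kap s.+1 setT) (@exp_system_kernel R kap s.+1)
    (@exp_system_free R kap s.+1) x dd injx) => i.
  rewrite (sumd (@exp_system R kap s.+1 (lift ord0 i) 0%N)) sumD.
  by apply/eqP; rewrite subr_eq0; apply/eqP; exact: mom.
apply/eqP; rewrite -subr_eq0 -sumD -sumd big1// => j _.
by rewrite dd0 mul0r.
Qed.

End moments.

(** * Existence and uniqueness of the Gauss measure *)

Section gauss_quadrature_measure.
Variables (R : realType) (n : nat).
Local Notation X := (cylinder R n).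
Variables (a b : R).
Hypothesis ab : a < b.

(** [g] is constrained on the slab only, so preimages are shown to be traces of open sets on the
    slab. *)
Lemma bounded_measurable_slab (g : X -> R) : {within slab a b, continuous g} ->
  bounded_measurable (fun x : borel X => g x * \1_(slab a b) x).
Proof.
move=> cg; split; last first.
  have [M gM] := slab_bounded cg; exists (Num.max M 0) => x; rewrite indicE.
  have [/set_mem sx|_] := boolP (_ \in _).
    by rewrite mulr1 le_max gM.
  by rewrite mulr0 normr0 le_max lexx orbT.
have mS : measurable (slab a b : set (borel X)) by exact: measurable_slab.
rewrite (_ : (fun x => _) = (g : borel X -> R) \_ (slab a b)); last first.
  by apply/funext => x; rewrite patchE indicE; case: ifP; rewrite ?mulr1 ?mulr0.
apply/(measurable_restrictT _ mS).
apply: (measurability _ (RGenOpens.measurableE R)).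
move=> _ [_ [c [e ->] <-]].
have oce : open (`]c, e[%classic : set R) by exact: interval_open.
move/subspace_continuousP : cg => cg.
pose W : set X := interior [set y | slab a b y -> (g y) \in `]c, e[].
rewrite (_ : _ `&` _ = slab a b `&` W); last first.
  apply/seteqP; split=> x [sx gx]; split=> //.
    have gxN : nbhs (g x) (`]c, e[%classic : set R) by exact: open_nbhs_nbhs.
    exact: (cg x sx _ gxN).
  exact: (interior_subset gx sx).
apply: measurableI => //; apply: sub_sigma_algebra; exact: open_interior.
Qed.

Lemma PH_real p (f : X -> R[i]) : PH p a b f ->
  [/\ {within slab a b, continuous (fun x => complex.Re (f x))},
      {within slab a b, continuous (fun x => complex.Im (f x))},
      polyharmonic_on p (`]a, b[ `*` setT) (fun x => complex.Re (f (x.1, torus_proj x.2))) &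
      polyharmonic_on p (`]a, b[ `*` setT) (fun x => complex.Im (f (x.1, torus_proj x.2)))].
Proof.
move=> [cf [pre pim]]; split => // x.
  exact: continuous_comp (cf x) (@continuous_Re R (f x)).
exact: continuous_comp (cf x) (@continuous_Im R (f x)).
Qed.

Lemma slab_component_measure (sigma : signed_measure R n) k (q : seq R * (R -> R)) :
  (forall z, z \in q.1 -> a <= z <= b /\ 0 <= q.2 z) ->
  (forall g, bounded_measurable g -> component a b sigma k g = point_sum q g) ->
  (forall g, bounded_measurable g -> sine_component a b sigma k g = 0) ->
  exists nu, [/\ component_measure a b sigma k nu,
    measure_support nu `<=` `[a, b] & (measure_support nu #<= `I_(size q.1))%card].
Proof.
move=> qab Ec Es; have [nu [nuT nuE nuS]] := point_measure (fun z zq => (qab z zq).2).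
exists nu; split.
- move=> h ch sh; have bh := bounded_measurable_compactly_supported ch sh.
  have bh' : bounded_measurable (h : measurableTypeR R -> R).
    by case: bh => mh [M hM]; split=> //; exists M.
  split; first exact: bounded_measurable_integrable.
  by rewrite nuE// character_integralE Ec// Es.
- by move=> z /nuS /= zq; rewrite in_itv/=; have [] := qab z zq.
- exact: card_le_trans (subset_card_le nuS) (seq_card_le 0 q.1).
Qed.

Lemma component_point_sum (sigma : signed_measure R n) k nu m :
  component_measure a b sigma k nu -> measure_support nu `<=` `[a, b] ->
  (measure_support nu #<= `I_m)%card ->
  exists q : seq R * (R -> R), [/\ uniq q.1, (size q.1 <= m)%N,
    forall z, z \in q.1 -> a <= z <= b &
    forall h, continuous h -> compactly_supported h ->
      component a b sigma k h = point_sum q h /\ sine_component a b sigma k h = 0].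
Proof.
move=> nuP nuab /card_le_seq[zs [uzs szs nuS]].
exists (zs, fun z => fine (nu [set z])); split=> //= [z zzs|h ch sh].
  by have := nuab z; rewrite nuS /= in_itv; apply.
have [ih] := nuP h ch sh; rewrite character_integralE => -[Ec Es].
split; last by rewrite -Es.
rewrite -Ec; apply: finite_support_measure => //.
  (* The total mass is finite: the integrable test function [h1] is 1 on [[a, b]] and so dominates
     the indicator of the support. *)
  have c1 : continuous (fun _ : R => 1 : R) by move=> x; exact: cvg_cst.
  have [h1 [ch1 sh1 h1ab h1ge]] := compact_support_extension ab c1.
  have [i1 _] := nuP h1 ch1 sh1.
  have h1p : forall t, 0 <= h1 t by apply: h1ge => t _; exact: ler01.
  have mzs := measurable_seq zs.
  pose S : set (measurableTypeR R) := measure_support (T := R) nu.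
  have mS : measurable S by rewrite /S nuS.
  have n0 : nu (~` S) = 0%E by apply: null_outside_support => //; exact: measurableC.
  have -> : nu setT = nu S.
    rewrite -[LHS](congr1 nu (setUv S)) measureU//; [|exact: measurableC|exact: setICr].
    by rewrite -[RHS]adde0; congr (_ + _)%E; exact: n0.
  have /integrableP[_ fin1] := i1; apply: le_lt_trans fin1.
  rewrite -[leLHS](congr1 nu (setIT S)) -integral_indic//.
  apply: ge0_le_integral => //.
  - by apply/measurable_EFinP; exact: measurable_indic.
  - have [mh _] := bounded_measurable_compactly_supported ch1 sh1.
    by apply/measurable_EFinP; apply: measurableT_comp => //; exact: mh.
  - move=> x _; rewrite /= lee_fin indicE; have [/set_mem/nuab|] := boolP (_ \in _).
      by rewrite /= in_itv/= => /h1ab ->; rewrite normr1.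
    by rewrite normr_ge0.
have bh := bounded_measurable_compactly_supported ch sh.
by case: bh => mh [M hM]; split=> //; exists M.
Qed.

Variables (d : measure_display) (T : measurableType d) (P : probability T R).
Variable theta : T -> 'rV[R]_n.
Hypothesis thetaP : is_uniform_sample P theta.
Variables (s : nat) (mu sigma : signed_measure R n) (q : 'rV[int]_n -> seq R * (R -> R)).
Hypothesis s0 : (0 < s)%N.
Hypothesis qP : forall k, exponential_moments a b (frequency R k) s (component a b mu k) (q k).
Hypothesis Ec : forall k g, bounded_measurable g -> component a b sigma k g = point_sum (q k) g.
Hypothesis Es : forall k g, bounded_measurable g -> sine_component a b sigma k g = 0.
Hypothesis Ef : forall f : borel X -> R, bounded_measurable f ->
  (forall k, component a b mu k (fourier_coef P theta k f) =
             point_sum (q k) (fourier_coef P theta k f)) ->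
  charge_Rintegral mu (slab a b) f = charge_Rintegral sigma (slab a b) f.

Lemma component_eq (nu : signed_measure R n) k g h :
  (forall t, a <= t <= b -> g t = h t) -> component a b nu k g = component a b nu k h.
Proof.
by move=> gh; apply: eq_slab_integral => x [+ _]; rewrite /= in_itv/= => /gh ->.
Qed.

Lemma polyharmonic_integral_eq (g : X -> R) : {within slab a b, continuous g} ->
  polyharmonic_on (2 * s) (`]a, b[ `*` setT) (fun x : R * 'rV[R]_n => g (x.1, torus_proj x.2)) ->
  charge_Rintegral mu (slab a b) g = charge_Rintegral sigma (slab a b) g.
Proof.
(* Off the slab [g] is arbitrary; the cut makes it bounded measurable and keeps its Fourier
   coefficients over [[a, b]]. *)
move=> cg pg; pose f (x : borel X) := g x * \1_(slab a b) x.
have fg (x : X) : slab a b x -> g x = f x by move=> sx; rewrite /f indicE mem_set ?mulr1.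
rewrite !(eq_slab_integral _ fg); apply: Ef => [|k]; first exact: bounded_measurable_slab.
have [c [c0 cE]] := fourier_coef_exponential ab thetaP k s0 cg pg.
have fE t : a <= t <= b -> fourier_coef P theta k f t =
    combination (@exp_system R (frequency R k) s) c t.
  move=> tab; rewrite -cE//; congr (Rintegral _ _ _); apply/funext => w.
  by rewrite -fg//; split=> //=; rewrite in_itv.
rewrite (component_eq _ _ fE) -component_cut (cut_combination _ (qP k) c0); last exact: bfun_component.
have [_ qab _ _] := qP k.
rewrite /point_sum big_seq [RHS]big_seq; apply: eq_bigr => z zq.
by rewrite fE//; have [] := qab z zq.
Qed.

Lemma gauss_charge_gauss_measure : charge_support sigma `<=` slab a b ->
  gauss_measure s a b mu sigma.
Proof.
move=> ssi; split=> //.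
- move=> k; have [[_ sq] qab _ _] := qP k.
  have [nu [n1 n2 n3]] := slab_component_measure qab (Ec k) (Es k).
  exists nu; split=> //; apply: card_le_trans n3 _.
  by rewrite card_le_II mul2n.
- move=> f /PH_real[cre cim pre pim]; rewrite /charge_Cintegral.
  by rewrite (polyharmonic_integral_eq cre pre) (polyharmonic_integral_eq cim pim).
- apply/pseudo_positiveP => k h ch sh h0.
  have bh := bounded_measurable_compactly_supported ch sh.
  rewrite Ec// Es//; split=> //; have [_ qab _ _] := qP k.
  rewrite /point_sum big_seq sumr_ge0// => z zq; rewrite mulr_ge0//.
  by have [] := qab z zq.
Qed.

Lemma gauss_charge_unique (sigma' : signed_measure R n) : charge_support sigma `<=` slab a b ->
  gauss_measure s a b mu sigma' -> forall A, measurable A -> sigma' A = sigma A.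
Proof.
move=> ssi [ssi' nus PHeq _]; apply: signed_measure_ext ssi' ssi _ => k h ch sh.
have bh := bounded_measurable_compactly_supported ch sh.
have [nu [nuP nuab nuc]] := nus k.
have [q' [uq' sq' q'ab q'E]] := component_point_sum nuP nuab nuc.
have [E1 E2] := q'E h ch sh; rewrite E1 E2 Ec// Es//; split=> //.
have [[uq sq] qab mom _] := qP k.
apply/esym/(@exponential_moments_unique R (frequency R k) s) => //.
  by rewrite -mul2n.
move=> i; set W := exp_system _ _ _.
have cW : continuous W by exact: continuous_exp_system.
(* The components of [sigma'] are known on compactly supported functions only, so [W] is replaced by
   an extension from [[a, b]]. *)
have [hW [chW shW hWE _]] := compact_support_extension ab cW.
rewrite -mom component_cut.
have [E3 _] := q'E hW chW shW.
have -> : point_sum q' W = point_sum q' hW.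
  rewrite /point_sum big_seq [RHS]big_seq; apply: eq_bigr => z zq.
  by rewrite hWE//; exact: q'ab.
rewrite -E3 (component_eq _ _ hWE).
by have := PHeq _ (@PH_mode R n k a b s i); rewrite /charge_Cintegral => -[].
Qed.

End gauss_quadrature_measure.

Theorem theorem38 (R : realType) (d : nat) (hd : (2 <= d)%N) (a b : R)
    (hab : a < b) (mu : signed_measure R d.-1)
    (hsupp : charge_support mu `<=` slab a b)
    (hpos : pseudo_positive a b mu)
    (hC : (\esum_(k in [set: 'rV[int]_d.-1])
             (complex.Re (charge_Cintegral mu (slab a b)
                    (fun x => character k x.2)))%:E < +oo)%E) :
  forall s : nat, (1 <= s)%N ->
  exists sigma : signed_measure R d.-1,
    gauss_measure s a b mu sigma /\
    forall sigma' : signed_measure R d.-1, gauss_measure s a b mu sigma' ->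
      forall A, measurable A -> sigma' A = sigma A.
Proof.
move=> s s0; have [e [T [P [theta [mtheta theta_char]]]]] := sample_space R d.-1.
have [sigma [q [qP ssi Ec Es Ef]]] := exists_gauss_charge mtheta theta_char hab s0 hpos hC.
exists sigma; split.
  exact: (gauss_charge_gauss_measure hab (conj mtheta theta_char) s0 qP Ec Es Ef ssi).
move=> sigma' gsi'.
exact: (gauss_charge_unique hab s0 qP Ec Es ssi gsi').
Qed.
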